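(* The left-invariant complex structures (up to Lie group automorphism) on the real Lie group $\mathrm{SL}(2,\mathbb C)$ consist of the bi-invariant complex structure, a family of regular complex structures parameterised by the open unit disk, and one non-regular complex structure.
   Context: $\mathrm{SL}(2,\mathbb C)$ is the group of complex $2\times 2$ matrices of determinant $1$, regarded as a real Lie group (of real dimension $6$). A left-invariant complex structure on a real Lie group $G$ is an integrable complex structure $J$ on $G$ such that every left translation of $G$ is a biholomorphism. Two left-invariant complex structures $J,J'$ on $G$ are identified up to Lie group automorphism if there is an automorphism $\Phi$ of the real Lie group $G$ with $J'=d\Phi\circ J\circ d\Phi^{-1}$. A complex structure on $G$ is bi-invariant if all left and all right translations of $G$ are biholomorphisms. For $G$ real semisimple with Lie algebra $\mathfrak g$, a Cartan subalgebra of $\mathfrak g$ is a subalgebra $\mathfrak h$ whose complexification $\mathfrak h^{\mathbb C}$ is a Cartan subalgebra of $\mathfrak g^{\mathbb C}$, and a Cartan subgroup of $G$ is a connected Lie subgroup whose Lie algebra is a Cartan subalgebra of $\mathfrak g$. A left-invariant complex structure on $G$ is regular if it is right-invariant with respect to some Cartan subgroup $H$ of $G$, i.e. right translations by elements of $H$ are biholomorphisms. *)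

(* Defs.v *)
From HB Require Import structures.
From mathcomp Require Import all_boot all_order all_algebra.
From mathcomp Require Import complex.
From mathcomp Require Import all_classical all_reals all_analysis.

Set Implicit Arguments.
Unset Strict Implicit.
Unset Printing Implicit Defensive.

Import Order.TTheory GRing.Theory Num.Theory.
Import numFieldNormedType.Exports.

Local Open Scope classical_set_scope.
Local Open Scope ring_scope.

(** * Smooth maps on subsets of normed spaces *)

Section Smooth.
Context {R : realType}.

(* In finite dimension (the only use below) [Ck k U f] says that f is of class
   C^k on the open set U. *)
Fixpoint Ck {V W : normedModType R} (k : nat) (U : set V) (f : V -> W) : Prop :=
  match k with
  | 0 => forall x, U x -> {for x, continuous f}
  | k'.+1 => (forall x, U x -> differentiable f x) /\
             (forall v, Ck k' U (fun x => 'D_v f x))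
  end.

Definition Cinfty {V W : normedModType R} (U : set V) (f : V -> W) : Prop :=
  forall k, Ck k U f.

(* Smoothness on an arbitrary subset M of V: f is locally the restriction of a
   smooth map defined on an open subset of V. *)
Definition smooth_on {V W : normedModType R} (M : set V) (f : V -> W) : Prop :=
  forall p, M p -> exists (U : set V) (F : V -> W),
    [/\ open U, U p, Cinfty U F & forall x, U x -> M x -> F x = f x].

(* Germs at time 0 of smooth curves in M through p with velocity v. *)
Definition curve_in {V : normedModType R} (M : set V) (p v : V) (c : R -> V) :=
  [/\ c 0 = p, derive1 c 0 = v & exists U : set R,
      [/\ open U, U 0, Cinfty U c & forall t, U t -> M (c t)]].

Definition tangent {V : normedModType R} (M : set V) (p : V) : set V :=
  [set v | exists c, curve_in M p v c].

(* The differential at p of a smooth map f on M. For v tangent to M at p the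
   derivative of f along a curve in M depends only on the velocity v of the
   curve, so the choice made by [xget] is immaterial. *)
Definition differential {V W : normedModType R} (M : set V) (f : V -> W)
    (p v : V) : W :=
  xget 0 [set w | exists2 c, curve_in M p v c & w = derive1 (f \o c) 0].

End Smooth.

(** * Cartan subalgebras *)

Section LieAlgebra.
Context {K : pzRingType} {L : lmodType K} (br : L -> L -> L).

Definition subspace (h : set L) : Prop :=
  [/\ h 0, forall x y, h x -> h y -> h (x + y)
         & forall (a : K) x, h x -> h (a *: x)].

Definition lin_span (S : set L) : set L :=
  [set x | forall h, subspace h -> S `<=` h -> h x].

Definition lie_subalgebra (h : set L) : Prop :=
  subspace h /\ forall x y, h x -> h y -> h (br x y).

Fixpoint lower_central (h : set L) (k : nat) : set L :=
  match k with
  | 0 => h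
  | k'.+1 =>
      lin_span [set z | exists x y, [/\ h x, lower_central h k' y & z = br x y]]
  end.

Definition nilpotent_subalgebra (h : set L) : Prop :=
  exists k, lower_central h k `<=` [set 0].

(* h is a nilpotent self-normalising subalgebra of the Lie algebra (g, br). *)
Definition cartan_subalgebra (g h : set L) : Prop :=
  [/\ h `<=` g, lie_subalgebra h, nilpotent_subalgebra h
    & forall x, g x -> (forall y, h y -> h (br x y)) -> h x].

End LieAlgebra.

(* L (x)_R C; the pair (x, y) stands for x + i y. *)
Definition complexified {R : realType} (L : lmodType R) : Type := (L * L)%type.

Section Complexification.
Context {R : realType} (L : lmodType R).

HB.instance Definition _ :=
  GRing.Zmodule.on (complexified L).

Definition complexified_scale (a : R[i]) (z : complexified L) :
    complexified L :=
  (complex.Re a *: z.1 - complex.Im a *: z.2,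
   complex.Re a *: z.2 + complex.Im a *: z.1).

Lemma complexified_scaleA a b z :
  complexified_scale a (complexified_scale b z) = complexified_scale (a * b) z.
Proof.
case: a b z => [a1 a2] [b1 b2] [x y]; congr pair => /=;
  rewrite !(scalerDr, scalerDl, scalerBr, scalerBl, scalerA, scaleNr, scalerN) ?opprD.
all: by rewrite -!addrA; congr (_ + _); rewrite addrA addrC.
Qed.

Lemma complexified_scale1 : left_id 1 complexified_scale.
Proof.
by case=> x y; congr pair => /=; rewrite scale1r scale0r ?subr0 ?addr0.
Qed.

Lemma complexified_scaleDr : right_distributive complexified_scale +%R.
Proof.
move=> [a b] [x y] [x' y']; congr pair => /=; rewrite !scalerDr.
  by rewrite opprD addrACA.
by rewrite addrACA.
Qed.

Lemma complexified_scaleDl z :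
  {morph complexified_scale^~ z : a b / a + b}.
Proof.
case: z => [x y] [a1 a2] [b1 b2]; congr pair => /=; rewrite !scalerDl.
  by rewrite opprD addrACA.
by rewrite addrACA.
Qed.

HB.instance Definition _ :=
  GRing.Zmodule_isLmodule.Build R[i] (complexified L)
    complexified_scaleA complexified_scale1
    complexified_scaleDr complexified_scaleDl.

Definition complexified_bracket (br : L -> L -> L) (z w : complexified L) :
    complexified L :=
  (br z.1 w.1 - br z.2 w.2, br z.1 w.2 + br z.2 w.1).

Definition complexified_set (h : set L) : set (complexified L) :=
  [set z | h z.1 /\ h z.2].

Definition real_cartan_subalgebra (br : L -> L -> L) (g h : set L) : Prop :=
  [/\ h `<=` g, lie_subalgebra br h
    & cartan_subalgebra (complexified_bracket br)
        (complexified_set g) (complexified_set h)].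

End Complexification.

(** * The real Lie group SL(2, C) *)

(* The complex 2 x 2 matrices as a real normed space: (A, B) stands for
   A + i B. *)
Notation M2C R := ('M[R]_2 * 'M[R]_2)%type.

Section SL2C.
Context {R : realType}.

Definition to_cmx (x : M2C R) : 'M[R[i]]_2 :=
  \matrix_(i, j) (x.1 i j +i* x.2 i j)%C.

Definition of_cmx (A : 'M[R[i]]_2) : M2C R :=
  (\matrix_(i, j) complex.Re (A i j), \matrix_(i, j) complex.Im (A i j)).

Definition cmul (x y : M2C R) : M2C R := of_cmx (to_cmx x *m to_cmx y).

Definition cone : M2C R := of_cmx 1%:M.

Definition SL2 : set (M2C R) := [set g | \det (to_cmx g) = 1].

Definition sl2 : set (M2C R) := [set X | \tr (to_cmx X) = 0].

Definition commutator (X Y : M2C R) : M2C R := cmul X Y - cmul Y X.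

Definition left_translation (a g : M2C R) : M2C R := cmul a g.
Definition right_translation (a g : M2C R) : M2C R := cmul g a.

Definition diffeomorphism (f : M2C R -> M2C R) : Prop :=
  exists f' : M2C R -> M2C R,
    [/\ smooth_on SL2 f, smooth_on SL2 f',
        (forall g, SL2 g -> SL2 (f g) /\ SL2 (f' g)),
        (forall g, SL2 g -> f' (f g) = g)
      & (forall g, SL2 g -> f (f' g) = g)].

Definition lie_automorphism (f : M2C R -> M2C R) : Prop :=
  diffeomorphism f /\
  forall g h, SL2 g -> SL2 h -> f (cmul g h) = cmul (f g) (f h).

(** ** Connected Lie subgroups and Cartan subgroups *)

Definition subgroup (H : set (M2C R)) : Prop :=
  [/\ H `<=` SL2, H cone, forall g h, H g -> H h -> H (cmul g h)
    & forall g, H g -> exists2 g', H g' & cmul g g' = cone].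

(* [c t] is exp (t X), where X is the derivative of c at 0. *)
Definition one_parameter_subgroup (c : R -> M2C R) : Prop :=
  [/\ Cinfty setT c, forall t, SL2 (c t)
    & forall s t, c (s + t) = cmul (c s) (c t)].

Definition lie_algebra_of (H : set (M2C R)) : set (M2C R) :=
  [set X | exists c, [/\ one_parameter_subgroup c, (forall t, H (c t))
                       & derive1 c 0 = X]].

(* Connected (possibly immersed) Lie subgroups, as in Hall, Lie Groups, Lie
   Algebras, and Representations, Section 5.9: a subgroup H such that the set
   h of all X with exp (t X) in H for every t is a subspace, and such that
   every element of H is a finite product of exponentials of elements of h. *)
Definition connected_lie_subgroup (H : set (M2C R)) : Prop :=
  [/\ subgroup H, subspace (lie_algebra_of H)
    & forall h, H h -> exists s : seq (M2C R), h = foldr cmul cone s /\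
        forall x, x \in s -> exists c,
          [/\ one_parameter_subgroup c, (forall t, H (c t)) & x = c 1]].

Definition cartan_subgroup (H : set (M2C R)) : Prop :=
  connected_lie_subgroup H /\
  real_cartan_subalgebra commutator sl2 (lie_algebra_of H).

(** ** Complex structures *)

(* A field J of endomorphisms of the tangent spaces is a map taking a base point
   g and a tangent vector v at g to [J g v]; only the values at g in SL2 and v
   tangent to SL2 at g are meaningful. *)
Definition endo_field : Type := M2C R -> M2C R -> M2C R.

Definition vector_field (V : M2C R -> M2C R) : Prop :=
  smooth_on SL2 V /\ forall g, SL2 g -> tangent SL2 g (V g).

Definition lie_bracket (V W : M2C R -> M2C R) (g : M2C R) : M2C R :=
  differential SL2 W g (V g) - differential SL2 V g (W g).

Definition app_field (J : endo_field) (V : M2C R -> M2C R) (g : M2C R) :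
  M2C R := J g (V g).

Definition almost_complex_structure (J : endo_field) : Prop :=
  [/\ (forall g v, SL2 g -> tangent SL2 g v -> tangent SL2 g (J g v)),
      (forall g (a : R) u v, SL2 g -> tangent SL2 g u -> tangent SL2 g v ->
         J g (a *: u + v) = a *: J g u + J g v),
      (forall g v, SL2 g -> tangent SL2 g v -> J g (J g v) = - v)
    & (forall V, vector_field V -> smooth_on SL2 (app_field J V))].

Definition nijenhuis (J : endo_field) (V W : M2C R -> M2C R) (g : M2C R) :
    M2C R :=
  lie_bracket (app_field J V) (app_field J W) g
  - J g (lie_bracket (app_field J V) W g)
  - J g (lie_bracket V (app_field J W) g)
  - lie_bracket V W g.

Definition integrable (J : endo_field) : Prop :=
  forall V W, vector_field V -> vector_field W ->
  forall g, SL2 g -> nijenhuis J V W g = 0.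

Definition complex_structure (J : endo_field) : Prop :=
  almost_complex_structure J /\ integrable J.

(* The differential of f carries J to J', i.e. J' = df o J o df^-1 when f is a
   diffeomorphism. *)
Definition carries (f : M2C R -> M2C R) (J J' : endo_field) : Prop :=
  forall g v, SL2 g -> tangent SL2 g v ->
    J' (f g) (differential SL2 f g v) = differential SL2 f g (J g v).

Definition biholomorphism (J : endo_field) (f : M2C R -> M2C R) : Prop :=
  diffeomorphism f /\ carries f J J.

Definition left_invariant (J : endo_field) : Prop :=
  forall a, SL2 a -> biholomorphism J (left_translation a).

Definition right_invariant_under (H : set (M2C R)) (J : endo_field) : Prop :=
  forall a, H a -> biholomorphism J (right_translation a).

Definition left_invariant_complex_structure (J : endo_field) : Prop :=
  complex_structure J /\ left_invariant J.

Definition bi_invariant (J : endo_field) : Prop :=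
  left_invariant J /\ right_invariant_under SL2 J.

Definition regular (J : endo_field) : Prop :=
  exists H, cartan_subgroup H /\ right_invariant_under H J.

Definition equivalent (J J' : endo_field) : Prop :=
  exists f, lie_automorphism f /\ carries f J J'.

(* The open unit disk of C = R^2. *)
Definition unit_disk : set (R * R) := [set z | z.1 ^+ 2 + z.2 ^+ 2 < 1].

(* J z depends smoothly on the parameter z in D. *)
Definition smooth_family (D : set (R * R)) (J : R * R -> endo_field) : Prop :=
  forall g v, SL2 g -> tangent SL2 g v -> smooth_on D (fun z => J z g v).

End SL2C.

Arguments endo_field R : clear implicits.
Arguments unit_disk R : clear implicits.

(* Main.v *)
Require Import Defs.
From HB Require Import structures.
From mathcomp Require Import all_boot all_order all_algebra complex ring lra.
From mathcomp Require Import all_classical all_reals all_analysis.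

Set Implicit Arguments.
Unset Strict Implicit.
Unset Printing Implicit Defensive.
Import Order.TTheory GRing.Theory Num.Theory.
Import numFieldNormedType.Exports.
Local Open Scope classical_set_scope.
Local Open Scope ring_scope.

(* A left-invariant complex structure is a real-linear j on sl2(C) with j^2 = -1 and
   vanishing Nijenhuis tensor.  Put A = 1 - i j and B = 1 + i j: their images are complex
   subalgebras, A + B = 2, ker B = {j = i} is an ideal of im A and ker A = {j = -i} is an
   ideal of im B.  If both kernels vanished, B A^-1 would be an antilinear automorphism; its
   square fixes a nonzero vector, so it would have the eigenvalue -1, against A + B = 2.  If
   one image is everything, then j = i or j = -i.  Otherwise both images are proper and
   (after conjugation) im A is not commutative, hence it is the orthogonal of a nilpotent
   vector of ker B, say of E.  If im B is not commutative either, it is the orthogonal of F,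
   and j preserves the Cartan subalgebra C H: this gives the disk.  If im B is commutative, it
   is the line ker A, and a conjugation takes j to a member of the disk or to the non-regular
   structure.
   The structures are told apart by the centraliser {x | j [x, y] = [x, j y] for all y}, which
   contains the Lie algebra of any subgroup under which the structure is right-invariant; it
   is sl2(C), C H and 0 in the three cases. *)

(** The endomorphism [j] is only real-linear, so the complex subspaces come from A and B instead;
    replacing [j] by -[j] exchanges A and B, and each fact about B is the fact about A for [negj j].
    The bracket of sl2(C) is a cross product on a three-dimensional space, so Cramer's rule for the
    trace form does the work of dimension counts; only the passage from kernels to images counts
    real dimensions. The square of B A^-1 fixes a vector for the reason that makes every rotation of
    3-space have an axis. Two notions of automorphism are in play. Reductions to normal form use a
    few generators, each induced by a linear map on matrices, so that they lift to the group by
    inspection. Inequivalence is proved against every real automorphism of the Lie algebra, since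
    the differential of a group automorphism is known to be no more than that. On the group,
    inversion is the adjugate, which is linear, and test curves are built from 1 + tN with N^2 = 0.
    Exponentials enter only for Cartan subgroups, whose elements must be products of
    exponentials. *)

(* (a, b, c) stands for the matrix [[a, b], [c, -a]]. *)
Notation vec R := (R[i] * R[i] * R[i])%type.

(** * The bracket and the trace form of sl2(C) *)

Section Sl2Algebra.
Variable R : rcfType.
Notation C := R[i].
Local Notation vec := (vec R).
Implicit Types (u v w p q x y : vec) (j phi : vec -> vec) (l : C) (r : R).

Definition ii : C := Complex 0 1.

Definition br (u v : vec) : vec :=
  (u.1.2 * v.2 - v.1.2 * u.2,
   2 * (u.1.1 * v.1.2 - v.1.1 * u.1.2),
   2 * (u.2 * v.1.1 - v.2 * u.1.1)).

(* The trace of the product of the two matrices. *)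
Definition trform (u v : vec) : C := 2 * u.1.1 * v.1.1 + u.1.2 * v.2 + u.2 * v.1.2.

Lemma iiE : ii * ii = -1. Proof. by rewrite -expr2 sqr_i. Qed.
Lemma zeroE : (0 : vec) = (0, 0, 0). Proof. by []. Qed.
Lemma addE (a b c a' b' c' : C) :
  ((a, b, c) : vec) + (a', b', c') = (a + a', b + b', c + c').
Proof. by []. Qed.
Lemma oppE (a b c : C) : - ((a, b, c) : vec) = (- a, - b, - c).
Proof. by []. Qed.
Lemma scE (r a b c : C) : r *: ((a, b, c) : vec) = (r * a, r * b, r * c).
Proof. by []. Qed.
Lemma brE (a b c a' b' c' : C) :
  br (a, b, c) (a', b', c') =
  (b * c' - b' * c, 2 * (a * b' - a' * b), 2 * (c * a' - c' * a)).
Proof. by []. Qed.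
Lemma trformE (a b c a' b' c' : C) :
  trform (a, b, c) (a', b', c') = 2 * a * a' + b * c' + c * b'.
Proof. by []. Qed.
Lemma scCE (a b : C) : a *: b = a * b. Proof. by []. Qed.
Definition vecE := (addE, oppE, scE, brE, trformE).

Ltac vcoord := repeat match goal with
  | u : prod (prod _ _) _ |- _ => destruct u as [[? ?] ?] end;
  rewrite ?zeroE ?vecE; cbn [fst snd]; rewrite ?scCE; try (congr (_, _, _)).
Ltac vring := vcoord; ring.

Lemma brC u v : br u v = - br v u. Proof. vring. Qed.
Lemma brDl u v w : br (u + v) w = br u w + br v w. Proof. vring. Qed.
Lemma brZl l u v : br (l *: u) v = l *: br u v. Proof. vring. Qed.
Lemma brZr l u v : br u (l *: v) = l *: br u v. Proof. vring. Qed.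
Lemma brNl u v : br (- u) v = - br u v. Proof. vring. Qed.
Lemma brNr u v : br u (- v) = - br u v. Proof. vring. Qed.
Lemma brvv u : br u u = 0.
Proof. vring. Qed.
Lemma trformDr u v w : trform u (v + w) = trform u v + trform u w. Proof. vring. Qed.
Lemma trformZr u l v : trform u (l *: v) = l * trform u v. Proof. vring. Qed.
Lemma trformZl u l v : trform (l *: u) v = l * trform u v. Proof. vring. Qed.
Lemma trform_brl u v : trform (br u v) u = 0. Proof. vring. Qed.
Lemma trform_brr u v : trform (br u v) v = 0. Proof. vring. Qed.
(** The form [trform (br u v) w] is alternating and trilinear on a three-dimensional space, hence a
    multiple of the determinant; this is Cramer's rule. *)
Lemma br_trform_cramer u v w x :
  trform (br u v) w *: x =
  trform (br v w) x *: u + trform (br w u) x *: v + trform (br u v) x *: w.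
Proof. vring. Qed.
Lemma two_neq0 : (2 : C) != 0. Proof. by rewrite pnatr_eq0. Qed.

(** The formula for a double cross product, in the normalisation of the trace form. *)
Lemma br_br_trform p u q :
  trform p q *: u - trform u q *: p = (1 / 2) *: br q (br p u).
Proof. by vcoord; field. Qed.
Lemma trform_nondeg p : (forall q, trform p q = 0) -> p = 0.
Proof.
move: p => [[a b] c] h.
have ha := h (1, 0, 0); have hb := h (0, 0, 1); have hc := h (0, 1, 0).
rewrite !trformE in ha hb hc.
have {}hb : b = 0 by rewrite -hb; ring.
have {}hc : c = 0 by rewrite -hc; ring.
have {}ha : 2 * a = 0 by rewrite -ha; ring.
by move/eqP: ha; rewrite mulf_eq0 (negbTE two_neq0) => /eqP ->; rewrite hb hc.
Qed.

(** Choosing [q] with [trform p q] nonzero, the double bracket formula solves [br p u = 0] for [u]: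
    sl2 has rank one. *)
Lemma centralizer_line p u : p <> 0 -> br p u = 0 -> exists l, u = l *: p.
Proof.
move=> p0 pu.
have [q kq] : exists q, trform p q <> 0.
  apply/not_existsP => h; apply: p0; apply: trform_nondeg => q.
  by have := h q; case: (eqVneq (trform p q) 0) => // /eqP.
exists (trform u q / trform p q).
have := br_br_trform p u q; rewrite pu.
have -> : br q 0 = 0 by vring.
rewrite scaler0 => /eqP; rewrite subr_eq0 => /eqP e.
by rewrite mulrC -scalerA -e scalerA mulVf ?scale1r //; apply/eqP.
Qed.

(** * Complex structures on sl2(C) and their (1,0)-projections *)

Definition rlinear j := forall (r : R) u v, j (r%:C%C *: u + v) = r%:C%C *: j u + j v.

Record cxs j : Prop := Cxs {
  cxs_lin : rlinear j;
  cxs_sq : forall v, j (j v) = - v;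
  cxs_nij : forall u v,
    br (j u) (j v) - j (br (j u) v) - j (br u (j v)) - br u v = 0 }.

Section RLinear.
Variable j : vec -> vec.
Hypothesis hj : rlinear j.
Lemma rlinD u v : j (u + v) = j u + j v.
Proof. by have := hj 1 u v; rewrite !scale1r. Qed.
Lemma rlin0 : j 0 = 0.
Proof. by apply: (addrI (j 0)); rewrite -rlinD !addr0. Qed.
Lemma rlinZ r v : j (r%:C%C *: v) = r%:C%C *: j v.
Proof. by have := hj r v 0; rewrite !addr0 rlin0 addr0. Qed.
Lemma rlinN v : j (- v) = - j v.
Proof. by apply: (addrI (j v)); rewrite -rlinD !subrr rlin0. Qed.
Lemma rlinB u v : j (u - v) = j u - j v.
Proof. by rewrite rlinD rlinN. Qed.
End RLinear.

(* In g (x)_R C = g x conj g, projecting v to its (1,0)-part gives the components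
   [holp j v] and (the conjugate of) [holp (negj j) v], up to the factor 2. *)
Definition holp j v : vec := v - ii *: j v.

Definition negj j v : vec := - j v.

Lemma negj_cxs j : cxs j -> cxs (negj j).
Proof.
move=> [l s n]; split=> [r u v | v | u v]; rewrite /negj.
- by rewrite l opprD scalerN.
- by rewrite (rlinN l) s !opprK.
- by rewrite !brNl !brNr !(rlinN l) // !opprK; exact: n.
Qed.

Section RankNullity.
Let V : vectType R := ((R^o * R^o) * (R^o * R^o) * (R^o * R^o))%type.
Let enc v : V := ((complex.Re v.1.1, complex.Im v.1.1), (complex.Re v.1.2, complex.Im v.1.2),
   (complex.Re v.2, complex.Im v.2)).
Let dec (w : V) : vec := (Complex w.1.1.1 w.1.1.2, Complex w.1.2.1 w.1.2.2, Complex w.2.1 w.2.2).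

Let encK : cancel enc dec.
Proof. by case=> [[[? ?] [? ?]] [? ?]]. Qed.
Let decK : cancel dec enc.
Proof. by case=> [[[? ?] [? ?]] [? ?]]. Qed.

(** The map of interest, [holp j], is only real-linear, so rank-nullity is applied over the reals in
    a six-dimensional copy of [vec]. *)
Lemma rlinear_inj_surj f : rlinear f -> injective f <-> (forall u, exists v, u = f v).
Proof.
move=> fl.
have dec_lin r (x y : V) : dec (r *: x + y) = r%:C%C *: dec x + dec y.
  by case: x y => [[[? ?] [? ?]] [? ?]] [[[? ?] [? ?]] [? ?]];
    congr (Complex _ _, Complex _ _, Complex _ _) => /=; rewrite ?mul0r ?subr0 ?addr0.
have enc_lin r u v : enc (r%:C%C *: u + v) = r *: enc u + enc v.
  by apply: (can_inj decK); rewrite dec_lin !encK.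
pose g := enc \o f \o dec.
have gl : linear g by move=> r x y; rewrite /g /= dec_lin fl enc_lin.
pose gL : {linear V -> V} := HB.pack g (GRing.isLinear.Build _ _ _ _ g gl).
have gE (x : V) : linfun gL x = enc (f (dec x)) by rewrite lfunE.
have dimE := limg_ker_dim (linfun gL) fullv; rewrite capfv in dimE.
split=> [fi u | fs].
- have k0 : \dim (lker (linfun gL)) = 0%N.
    apply/eqP; rewrite dimv_eq0; apply/lker0P => x y.
    by rewrite !gE => /(can_inj encK) /fi /(can_inj decK).
  have /memv_imgP[x _ xE] : enc u \in limg (linfun gL).
    suff -> : limg (linfun gL) = fullv by rewrite memvf.
    by apply/eqP; rewrite eqEdim subvf -dimE k0 leqnn.
  by exists (dec x); apply: (can_inj encK); rewrite xE gE.
- have im : limg (linfun gL) = fullv.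
    apply/vspaceP => x; rewrite memvf; apply/memv_imgP.
    by have [v vecE] := fs (dec x); exists (enc v); rewrite ?memvf // gE encK -vecE decK.
  have /lker0P gi : lker (linfun gL) == 0%VS.
    by rewrite -dimv_eq0 -(eqn_add2r (\dim (limg (linfun gL)))) dimE im add0n.
  move=> u v e; apply: (can_inj encK); apply: gi.
  by rewrite !gE !encK e.
Qed.
End RankNullity.

(** In the notation of the overview, [Kp j] is ker B, [Kp (negj j)] is ker A, [imh j] is im A and
    [imh (negj j)] is im B. *)
Definition Kp j p := j p = ii *: p.
Definition imh j u := exists v, u = holp j v.

Section HolProj.
Variable j : vec -> vec.
Hypothesis hj : cxs j.
Let jl := cxs_lin hj.
Let js := cxs_sq hj.

Lemma holpD u v : holp j (u + v) = holp j u + holp j v.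
Proof. by rewrite /holp (rlinD jl); move: (j u) (j v) => *; vring. Qed.
Lemma holp_j v : holp j (j v) = ii *: holp j v.
Proof. by rewrite /holp js; move: (j v) => w; vcoord; ring: iiE. Qed.
Lemma holpR r v : holp j (r%:C%C *: v) = r%:C%C *: holp j v.
Proof. by rewrite /holp (rlinZ jl); move: (j v) => w; vring. Qed.
Lemma complexEii l : l = (complex.Re l)%:C%C + ii * (complex.Im l)%:C%C.
Proof. exact: complexE. Qed.
(** Since A j = i A, multiplying a value of A by i amounts to applying [j] to the argument; so im A
    is a complex subspace although A is only real-linear. *)
Lemma holpZ l v :
  l *: holp j v = holp j ((complex.Re l)%:C%C *: v + (complex.Im l)%:C%C *: j v).
Proof.
rewrite holpD !holpR holp_j {1}(complexEii l).
by move: (holp j v) => w; vring.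
Qed.
(** Put w = [u, v] - [ju, jv]. Vanishing of the Nijenhuis tensor says j w = [ju, v] + [u, jv], and w
    - i j w is the expansion of the left side. Hence im A is a subalgebra. *)
Lemma holp_br u v : br (holp j u) (holp j v) = holp j (br u v - br (j u) (j v)).
Proof.
have /(congr1 j) := cxs_nij hj u v; rewrite !(rlinB jl) (rlin0 jl) !js => e.
have -> : holp j (br u v - br (j u) (j v)) = br u v - br (j u) (j v)
   - ii *: (br (j u) v + br u (j v)).
  rewrite /holp (rlinB jl); congr (_ - _ *: _).
  apply: (addrI (j (br (j u) (j v)) - j (br u v))).
  rewrite (_ : _ + (_ - _) = 0); last by move: (j (br _ _)) (j (br u v)) => *; vring.
  rewrite -e; move: (j (br _ _)) (j (br u v)) => P Q; move: (br (j u) v) (br u (j v)) => S T. vring.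
by rewrite /holp; move: (j u) (j v) => *; vcoord; ring: iiE.
Qed.
Lemma holp_negj v : holp j v + holp (negj j) v = 2 *: v.
Proof. by rewrite /holp /negj; move: (j v) => *; vring. Qed.

Lemma KpE p : Kp j p <-> holp j p = 2 *: p.
Proof.
rewrite /Kp /holp; split=> [-> | e].
  by rewrite scalerA iiE; vring.
have -> : j p = ii *: (p - ii *: j p) - ii *: p.
  by move: (j p) => *; vcoord; ring: iiE.
by rewrite e; vring.
Qed.
Lemma KpD p q : Kp j p -> Kp j q -> Kp j (p + q).
Proof. by rewrite /Kp (rlinD jl) => -> ->; vring. Qed.
Lemma KpZ l p : Kp j p -> Kp j (l *: p).
Proof.
rewrite !KpE => hp; have : Kp j p by apply/KpE.
rewrite /Kp => jp; rewrite {1}(complexEii l).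
have -> : ((complex.Re l)%:C%C + ii * (complex.Im l)%:C%C) *: p =
  (complex.Re l)%:C%C *: p + (complex.Im l)%:C%C *: j p by rewrite jp; vring.
by rewrite -holpZ hp; vring.
Qed.
(** With A p = 2p, the bracket formula becomes 2 [p, A v] = A [p, v - i j v] = A [p, A v], so
    [p, A v] again satisfies the criterion [KpE]. *)
Lemma Kp_br p v : Kp j p -> Kp j (br p (holp j v)).
Proof.
move=> hp; apply/KpE.
have e := holp_br p v; move: (hp); rewrite KpE => hp2.
rewrite hp2 brZl in e; rewrite e; congr holp.
by rewrite hp /holp; move: (j v) => *; vring.
Qed.
Lemma Kp_imh p : Kp j p -> imh j p.
Proof.
rewrite KpE => hp; exists ((1 / 2)%:C%C *: p); rewrite holpR hp scalerA.
have -> : ((1 / 2 : R)%:C%C * 2 : C) = 1; last by rewrite scale1r.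
have -> : (2 : C) = (2 : R)%:C%C by rewrite rmorph_nat.
by rewrite -rmorphM /= divfK ?pnatr_eq0.
Qed.

Lemma imhD u v : imh j u -> imh j v -> imh j (u + v).
Proof. by move=> [u' ->] [v' ->]; exists (u' + v'); rewrite holpD. Qed.
Lemma imhZ l u : imh j u -> imh j (l *: u).
Proof. by move=> [u' ->]; eexists; rewrite holpZ. Qed.
Lemma imh_br u v : imh j u -> imh j v -> imh j (br u v).
Proof. by move=> [u' ->] [v' ->]; eexists; rewrite holp_br. Qed.

(** Three vectors of im A with nonzero determinant would span everything by Cramer's rule. *)
Lemma imh_det u v w : (exists x, ~ imh j x) -> imh j u -> imh j v -> imh j w ->
  trform (br u v) w = 0.
Proof.
move=> [x nx] iu iv iw; apply/eqP; apply: contrapT => /negP d0; apply: nx.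
have e := br_trform_cramer u v w x.
have -> : x = (trform (br u v) w)^-1 *: (trform (br u v) w *: x).
  by rewrite scalerA mulVf ?scale1r.
by rewrite e; apply: imhZ; apply: imhD; [apply: imhD|]; apply: imhZ.
Qed.

(** Some [y] in im A does not commute with [p], for otherwise [u] and [v] would both be multiples of
    [p]. Then w = [p, y] lies in the ideal ker B, and as a bracket inside a proper subalgebra it is
    orthogonal to im A, in particular to itself. *)
Lemma imh_nilpotent p u v : (exists x, ~ imh j x) -> p <> 0 -> Kp j p ->
  imh j u -> imh j v -> br u v <> 0 ->
  exists w, [/\ w <> 0, Kp j w, trform w w = 0 & forall x, trform w (holp j x) = 0].
Proof.
move=> proper p0 hp iu iv uv.
have [y [iy py]] : exists y, imh j y /\ br p y <> 0.
  apply: contrapT => h; apply: uv.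
  have hu : br p u = 0 by apply: contrapT => ?; apply: h; exists u.
  have hv : br p v = 0 by apply: contrapT => ?; apply: h; exists v.
  have [a ->] := centralizer_line p0 hu; have [b ->] := centralizer_line p0 hv.
  by rewrite brZl brZr brvv !scaler0.
exists (br p y); have ip := Kp_imh hp; split=> //.
- by case: iy => y' ->; apply: Kp_br.
- by apply: imh_det => //; apply: imh_br.
- by move=> x; apply: imh_det => //; exists x.
Qed.

Lemma imh_surj : (forall p, Kp (negj j) p -> p = 0) <-> (forall u, imh j u).
Proof.
have hl : rlinear (holp j) by move=> r u v; rewrite holpD holpR.
have kerE p : holp j p = 0 <-> Kp (negj j) p.
  rewrite /holp /Kp /negj; split=> e.
    have {}e : p = ii *: j p by apply/eqP; rewrite -subr_eq0 e.
    by rewrite {2}e scalerA iiE scaleN1r.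
  have -> : j p = - (ii *: p) by rewrite -e opprK.
  by rewrite scalerN opprK scalerA iiE scaleN1r subrr.
have := rlinear_inj_surj hl; rewrite /imh => <-; split=> [k0 u v e | hi p /kerE hp].
  by apply/eqP; rewrite -subr_eq0; apply/eqP; apply: k0; apply/kerE; rewrite (rlinB hl) e subrr.
by apply: hi; rewrite hp (rlin0 hl).
Qed.
End HolProj.

(** * Existence of an eigenvector of [j] for i or -i *)

Definition basis_H : vec := (1, 0, 0).
Definition basis_E : vec := (0, 1, 0).
Definition basis_F : vec := (0, 0, 1).

Lemma vec_basis a b c : ((a, b, c) : vec) = a *: basis_H + b *: basis_E + c *: basis_F.
Proof. by rewrite /basis_H /basis_E /basis_F; vring. Qed.
Lemma trform_inv u v w : trform (br u v) w = trform u (br v w). Proof. vring. Qed.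
(** The eigenvalues of ad h are 0 and the square roots of 2 tr (h^2); this recovers tr (h^2) from
    bracket relations. *)
Lemma trform_ad3 h e : br h (br h (br h e)) = (2 * trform h h) *: br h e.
Proof. vring. Qed.

(** The images of H, E, F satisfy the same bracket relations, which determine their trace products.
    So [s] acts like an element of SO(3), and det (s - 1) = 0. *)
Lemma sl2_endo_fixed (s : vec -> vec) :
  (forall l u v, s (l *: u + v) = l *: s u + s v) ->
  (forall u v, s (br u v) = br (s u) (s v)) -> injective s ->
  exists x, x <> 0 /\ s x = x.
Proof.
move=> sl sb si.
have sD u v : s (u + v) = s u + s v by rewrite -[u]scale1r sl !scale1r.
have s0 : s 0 = 0 by apply: (addrI (s 0)); rewrite -sD !addr0.
have sZ l u : s (l *: u) = l *: s u by rewrite -[l *: u]addr0 sl s0 addr0.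
set h := s basis_H; set e := s basis_E; set f := s basis_F.
have he : br h e = 2 *: e by rewrite -sb -sZ; congr s; rewrite /basis_H /basis_E; vring.
have hf : br h f = - (2 *: f).
  by rewrite -sb -scaleNr -sZ; congr s; rewrite /basis_H /basis_F; vring.
have ef : br e f = h by rewrite -sb; congr s; rewrite /basis_E /basis_F /basis_H; vring.
have e0 : e <> 0.
  by rewrite -s0 => /si [] /eqP; rewrite oner_eq0.
have hh : trform h h = 2.
  have := trform_ad3 h e; rewrite !(he, brZr, scalerA) => /eqP.
  rewrite -subr_eq0 -scalerBl => /eqP k.
  apply/eqP; rewrite eq_sym -subr_eq0; apply/negP => /negP d; apply: e0.
  have d' : 2 * 2 * 2 - 2 * trform h h * 2 != 0 :> C.
    have -> : 2 * 2 * 2 - 2 * trform h h * 2 = 2 * 2 * (2 - trform h h) by ring.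
    by rewrite !mulf_neq0 ?two_neq0.
  by rewrite -[e]scale1r -(mulVf d') -scalerA k scaler0.
have kef : trform e f = 1.
  have : trform h h = 2 * trform e f.
    rewrite -{1}ef trform_inv brC hf opprK trformZr; ring.
  by rewrite hh => /eqP; rewrite -subr_eq0 -{1}[2]mulr1 -mulrBr mulf_eq0
    (negbTE two_neq0) subr_eq0 => /eqP.
pose u := h - basis_H; pose v := e - basis_E; pose w := f - basis_F.
(* The determinant of s - 1 on the basis H, E, F; after expansion only brackets and traces already
   known remain, and they cancel. *)
have det0 : trform (br u v) w = 0.
  have -> : trform (br u v) w = trform (br h e) f - trform (br h e) basis_F + trform basis_E (br h f)
      + trform h (br basis_E basis_F) - trform basis_H (br e f) + trform e (br basis_F basis_H) 
      + trform (br basis_H basis_E) f - trform (br basis_H basis_E) basis_F.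
    by rewrite /u /v /w; clearbody h e f; rewrite /basis_H /basis_E /basis_F; vring.
  rewrite he hf ef trformZl kef /basis_H /basis_E /basis_F.
  by clear -h; clearbody h e f; vring.
have kerP a b c : a *: u + b *: v + c *: w = 0 -> s (a, b, c) = (a, b, c).
  rewrite [in s _]vec_basis !sD !sZ -/h -/e -/f /u /v /w => k.
  apply/eqP; rewrite -subr_eq0; apply/eqP; rewrite -[RHS]k [X in _ - X]vec_basis.
  by clearbody h e f; rewrite /basis_H /basis_E /basis_F; vring.
(* A linear relation between [u], [v], [w] is a fixed vector by [kerP]. If [u] and [v] are dependent
   it is found directly, otherwise Cramer's rule supplies the coefficients. *)
case: (pselect (br u v = 0)) => [uv | uv].
  case: (pselect (u = 0)) => [u0 | u0].
    exists basis_H; split; last by apply: kerP; rewrite u0 scaler0 !scale0r !addr0.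
    by case=> /eqP; rewrite oner_eq0.
  have [l vl] := centralizer_line u0 uv.
  exists (- l, 1, 0); split; first by case=> _ /eqP; rewrite oner_eq0.
  by apply: kerP; rewrite vl scaleNr scale1r addNr scale0r addr0.
have [x kx] : exists x, trform (br u v) x <> 0.
  by apply: contrapT => k; apply: uv; apply: trform_nondeg => q; apply: contrapT => ?; apply: k; exists q.
exists (trform (br v w) x, trform (br w u) x, trform (br u v) x); split; first by case.
by apply: kerP; rewrite -br_trform_cramer det0 scale0r.
Qed.

Lemma cxs_Kp_exists j : cxs j ->
  (exists p, p <> 0 /\ Kp j p) \/ (exists p, p <> 0 /\ Kp (negj j) p).
Proof.
move=> hj; have hnj := negj_cxs hj; apply: contrapT => /not_orP [k1 k2].
have negjK : negj (negj j) = j by apply/funext => v; rewrite /negj opprK.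
have sA : forall u, imh j u.
  by apply/(imh_surj hj) => p hp; apply: contrapT => p0; apply: k2; exists p.
have sB : forall u, imh (negj j) u.
  by apply/(imh_surj hnj) => p; rewrite negjK => hp; apply: contrapT => p0; apply: k1; exists p.
have lA : rlinear (holp j) by move=> r u v; rewrite holpD // holpR.
have lB : rlinear (holp (negj j)) by move=> r u v; rewrite holpD // holpR.
have iA : injective (holp j) by apply/rlinear_inj_surj.
have iB : injective (holp (negj j)) by apply/rlinear_inj_surj.
have [g gK] := choice sA.
pose psi u := holp (negj j) (g u).
have psiE x : psi (holp j x) = holp (negj j) x by rewrite /psi (iA (g (holp j x)) x (esym (gK _))).
have psil : rlinear psi.
  by move=> r u v; rewrite {1}[u]gK {1}[v]gK -lA psiE lB.
(* The argument [u, v] - [ju, jv] in [holp_br] is the same for j and for -j. *)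
have psib u v : psi (br u v) = br (psi u) (psi v).
  rewrite {1}[u]gK {1}[v]gK holp_br // psiE /psi holp_br //.
  by rewrite /negj brNl brNr opprK.
(* A j = i A while B j = - i B, so [psi] is antilinear and its square is complex-linear. *)
have psii u : psi (ii *: u) = - (ii *: psi u).
  rewrite {1}[u]gK -holp_j // psiE /psi -holp_j // -(rlinN lB).
  by rewrite /negj opprK.
have psi_inj : injective psi by move=> u v /iB e; rewrite [u]gK [v]gK e.
clearbody psi.
have [x [x0 xE]] : exists x, x <> 0 /\ psi (psi x) = x.
  apply: (@sl2_endo_fixed (psi \o psi)) => [l u v | u v | u v /psi_inj /psi_inj //] /=; last by rewrite !psib.
  rewrite !(rlinD psil); congr (_ + _).
  rewrite [in LHS](complexEii l) scalerDl mulrC -scalerA !(rlinD psil) !(rlinZ psil) !psii.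
  rewrite (rlinN psil) psii opprK scalerA [_ * ii]mulrC -scalerDl -complexEii //.
(* The vector x + psi x is fixed by [psi]; multiplying it by i makes it an eigenvector for -1, as
   [psi] is antilinear. *)
have [y [y0 yE]] : exists y, y <> 0 /\ psi y = - y.
  case: (pselect (x + psi x = 0)) => [e | ne].
    by exists x; split=> //; apply/eqP; rewrite -addr_eq0 addrC e.
  exists (ii *: (x + psi x)); split; last by rewrite psii (rlinD psil) xE [psi x + x]addrC.
  move=> e; apply: ne; rewrite -[x + _]scale1r -[1]opprK -iiE -mulNr -scalerA e scaler0 //.
(* For y = A v one has B v = psi y = -y, so 2 v = A v + B v = 0. *)
apply: y0; have := holp_negj j (g y); rewrite -psiE -gK yE subrr => /esym/eqP.
rewrite scaler_eq0 (negbTE two_neq0) => /eqP g0.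
by rewrite [y]gK g0 rlin0.
Qed.

(** If im A is everything, ker B is a nonzero ideal of a simple Lie algebra. Concretely, at most two
    brackets with E take a nonzero vector to a nonzero multiple of E, and brackets with F then give
    H and F. *)
Lemma Kp_ideal j p : cxs j -> (forall u, imh j u) -> p <> 0 -> Kp j p ->
  forall v, j v = ii *: v.
Proof.
move=> hj sA p0 hp.
have Kbr q u : Kp j q -> Kp j (br q u).
  by move=> hq; have [v ->] := sA u; apply: Kp_br.
have KZ l q : l != 0 -> Kp j (l *: q) -> Kp j q.
  by move=> l0 /(KpZ hj l^-1); rewrite scalerA mulVf // scale1r.
have KE : Kp j basis_E.
  case: p p0 hp => [[a b] c] p0 hp.
  case: (eqVneq c 0) => [c0|c0]; last first.
    apply: (@KZ (- (2 * c))); first by rewrite oppr_eq0 mulf_neq0 ?two_neq0.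
    suff -> : - (2 * c) *: basis_E = br (br (a, b, c) basis_E) basis_E by exact: (Kbr _ _ (Kbr _ _ hp)).
    by rewrite /basis_E; vring.
  case: (eqVneq a 0) => [a0|a0]; last first.
    apply: (@KZ (2 * a)); first by rewrite mulf_neq0 ?two_neq0.
    suff -> : (2 * a) *: basis_E = br (a, b, c) basis_E by apply: Kbr.
    by rewrite /basis_E c0; vring.
  subst a c; apply: (@KZ b); first by apply/negP => /eqP b0; apply: p0; rewrite b0.
  suff -> : b *: basis_E = (0, b, 0) by [].
  by rewrite /basis_E; vring.
have KH : Kp j basis_H.
  suff -> : basis_H = br basis_E basis_F by apply: Kbr.
  by rewrite /basis_E /basis_F /basis_H; vring.
have KF : Kp j basis_F.
  apply: (@KZ (- 2)); first by rewrite oppr_eq0 two_neq0.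
  suff -> : -2 *: basis_F = br basis_H basis_F by apply: Kbr.
  by rewrite /basis_F /basis_H; vring.
by case=> [[a b] c]; rewrite vec_basis; do ?[apply: KpD => //]; apply: KpZ.
Qed.

(** * Explicit automorphisms and transport along them *)

Definition cj v : vec := ((v.1.1)^*%C, (v.1.2)^*%C, (v.2)^*%C).
(* Conjugation by [[1, t], [0, 1]], by [[0, 1], [-1, 0]] and by diag (l, 1 / l). *)
Definition adU (t : C) v : vec :=
  (v.1.1 + t * v.2, v.1.2 - 2 * t * v.1.1 - t ^+ 2 * v.2, v.2).
Lemma adU_2 t v : (adU t v).2 = v.2. Proof. by []. Qed.
Definition adW v : vec := (- v.1.1, - v.2, - v.1.2).
Definition adD (l : C) v : vec := (v.1.1, l ^+ 2 * v.1.2, l ^- 2 * v.2).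

(** Just enough automorphisms for the normal forms, each with an evident lift to the group; [cj] is
    the only antilinear generator. *)
Inductive gen : (vec -> vec) -> Prop :=
| gen_id : gen idfun
| gen_U t : gen (adU t)
| gen_W : gen adW
| gen_D l : l != 0 -> gen (adD l)
| gen_cj : gen cj
| gen_comp f g : gen f -> gen g -> gen (f \o g).

Lemma conjcD (x y : C) : ((x + y)^*)%C = x^*%C + y^*%C. Proof. exact: rmorphD. Qed.
Lemma conjcM (x y : C) : ((x * y)^*)%C = x^*%C * y^*%C. Proof. exact: rmorphM. Qed.
Lemma conjcN (x : C) : ((- x)^*)%C = - x^*%C. Proof. exact: rmorphN. Qed.
Lemma realcN (r : R) : ((- r)%:C)%C = - (r%:C)%C. Proof. exact: rmorphN. Qed.
Lemma realcD (x y : R) : ((x + y)%:C)%C = x%:C%C + y%:C%C. Proof. exact: rmorphD. Qed.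
Lemma realcM (x y : R) : ((x * y)%:C)%C = x%:C%C * y%:C%C. Proof. exact: rmorphM. Qed.
Lemma realc1 : ((1 : R)%:C)%C = 1 :> C. Proof. by []. Qed.
Definition conjE := (conjcD, conjcM, conjcN, conjc_real, realcN).
Lemma cjK : involutive cj.
Proof. by case=> [[a b] c]; rewrite /cj /= !conjcK. Qed.
Lemma conjc_ii : (ii^*)%C = - ii.
Proof. by rewrite /ii /= -[RHS]/(Complex _ _) oppr0. Qed.
Lemma cjZ l v : cj (l *: v) = (l^*)%C *: cj v.
Proof. by move: v => [[a b] c]; rewrite /cj !vecE; congr (_, _, _) => /=; rewrite rmorphM. Qed.
Lemma cjD u v : cj (u + v) = cj u + cj v.
Proof.
by move: u v => [[a b] c] [[a' b'] c']; rewrite /cj !vecE; congr (_, _, _) => /=; rewrite rmorphD.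
Qed.
Lemma cj_br u v : cj (br u v) = br (cj u) (cj v).
Proof.
move: u v => [[a b] c] [[a' b'] c']; rewrite /cj !vecE; cbn [fst snd].
by congr (_, _, _); rewrite !(rmorphB, rmorphM) ?rmorph_nat.
Qed.

Lemma gen_auto f : gen f -> [/\ rlinear f, forall u v, f (br u v) = br (f u) (f v)
  & exists f', [/\ gen f', cancel f f' & cancel f' f]].
Proof.
elim=> {f} [|t||l l0||f g gf [fl fb [f' [gf' fK f'K]]] gg [gl gb [g' [gg' gK g'K]]]].
- by split=> //; exists idfun; split=> //; apply: gen_id.
- split=> [r u v | u v |]; rewrite /adU; [vring|vring|].
  exists (adU (- t)); split; first exact: gen_U.
    by move=> v; rewrite /adU; vring.
  by move=> v; rewrite /adU; vring.
- split=> [r u v | u v |]; rewrite /adW; [vring|vring|].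
  by exists adW; split; [exact: gen_W | move=> v | move=> v]; rewrite /adW; vring.
- split=> [r u v | u v |]; rewrite /adD; [vring|by vcoord; field|].
  exists (adD l^-1); split; first by apply: gen_D; rewrite invr_eq0.
    by move=> v; rewrite /adD; vcoord; rewrite ?invrK; field.
  by move=> v; rewrite /adD; vcoord; rewrite ?invrK; field.
- split=> [r u v||]; first by rewrite cjD cjZ conjc_real.
    exact: cj_br.
  by exists cj; split; [exact: gen_cj | exact: cjK | exact: cjK].
- split=> [r u v | u v |] /=; first by rewrite gl fl.
    by rewrite gb fb.
  exists (g' \o f'); split; first exact: gen_comp.
    by move=> v /=; rewrite fK gK.
  by move=> v /=; rewrite g'K f'K.
Qed.

Definition sim j k := exists f, gen f /\ forall v, f (j v) = k (f v).

Lemma sim_trans j k h : sim j k -> sim k h -> sim j h.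
Proof.
move=> [f [gf fE]] [g [gg gE]]; exists (g \o f); split; first exact: gen_comp.
by move=> v /=; rewrite fE gE.
Qed.

Lemma cxs_transport f j : gen f -> cxs j ->
  exists k, cxs k /\ forall v, f (j v) = k (f v).
Proof.
move=> /gen_auto[fl fb [f' [gf' fK f'K]]] [jl js jn].
have f'l : rlinear f' by move=> r u v; apply: (can_inj fK); rewrite fl !f'K.
have f'b u v : f' (br u v) = br (f' u) (f' v).
  by apply: (can_inj fK); rewrite fb !f'K.
exists (f \o j \o f'); split; last by move=> v /=; rewrite fK.
split=> [r u v | v | u v] /=.
- by rewrite f'l jl fl.
- by rewrite fK js (rlinN fl) f'K.
- apply: (can_inj f'K); rewrite !(rlinB f'l) (rlin0 f'l) !(f'b, fK).
  exact: jn.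
Qed.

(** Complex linearity excludes [cj]: such maps keep the eigenvalues i and -i apart and carry
    orthogonal complements along. *)
Definition cgen f := [/\ gen f, forall l v, f (l *: v) = l *: f v
  & forall u v, trform (f u) (f v) = trform u v].

Lemma cgen_U t : cgen (adU t).
Proof. by split; [exact: gen_U | move=> l v | move=> u v]; rewrite /adU; vring. Qed.
Lemma cgen_W : cgen adW.
Proof. by split; [exact: gen_W | move=> l v | move=> u v]; rewrite /adW; vring. Qed.
Lemma cgen_comp f g : cgen f -> cgen g -> cgen (f \o g).
Proof.
move=> [gf fZ fk] [gg gZ gk]; split; first exact: gen_comp.
  by move=> l v /=; rewrite gZ fZ.
by move=> u v /=; rewrite fk gk.
Qed.

Lemma nilpotent_normal w : w <> 0 -> trform w w = 0 ->
  exists f l, [/\ cgen f, l != 0 & f w = l *: basis_E].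
Proof.
move: w => [[a b] c] w0; rewrite trformE => k.
have {}k : a ^+ 2 + b * c = 0.
  have /eqP : 2 * (a ^+ 2 + b * c) = 0 by rewrite -k; ring.
  by rewrite mulf_eq0 (negbTE two_neq0) => /eqP.
case: (eqVneq c 0) => [c0 | c0].
  move: k; rewrite c0 mulr0 addr0 => /eqP; rewrite sqrf_eq0 => /eqP a0.
  exists (adU 0), b; split; first exact: cgen_U.
    by apply/negP => /eqP b0; apply: w0; rewrite a0 b0 c0.
  by rewrite a0 /adU /basis_E; vring.
(* The unipotent element kills the H-coordinate, after which nilpotency leaves a multiple of F; the
   Weyl element turns F into -E. *)
exists (adW \o adU (- (a / c))), (- c); split.
- by apply: cgen_comp; [exact: cgen_W | exact: cgen_U].
- by rewrite oppr_eq0.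
have bE : b = - (a ^+ 2) / c.
  by apply: (mulIf c0); rewrite divfK //; apply/eqP; rewrite -addr_eq0 addrC k.
by rewrite bE /= /adU /adW /basis_E; vcoord; field.
Qed.

(** * The models and the reduction to them *)

Definition jbi v : vec := ii *: v.
(** E and F are eigenvectors for i and -i, and C H is preserved; [ii * s] and [b] are the
    coefficients of the linear and the antilinear part on C H. *)
Definition jst (s : R) (b : C) v : vec :=
  (ii * s%:C%C * v.1.1 + b * (v.1.1)^*%C, ii * v.1.2, - ii * v.2).
(** The complex-linear map equal to i on the Borel subalgebra spanned by H and E, and to -i on the
    line of E + F. That line is not nilpotent, in contrast with the line of F for [jst 1 0]. *)
Definition jnon v : vec := (ii * v.1.1, ii * v.1.2 - 2 * ii * v.2, - ii * v.2).
Definition sqn (z : R * R) : R := z.1 ^+ 2 + z.2 ^+ 2.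
(* [jst s b] squares to -1 exactly when [s ^ 2 = 1 + |b| ^ 2]; the sheet [s > 0] of this
   hyperboloid is parameterised by the disk through stereographic projection. *)
Definition jreg (z : R * R) := jst ((1 + sqn z) / (1 - sqn z))
  (Complex (2 * z.1 / (1 - sqn z)) (2 * z.2 / (1 - sqn z))).

Lemma jst_jreg s (b : C) : 0 < s -> s ^+ 2 = 1 + sqn (complex.Re b, complex.Im b) ->
  exists z, sqn z < 1 /\ jst s b = jreg z.
Proof.
move: b => [x y]; rewrite /sqn /= => s0 sE.
have s1 : 1 + s != 0 by rewrite gt_eqF // addr_gt0.
have nE : (x / (1 + s)) ^+ 2 + (y / (1 + s)) ^+ 2 = (s - 1) / (1 + s).
  have -> : (x / (1 + s)) ^+ 2 + (y / (1 + s)) ^+ 2 = (s ^+ 2 - 1) / (1 + s) ^+ 2.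
    by rewrite sE; field.
  by field.
(* The inverse of the stereographic projection; its squared norm is (s - 1) / (s + 1). *)
exists (x / (1 + s), y / (1 + s)); rewrite /sqn /= nE; split.
  by rewrite ltr_pdivrMr ?addr_gt0 // mul1r ltrBlDr addrAC ltrDr addr_gt0.
rewrite /jreg /sqn /= nE.
have d : 1 - (s - 1) / (1 + s) = 2 / (1 + s) by field.
have -> : (1 + (s - 1) / (1 + s)) / (1 - (s - 1) / (1 + s)) = s.
  by rewrite d; field; rewrite s1.
have -> : 2 * (x / (1 + s)) / (1 - (s - 1) / (1 + s)) = x.
  by rewrite d; field; rewrite s1.
by have -> : 2 * (y / (1 + s)) / (1 - (s - 1) / (1 + s)) = y
  by rewrite d; field; rewrite s1.
Qed.

(* Composed with complex conjugation, the Weyl element exchanges the two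
   orientations of the Cartan subalgebra. *)
Lemma jst_flip s b : sim (jst s b) (jst (- s) (b^*)%C).
Proof.
exists (adW \o cj); split; first by apply: gen_comp; [exact: gen_W | exact: gen_cj].
case=> [[x y] z]; rewrite /= /adW /cj /jst; cbn [fst snd].
by congr (_, _, _); rewrite !conjE ?conjc_ii ?conjcK; ring.
Qed.

Lemma jst_classified s b : s ^+ 2 = 1 + sqn (complex.Re b, complex.Im b) ->
  exists z, sqn z < 1 /\ sim (jst s b) (jreg z).
Proof.
move=> sE; have s2 : 0 < s ^+ 2.
  by rewrite sE ltr_pwDl ?ltr01 // addr_ge0 // sqr_ge0.
case: (ltrgtP s 0) => [s0|s0|s0].
- have [||z [z1 zE]] := @jst_jreg (- s) (b^*)%C; rewrite ?oppr_gt0 //.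
    by rewrite sqrrN sE /sqn; case: (b) => x y /=; rewrite sqrrN.
  by exists z; split=> //; rewrite -zE; apply: jst_flip.
- have [z [z1 zE]] := jst_jreg s0 sE; exists z; split=> //; rewrite -zE.
  by exists idfun; split=> //; apply: gen_id.
- by move: s2; rewrite s0 expr0n /= ltxx.
Qed.

Lemma real_complex_structure_line (k : C -> C) :
  (forall (r : R) (x y : C), k (r%:C%C * x + y) = r%:C%C * k x + k y) ->
  (forall x : C, k (k x) = - x) ->
  exists s b, s ^+ 2 = 1 + sqn (complex.Re b, complex.Im b) /\
    forall x : C, k x = ii * s%:C%C * x + b * x^*%C.
Proof.
move=> kl kk.
have k0 : k 0 = 0 by apply: (addrI (1%:C%C * k 0)); rewrite -kl mul1r !addr0 mul1r.
have kZ (r : R) (x : C) : k (r%:C%C * x) = r%:C%C * k x by rewrite -[_ * x]addr0 kl k0 addr0.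
pose a := (k 1 - ii * k ii) / 2; pose b := (k 1 + ii * k ii) / 2.
have kE (x : C) : k x = a * x + b * x^*%C.
  rewrite {1}(complexEii x) addrC [ii * _]mulrC kl -[(complex.Re x)%:C%C]mulr1 kZ.
  rewrite [in RHS](complexEii x) !conjE conjc_ii /a /b.
  by field: iiE.
clearbody a b.
have e1 : a * (a + b) + b * (a^*%C + b^*%C) = -1.
  by rewrite -conjcD -kE -[a + b]mulr1 mulrDl -{2}(conjc1 R) -kE kk.
have e2 : a * (a - b) - b * (a^*%C - b^*%C) = -1.
  have := kk ii; rewrite !kE !(conjE, conjc_ii) => e.
  have : - ii * (a * (a * ii + b * - ii) + b * (a^*%C * - ii + b^*%C * - - ii)) = - ii * - ii.
    by rewrite e.
  by move=> e'; have -> : -1 = - ii * - ii :> C; [ring: iiE | rewrite -e'; ring: iiE].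
have aa : a ^+ 2 + b * b^*%C = -1.
  apply: (mulfI two_neq0); transitivity (-1 + -1 : C); last by ring.
  by rewrite -[X in _ = X + _]e1 -[X in _ = _ + X]e2; ring.
have ab : b * (a + a^*%C) = 0.
  apply: (mulfI two_neq0); transitivity (-1 - -1 : C); last by ring.
  by rewrite -[X in _ = X - _]e1 -[X in _ = _ - X]e2; ring.
have [s sE] : exists s : R, a = ii * s%:C%C.
  exists (complex.Im a).
  suff ra : complex.Re a = 0 by rewrite {1}(complexEii a) ra add0r.
  move/eqP: ab; rewrite mulf_eq0 => /orP[/eqP b0 | /eqP].
    move: aa; rewrite b0 mul0r addr0 => /eqP.
    rewrite -subr_eq0 opprK -(opprK 1) -iiE -expr2 subr_sqr mulf_eq0 => /orP[].
      by rewrite subr_eq0 => /eqP ->.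
    by rewrite addr_eq0 => /eqP ->; rewrite /ii /= oppr0.
  rewrite addcJ => /eqP; rewrite mulf_eq0 (negbTE two_neq0) => /eqP.
  by move/complexI.
exists s, b; split; last by move=> x; rewrite kE sE.
move: aa; rewrite sE; case: (b) => x y; rewrite /ii /sqn.
rewrite expr2 => /(congr1 (@complex.Re R)) /=.
move=> /eqP; rewrite -subr_eq0 => /eqP e; apply/eqP; rewrite -subr_eq0.
by rewrite -[X in _ == X]oppr0 -e; apply/eqP; ring.
Qed.

Definition classified j :=
  [\/ sim j jbi, exists z, sqn z < 1 /\ sim j (jreg z) | sim j jnon].

Lemma classified_sim j k : sim j k -> classified k -> classified j.
Proof.
move=> jk [h | [z [z1 h]] | h]; [apply: Or31 | apply: Or32; exists z; split=> // | apply: Or33];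
  exact: sim_trans jk h.
Qed.

Lemma classified_jst s b : s ^+ 2 = 1 + sqn (complex.Re b, complex.Im b) ->
  classified (jst s b).
Proof. by move=> /jst_classified; apply: Or32. Qed.

Lemma Kp_transport f j k p : cgen f -> (forall v, f (j v) = k (f v)) ->
  Kp j p -> Kp k (f p).
Proof. by move=> [_ fZ _] fE; rewrite /Kp -fE => ->; rewrite fZ. Qed.
Lemma cgenN f v : cgen f -> f (- v) = - f v.
Proof. by move=> [_ fZ _]; rewrite -scaleN1r fZ scaleN1r. Qed.
Lemma negj_transport f j k : cgen f -> (forall v, f (j v) = k (f v)) ->
  forall v, f (negj j v) = negj k (f v).
Proof. by move=> cf fE v; rewrite /negj (cgenN _ cf) fE. Qed.
Lemma cgenD f u v : cgen f -> f (u + v) = f u + f v.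
Proof. by move=> [/gen_auto[fl _ _] _ _]; exact: rlinD. Qed.
Lemma holp_transport f j k : cgen f -> (forall v, f (j v) = k (f v)) ->
  forall v, f (holp j v) = holp k (f v).
Proof.
move=> cf fE v; rewrite /holp (cgenD _ _ cf) (cgenN _ cf); case: (cf) => _ fZ _.
by rewrite fZ fE.
Qed.
Lemma cgen_inv f : cgen f -> exists f', [/\ gen f', cancel f f' & cancel f' f].
Proof. by case=> /gen_auto []. Qed.

Lemma KpNP j p : cxs j -> Kp j p -> Kp (negj j) p -> p = 0.
Proof.
rewrite /Kp /negj => hj -> /eqP; rewrite eq_sym -subr_eq0 opprK -scalerDl scaler_eq0.
have ii0 : ii != 0 by rewrite /ii eq_complex /= oner_eq0 andbF.
by rewrite -mulr2n -mulr_natl mulf_eq0 (negbTE two_neq0) (negbTE ii0) => /eqP.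
Qed.

Lemma Kp_comb j (a b : C) : cxs j -> Kp j basis_E -> Kp (negj j) basis_F ->
  j (0, a, b) = (0, ii * a, - ii * b).
Proof.
move=> hj hE hF.
have -> : ((0, a, b) : vec) = a *: basis_E + b *: basis_F by rewrite /basis_E /basis_F; vring.
rewrite (rlinD (cxs_lin hj)).
have /= -> : j (a *: basis_E) = _ := KpZ hj a hE.
have := KpZ (negj_cxs hj) b hF; rewrite {1}/Kp /negj => e.
by rewrite -[j (b *: basis_F)]opprK e /basis_E /basis_F; vring.
Qed.

(** For v in C H, the condition on A kills the F-coordinate of j v and the condition on B its
    E-coordinate. So [j] preserves C H, where it is a complex structure on a real plane. *)
Lemma normal_form_split j :
  cxs j -> Kp j basis_E -> Kp (negj j) basis_F ->
  (forall v, (holp j v).2 = 0) -> (forall v, (holp (negj j) v).1.2 = 0) ->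
  classified j.
Proof.
move=> hj hE hF hA hB; have jl := cxs_lin hj.
have ii0 : ii != 0 by rewrite /ii eq_complex /= oner_eq0 andbF.
pose k (x : C) : C := (j (x, 0, 0)).1.1.
have kE (x : C) : j (x, 0, 0) = (k x, 0, 0).
  have := hA (x, 0, 0); have := hB (x, 0, 0); rewrite /holp /negj /k.
  case: (j (x, 0, 0)) => [[y1 y2] y3]; rewrite !vecE; cbn [fst snd] => e1 e2.
  congr (_, _, _).
    by apply: (mulfI ii0); rewrite mulr0 -e1; ring.
  by apply: (mulfI ii0); rewrite mulr0 -[RHS]oppr0 -e2; ring.
have kl (r : R) (x y : C) : k (r%:C%C * x + y) = r%:C%C * k x + k y.
  rewrite /k -[j (x, _, _)]/(j (x, 0, 0)).
  have -> : ((r%:C%C * x + y, 0, 0) : vec) = r%:C%C *: (x, 0, 0) + (y, 0, 0) by vring.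
  by rewrite jl.
have kk (x : C) : k (k x) = - x by rewrite {1}/k -kE (cxs_sq hj).
have [s [b [sE kb]]] := real_complex_structure_line kl kk.
have -> : j = jst s b; last exact: classified_jst.
apply/funext => -[[x y] z].
have -> : ((x, y, z) : vec) = (x, 0, 0) + (0, y, z) by vring.
by rewrite (rlinD jl) kE Kp_comb // kb /jst; vring.
Qed.

(** By rank one im B is the line of [m]. Since A + B = 2 and A has no F-component, the F-coordinate
    of B v is twice that of v, which determines B and with it j = i - i B. Only the position of the
    line relative to the Borel subalgebra remains to be normalised. *)
Lemma normal_form_commuting j m : cxs j -> Kp j basis_E -> Kp (negj j) m ->
  (forall v, (holp j v).2 = 0) ->
  (forall u v, imh (negj j) u -> imh (negj j) v -> br u v = 0) -> m <> 0 ->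
  classified j.
Proof.
move=> hj hE hm hA comm m0; have hnj := negj_cxs hj.
have B2 v : (holp (negj j) v).2 = 2 * v.2.
  have := congr1 snd (holp_negj j v); rewrite -[(_ + _).2]/(_.2 + _.2) hA add0r => ->.
  by [].
have Bm v : exists l, holp (negj j) v = l *: m.
  apply: centralizer_line => //; apply: comm; first exact: Kp_imh.
  by exists v.
have m2 : m.2 != 0.
  apply/negP => /eqP e; have [l lE] := Bm basis_F.
  have := B2 basis_F; rewrite lE -[(_ *: _).2]/(_ * _.2) e mulr0 /= mulr1.
  by move/eqP; rewrite eq_sym (negbTE two_neq0).
pose a := m.1.1 / m.2; pose b := m.1.2 / m.2.
have jE v : j v = ii *: v - (2 * ii * v.2) *: (a, b, 1).
  have [l lE] := Bm v.
  have lE2 : l * m.2 = 2 * v.2 by rewrite -B2 lE.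
  have -> : j v = ii *: v - ii *: holp (negj j) v.
    by rewrite /holp /negj; move: (j v) => w; vcoord; ring: iiE.
  have -> : ((a, b, 1) : vec) = m.2^-1 *: m.
    by rewrite /a /b; move: m m2 {hm m0 Bm lE lE2 a b} => [[m1 m2'] m3] /= m2; rewrite vecE; congr (_, _, _); rewrite ?mulVf // mulrC.
  rewrite lE !scalerA; congr (_ - _ *: _).
  have -> : v.2 = l * m.2 / 2 by rewrite lE2; field.
  by field; rewrite m2.
have U_E v : adU (- a) (j v) = ii *: adU (- a) v - (2 * ii * v.2) *: (0, b + a ^+ 2, 1).
  by rewrite jE /adU; vring.
case: (eqVneq (b + a ^+ 2) 0) => [b0 | b0].
  apply: (@classified_sim _ (jst 1 0)).
    exists (adU (- a)); split; first exact: gen_U.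
    move=> v; rewrite U_E b0 /jst /adU; vcoord; rewrite ?mul0r ?addr0; ring.
  by apply: classified_jst; rewrite /sqn /= expr1n expr0n /= !addr0.
(* [adD l] multiplies the ratio of the E- and F-coordinates by l^4, so a fourth root makes the line
   that of E + F. *)
pose l := sqrtc (sqrtc (b + a ^+ 2)^-1).
have l4 : l ^+ 4 * (b + a ^+ 2) = 1.
  by rewrite (exprM _ 2 2) !sqr_sqrtc mulVf.
have l0 : l != 0.
  by apply/negP => /eqP l0; move: l4; rewrite l0 expr0n mul0r => /eqP; rewrite eq_sym oner_eq0.
apply: Or33; exists (adD l \o adU (- a)); split.
  by apply: gen_comp; [exact: gen_D | exact: gen_U].
move=> v /=; rewrite U_E.
have bE : b + a ^+ 2 = l ^- 4 by apply: (mulfI (expf_neq0 4 l0)); rewrite l4 mulfV ?expf_neq0.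
by rewrite bE /jnon /adD /adU; vcoord; field.
Qed.

Lemma classified_noncommuting j p q u v : cxs j -> p <> 0 -> Kp j p ->
  q <> 0 -> Kp (negj j) q -> imh j u -> imh j v -> br u v <> 0 -> classified j.
Proof.
move=> hj p0 hp q0 hq iu iv uv.
have proper k y : cxs k -> y <> 0 -> Kp (negj k) y -> exists x, ~ imh k x.
  move=> hk y0 hy; apply/not_existsP => h; apply: y0.
  by apply: (imh_surj hk).2 hy => x; apply: contrapT; apply: h.
have [w [w0 hw kww kwA]] := imh_nilpotent hj (proper _ _ hj q0 hq) p0 hp iu iv uv.
have [f [l [cf l0 fw]]] := nilpotent_normal w0 kww.
have [gf fZ fk] := cf.
have [k [hk fE]] := cxs_transport gf hj.
apply: (@classified_sim _ k); first by exists f.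
have [f' [_ fK f'K]] := cgen_inv cf.
have hE : Kp k basis_E.
  have := Kp_transport cf fE hw; rewrite fw => /(KpZ hk l^-1).
  by rewrite scalerA mulVf // scale1r.
(* Orthogonality to E for the trace form is the vanishing of the F-coordinate. *)
have hA x : (holp k x).2 = 0.
  rewrite -[x]f'K -(holp_transport cf fE); have := kwA (f' x).
  rewrite -fk fw trformZl => /eqP; rewrite mulf_eq0 (negbTE l0) /= => /eqP.
  by move: (f _) => y; rewrite /trform /basis_E /= => <-; ring.
have hm := Kp_transport cf (negj_transport cf fE) hq.
have m0 : f q <> 0.
  by move=> e; apply: q0; apply: (can_inj fK); rewrite e -[0](scale0r (0 : vec)) fZ !scale0r.
move: (f q) hm m0 => m hm m0 {f l cf l0 fw gf fZ fk fE f' fK f'K w w0 hw kww kwA iu iv uv}.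
case: (pselect (forall u v, imh (negj k) u -> imh (negj k) v -> br u v = 0)) => [comm | ].
  exact: normal_form_commuting hm hA comm m0.
move=> /existsNP[u' /existsNP[v' /not_implyP[iu /not_implyP[iv uv]]]].
have hnk := negj_cxs hk.
have E0 : basis_E <> 0 by case=> /eqP; rewrite oner_eq0.
have negjK : negj (negj k) = k by apply/funext => x; rewrite /negj opprK.
have properB : exists x, ~ imh (negj k) x by apply: (proper _ basis_E) => //; rewrite negjK.
have [w [w0 hw kww kwB]] := imh_nilpotent hnk properB m0 hm iu iv uv.
(* Otherwise nilpotency makes [w] a multiple of E, lying in the eigenspaces of both i and -i. *)
have w2 : w.2 != 0.
  apply/negP => /eqP e; apply: w0; apply: (KpNP hk) => //.
  move: e kww; case: (w) => [[a b] c] /= ->; rewrite trformE !mulr0 mul0r !addr0 => /eqP.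
  rewrite !mulf_eq0 (negbTE two_neq0) /= orbb => /eqP ->.
  have -> : ((0, b, 0) : vec) = b *: basis_E by rewrite /basis_E; vring.
  exact: KpZ.
(* Unipotent conjugation fixes E, so the first normalisation survives while [w] becomes a multiple
   of F. *)
pose f := adU (- (w.1.1 / w.2)); have cf : cgen f := cgen_U _.
have fw : f w = w.2 *: basis_F.
  rewrite /f /adU; move: w2 kww {f cf w0 hw kwB}; case: (w) => [[a b] c] /= c0.
  rewrite trformE => e.
  have -> : b = - a ^+ 2 / c.
    apply: (mulIf c0); rewrite divfK //; apply/eqP; rewrite -addr_eq0; apply/eqP.
    by apply: (mulfI two_neq0); rewrite mulr0 -e; ring.
  by rewrite /basis_F; vcoord; field.
have [gf fZ fk] := cf.
have [k' [hk' fE]] := cxs_transport gf hk.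
apply: (@classified_sim _ k'); first by exists f.
have [f' [_ fK f'K]] := cgen_inv cf.
have fEE : f basis_E = basis_E by rewrite /f /adU /basis_E; vring.
apply: normal_form_split => //.
- by rewrite -fEE; apply: Kp_transport cf fE hE.
- have := Kp_transport cf (negj_transport cf fE) hw; rewrite fw.
  by move/(KpZ (negj_cxs hk') w.2^-1); rewrite scalerA mulVf // scale1r.
- by move=> x; rewrite -[x]f'K -(holp_transport cf fE) /f adU_2 hA.
- move=> x; rewrite -[x]f'K -(holp_transport cf (negj_transport cf fE)).
  have := kwB (f' x); rewrite -fk fw trformZl => /eqP; rewrite mulf_eq0 (negbTE w2) orFb => /eqP.
  by move: (f (holp _ _)) => y; rewrite /trform /basis_F => /= <-; ring.
Qed.

Lemma cxs_classified j : cxs j -> classified j.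
Proof.
move=> hj; have hnj := negj_cxs hj.
have negjK k : negj (negj k) = k by apply/funext => x; rewrite /negj opprK.
case: (pselect (exists q, q <> 0 /\ Kp (negj j) q)) => [[q [q0 hq]] | nq]; last first.
  have [[p [p0 hp]] | //] := cxs_Kp_exists hj.
  apply: Or31; exists idfun; split; first exact: gen_id.
  apply: (Kp_ideal hj _ p0 hp); apply/(imh_surj hj) => q hq.
  by apply: contrapT => q0; apply: nq; exists q.
case: (pselect (exists p, p <> 0 /\ Kp j p)) => [[p [p0 hp]] | np]; last first.
  (* Here j = -i, and complex conjugation turns it into i. *)
  apply: Or31; exists cj; split; first exact: gen_cj.
  have sB : forall u, imh (negj j) u.
    apply/(imh_surj hnj) => p; rewrite negjK => hp.
    by apply: contrapT => p0; apply: np; exists p.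
  move=> v; have := Kp_ideal hnj sB q0 hq v; rewrite /negj => e.
  by rewrite -[j v]opprK e -scaleNr cjZ conjcN conjc_ii opprK.
case: (pselect (forall u v, imh j u -> imh j v -> br u v = 0)) => [cA | ]; last first.
  move=> /existsNP[u /existsNP[v /not_implyP[iu /not_implyP[iv uv]]]].
  exact: classified_noncommuting hj p0 hp q0 hq iu iv uv.
case: (pselect (forall u v, imh (negj j) u -> imh (negj j) v -> br u v = 0)) => [cB | ]; last first.
  move=> /existsNP[u /existsNP[v /not_implyP[iu /not_implyP[iv uv]]]].
  (* Conjugation being antilinear, it exchanges the roles of A and B and reduces to the case where
     im A is not commutative. *)
  have [k [hk fE]] := cxs_transport gen_cj hj.
  apply: (@classified_sim _ k); first by exists cj; split=> //; exact: gen_cj.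
  have cj0 x : x <> 0 -> cj x <> 0.
    by move=> x0 e; apply: x0; rewrite -[x]cjK e -[0](scale0r (0 : vec)) cjZ conjc0 !scale0r.
  have cjN x : cj (- x) = - cj x by rewrite -scaleN1r cjZ conjcN conjc1 scaleN1r.
  have KE x : Kp j x -> Kp (negj k) (cj x).
    by rewrite /Kp /negj -fE => ->; rewrite cjZ conjc_ii scaleNr opprK.
  have KE' x : Kp (negj j) x -> Kp k (cj x).
    rewrite /Kp /negj -fE => /(congr1 cj); rewrite cjN cjZ conjc_ii scaleNr.
    by move/oppr_inj.
  have iE x : imh (negj j) x -> imh k (cj x).
    case=> y ->; exists (cj y); rewrite /holp /negj -fE cjD cjN cjZ cjN conjc_ii.
    by rewrite scaleNr scalerN opprK.
  have := classified_noncommuting hk (cj0 _ q0) (KE' _ hq) (cj0 _ p0) (KE _ hp) (iE _ iu) (iE _ iv).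
  by apply; rewrite -cj_br; apply: cj0.
(* Two commutative images would be the lines of [p] and [q], yet A + B = 2 makes them span sl2(C).
   The trace form expresses this: [p, q] is orthogonal to both lines, hence zero, and then [p] and
   [q] are proportional. *)
exfalso; have ip := Kp_imh hj hp; have iq := Kp_imh hnj hq.
have pq : br p q = 0.
  apply: trform_nondeg => v; apply: (mulfI two_neq0).
  rewrite mulr0 -trformZr -(holp_negj j) trformDr.
  have [a ->] := centralizer_line p0 (cA _ _ ip (ex_intro _ v erefl)).
  have [b ->] := centralizer_line q0 (cB _ _ iq (ex_intro _ v erefl)).
  by rewrite !trformZr trform_brl trform_brr !mulr0 addr0.
have [l ql] := centralizer_line p0 pq.
by apply: q0; apply: (KpNP hj) => //; rewrite ql; exact: KpZ.
Qed.

(** * The models are complex structures and pairwise inequivalent *)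

Lemma ii_neq0 : ii != 0. Proof. by rewrite /ii eq_complex /= oner_eq0 andbF. Qed.

Lemma sqnc (b : C) : b * b^*%C = (sqn (complex.Re b, complex.Im b))%:C%C.
Proof.
case: b => x y; rewrite -[LHS]/(Complex _ _) /sqn /= !expr2.
by congr Complex; ring.
Qed.

Lemma cxs_jbi : cxs jbi.
Proof.
split=> [r u v | v | u v]; rewrite /jbi; first by vring.
  by vcoord; ring: iiE.
by vcoord; ring: iiE.
Qed.

Lemma cxs_jnon : cxs jnon.
Proof.
split=> [r u v | v | u v]; rewrite /jnon; first by vring.
  by vcoord; ring: iiE.
by vcoord; ring: iiE.
Qed.

Lemma cxs_jst s b : s ^+ 2 = 1 + sqn (complex.Re b, complex.Im b) -> cxs (jst s b).
Proof.
move=> sE.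
have bb : b * b^*%C = s%:C%C * s%:C%C - 1.
  by rewrite sqnc -realcM -expr2 sE [in RHS]realcD realc1; ring.
split=> [r u v | v | u v]; rewrite /jst; vcoord; rewrite ?conjE ?conjc_ii ?conjcK;
  ring: iiE bb.
Qed.

Lemma sqn_jreg z : sqn z < 1 -> let s := (1 + sqn z) / (1 - sqn z) in
  s ^+ 2 = 1 + sqn (2 * z.1 / (1 - sqn z), 2 * z.2 / (1 - sqn z)) /\ 0 < s.
Proof.
move=> z1; have d : 0 < 1 - sqn z by rewrite subr_gt0.
have n0 : 0 <= sqn z by rewrite /sqn addr_ge0 ?sqr_ge0.
split; last by rewrite divr_gt0 // ltr_pwDl ?ltr01.
move: d; rewrite /sqn /=; set n := z.1 ^+ 2 + z.2 ^+ 2 => d; have d0 : 1 - n != 0 by rewrite gt_eqF.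
have -> : (2 * z.1 / (1 - n)) ^+ 2 + (2 * z.2 / (1 - n)) ^+ 2 = 4 * n / (1 - n) ^+ 2.
  by rewrite /n; field.
by clearbody n; field.
Qed.

Lemma cxs_jreg z : sqn z < 1 -> cxs (jreg z).
Proof. by move=> /sqn_jreg [sE _]; apply: cxs_jst. Qed.

Definition cen j x := forall y, j (br x y) = br x (j y).

Lemma eqB0 (x y : C) : x = y -> x - y = 0. Proof. by move=> ->; rewrite subrr. Qed.

Lemma cen_jst_H s b : cen (jst s b) basis_H.
Proof. by move=> y; rewrite /jst /basis_H; vcoord; rewrite ?conjc0; ring. Qed.

Lemma cen_jst s b x : cen (jst s b) x -> x.1.2 = 0 /\ x.2 = 0.
Proof.
case: x => [[a1 a2] a3] h.
have := h basis_E; have := h basis_F; have := h basis_H; have := h (ii *: basis_H).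
rewrite /jst /basis_H /basis_E /basis_F; vcoord; cbn [fst snd].
rewrite ?(mulr0, mul0r, mulr1, mul1r, addr0, subr0, sub0r, conjc0, conjc1, conjE, conjc_ii, conjc_nat).
move=> [h1 h2] [h3 h4] [h5 _] [h6 _].
move: h1 h2 h3 h4 h5 h6 => /eqB0 h1 /eqB0 h2 /eqB0 h3 /eqB0 h4 /eqB0 h5 /eqB0 h6.
(* If the E-coordinate of x is nonzero, testing on H and iH forces j = i on C H, because j is i on C
   E; testing on F then demands -i there. For the F-coordinate the signs are reversed; w = 1 and w =
   -1 are the two cases. *)
have solve (w : C) : (ii * s%:C%C + b - w * ii) * 2 = 0 ->
    (ii * s%:C%C * ii + b * - ii + w) * 2 = 0 -> b = 0 /\ ii * s%:C%C = w * ii.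
  move=> /eqP; rewrite mulf_eq0 (negbTE two_neq0) orbF => /eqP e1.
  move=> /eqP; rewrite mulf_eq0 (negbTE two_neq0) orbF => /eqP e2.
  have b0 : b = 0.
    apply: (mulfI two_neq0); rewrite mulr0.
    transitivity ((ii * s%:C%C + b - w * ii) + ii * (ii * s%:C%C * ii + b * - ii + w)).
      by ring: iiE.
    by rewrite e1 e2 mulr0 addr0.
  by split=> //; move: e1; rewrite b0 addr0 => /eqP; rewrite subr_eq0 => /eqP.
split; apply: contrapT => /eqP n0.
- have [||b0 sE] := solve 1.
  + by apply: (mulfI n0); rewrite mulr0 -h3; ring.
  + by apply: (mulfI n0); rewrite mulr0 -h1; ring: iiE.
  move/eqP: n0; apply; apply: (mulfI (mulf_neq0 two_neq0 ii_neq0)).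
  by rewrite mulr0 -h5 b0 sE; ring.
- have [||b0 sE] := solve (-1).
  + by apply: (mulfI n0); rewrite mulr0 -[RHS]oppr0 -h4; ring: iiE.
  + by apply: (mulfI n0); rewrite mulr0 -[RHS]oppr0 -h2; ring: iiE.
  move/eqP: n0; apply; apply: (mulfI (mulf_neq0 two_neq0 ii_neq0)).
  by rewrite mulr0 -h6 b0 sE; ring.
Qed.

Lemma cen_jnon x : cen jnon x -> x = 0.
Proof.
case: x => [[a1 a2] a3] h; have := h basis_F; have := h basis_H.
rewrite /jnon /basis_H /basis_F; vcoord; move=> [_ /eqB0 h1 _] [/eqB0 h2 /eqB0 h3 _].
have c0 : a3 = 0.
  apply: (mulfI (mulf_neq0 (mulf_neq0 two_neq0 two_neq0) ii_neq0)); rewrite mulr0.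
  by rewrite -[RHS]oppr0 -h1; ring.
have b0 : a2 = 0.
  apply: (mulfI (mulf_neq0 two_neq0 ii_neq0)); rewrite mulr0 -h2 c0; ring.
have a0 : a1 = 0.
  apply: (mulfI (mulf_neq0 (mulf_neq0 (mulf_neq0 two_neq0 two_neq0) two_neq0) ii_neq0)).
  by rewrite mulr0 -h3 c0 b0; ring.
by rewrite a0 b0 c0.
Qed.

(** All real automorphisms of the Lie algebra, with no generators in sight; invariants must be
    tested against these. *)
Definition rauto f := [/\ rlinear f, forall u v, f (br u v) = br (f u) (f v),
  injective f & forall u, exists v, u = f v].

Lemma gen_rauto f : gen f -> rauto f.
Proof.
move=> /gen_auto[fl fb [f' [_ fK f'K]]]; split=> //; first exact: can_inj fK.
by move=> u; exists (f' u); rewrite f'K.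
Qed.

Lemma cen_rauto f j k x : rauto f -> (forall v, f (j v) = k (f v)) ->
  cen j x <-> cen k (f x).
Proof.
move=> [fl fb fi fs] fE; split=> h y.
  by have [y' ->] := fs y; rewrite -fb -!fE h fb.
by apply: fi; rewrite fE !fb h fE.
Qed.

Lemma basisE_neq0 : basis_E <> 0. Proof. by case=> /eqP; rewrite oner_eq0. Qed.
Lemma basisH_neq0 : basis_H <> 0. Proof. by case=> /eqP; rewrite oner_eq0. Qed.
Lemma cen_jbi x : cen jbi x. Proof. by move=> y; rewrite /jbi brZr. Qed.
Lemma rauto_neq0 f x : rauto f -> x <> 0 -> f x <> 0.
Proof. by move=> [fl _ fi _] x0 e; apply: x0; apply: fi; rewrite e rlin0. Qed.

Lemma cen_jreg_E z : ~ cen (jreg z) basis_E.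
Proof. by move=> /cen_jst [] /eqP; rewrite oner_eq0. Qed.

Lemma jbi_jreg f z : rauto f -> ~ (forall v, f (jbi v) = jreg z (f v)).
Proof.
move=> hf fE; case: (hf) => _ _ _ fs; have [v vecE] := fs basis_E.
by apply: (@cen_jreg_E z); rewrite vecE; apply/(cen_rauto _ hf fE); exact: cen_jbi.
Qed.
Lemma jnon_jreg f z : rauto f -> ~ (forall v, f (jnon v) = jreg z (f v)).
Proof.
move=> hf fE; case: (hf) => fl _ _ fs; have [v vecE] := fs basis_H.
have /cen_jnon v0 : cen jnon v.
  by apply/(cen_rauto _ hf fE); rewrite -vecE; exact: cen_jst_H.
by apply: basisH_neq0; rewrite vecE v0 rlin0.
Qed.
Lemma jbi_jnon f : rauto f -> ~ (forall v, f (jbi v) = jnon (f v)).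
Proof.
move=> hf fE; apply: (rauto_neq0 hf basisE_neq0); apply: cen_jnon.
by apply/(cen_rauto _ hf fE); exact: cen_jbi.
Qed.

(** Preserving the centralisers, [f] maps C H to itself, and its action there is read off from the
    image of E. It is the identity or x to -x^*; the latter reverses the sign of s, which positivity
    forbids. *)
Lemma jst_rauto f s b s' b' : rauto f -> 0 < s -> 0 < s' ->
  (forall v, f (jst s b v) = jst s' b' (f v)) -> s = s' /\ b = b'.
Proof.
move=> hf s0 s'0 fE; have [fl fb fi fs] := hf.
have fline (x : C) : exists y : C, f (x, 0, 0) = (y, 0, 0).
  have hx : cen (jst s b) (x, 0, 0) by move=> y; rewrite /jst; vcoord; rewrite ?conjc0; ring.
  have /cen_jst [] := (cen_rauto _ hf fE).1 hx.
  by case: (f _) => [[y1 y2] y3] /= -> ->; exists y1.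
have [h fH] := fline 1; have [m fI] := fline ii.
have eE : br (f basis_H) (f basis_E) = 2 *: f basis_E.
  have -> : (2 : C) = (2 : R)%:C%C by rewrite rmorph_nat.
  by rewrite -fb -(rlinZ fl); congr f; rewrite /basis_H /basis_E rmorph_nat; vring.
have eI : br (f (ii, 0, 0)) (f basis_E) = 2 *: f (ii *: basis_E).
  have -> : (2 : C) = (2 : R)%:C%C by rewrite rmorph_nat.
  by rewrite -fb -(rlinZ fl); congr f; rewrite /basis_H /basis_E rmorph_nat; vring.
have eJ : f (ii *: basis_E) = jst s' b' (f basis_E).
  by rewrite -fE; congr f; rewrite /jst /basis_E; vcoord; rewrite ?conjc0; ring.
have f0 := rauto_neq0 hf basisE_neq0.
move: eE eI eJ f0; rewrite /basis_H fH fI; case: (f basis_E) => [[e1 e2] e3].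
case: (f (ii *: basis_E)) => [[g1 g2] g3]; rewrite /jst; vcoord.
move=> [/eqB0 a1 /eqB0 a2 /eqB0 a3] [/eqB0 i1 /eqB0 i2 /eqB0 i3] [_ j2 j3] f0.
have e10 : e1 = 0 by apply: (mulfI two_neq0); rewrite mulr0 -[RHS]oppr0 -a1; ring.
(* The eigenvector f E of ad (f H) has no H-component. A nonzero E-component gives h = 1, a nonzero
   F-component h = -1; as f (iE) = j' (f E), both give m = i. *)
have hm : m = ii /\ (h = 1 \/ h = -1).
  case: (eqVneq e2 0) => [e20 | e20].
    have e30 : e3 != 0 by apply/negP => /eqP e30; apply: f0; rewrite e10 e20 e30.
    split.
      apply: (mulfI (mulf_neq0 two_neq0 e30)); apply/eqP; rewrite -subr_eq0; apply/eqP.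
      by rewrite -[RHS]oppr0 -i3 j3; ring.
    right; apply: (mulfI (mulf_neq0 two_neq0 e30)); apply/eqP; rewrite -subr_eq0; apply/eqP.
    by rewrite -[RHS]oppr0 -a3; ring.
  split.
    apply: (mulfI (mulf_neq0 two_neq0 e20)); apply/eqP; rewrite -subr_eq0; apply/eqP.
    by rewrite -i2 j2; ring.
  left; apply: (mulfI (mulf_neq0 two_neq0 e20)); apply/eqP; rewrite -subr_eq0; apply/eqP.
  by rewrite -a2; ring.
case: hm => mE hE.
have fC (x : C) : f (x, 0, 0) = (h * (complex.Re x)%:C%C + ii * (complex.Im x)%:C%C, 0, 0).
  have -> : ((x, 0, 0) : vec) = (complex.Re x)%:C%C *: (1, 0, 0) + (complex.Im x)%:C%C *: (ii, 0, 0).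
    by rewrite {1}(complexEii x); vring.
  by rewrite fl (rlinZ fl) fH fI mE; vring.
have := fE (1, 0, 0); have := fE (ii, 0, 0); rewrite fH fI mE /jst; cbn [fst snd].
rewrite !mulr0 !fC => -[eI] [eH].
have := congr1 (@complex.Re R) eI; have := congr1 (@complex.Im R) eI.
have := congr1 (@complex.Re R) eH; have := congr1 (@complex.Im R) eH.
clear -s0 s'0 hE; case: b => x y; case: b' => x' y'.
case: hE => -> /= h1 h2 h3 h4.
  have [? ? ?] : [/\ s = s', x = x' & y = y'] by split; lra.
  by split=> //; congr Complex.
by exfalso; lra.
Qed.

Lemma jreg_rauto f (z w : R * R) : rauto f -> sqn z < 1 -> sqn w < 1 ->
  (forall v, f (jreg z v) = jreg w (f v)) -> z = w.
Proof.
move=> hf z1 w1 fE; have [_ sz] := sqn_jreg z1; have [_ sw] := sqn_jreg w1.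
have [se [be1 be2]] := jst_rauto hf sz sw fE.
have dz : 1 - sqn z != 0 by rewrite gt_eqF // subr_gt0.
have dw : 1 - sqn w != 0 by rewrite gt_eqF // subr_gt0.
(* Adding 1 to s gives 2 / (1 - |z|^2), so equal values of s have equal denominators. *)
have key : (1 - sqn z)^-1 = (1 - sqn w)^-1.
  have : (1 + sqn z) / (1 - sqn z) + 1 = (1 + sqn w) / (1 - sqn w) + 1 by rewrite se.
  have -> : (1 + sqn z) / (1 - sqn z) + 1 = 2 * (1 - sqn z)^-1 by field.
  have -> : (1 + sqn w) / (1 - sqn w) + 1 = 2 * (1 - sqn w)^-1 by field.
  by apply: mulfI; rewrite pnatr_eq0.
have c0 : 2 / (1 - sqn w) != 0 by rewrite mulf_neq0 ?invr_neq0 ?pnatr_eq0.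
move: be1 be2; rewrite key => be1 be2.
rewrite [z]surjective_pairing [w]surjective_pairing; congr (_, _).
  by apply: (mulIf c0); rewrite !mulrA ![_ * 2]mulrC.
by apply: (mulIf c0); rewrite !mulrA ![_ * 2]mulrC.
Qed.

End Sl2Algebra.

(** * Calculus of C^k maps *)

Section CkTheory.
Context {R : realType}.
Implicit Types V W X : normedModType R.

Lemma near_eq_differentiable V W (f g : V -> W) x :
  (\near x, f x = g x) -> differentiable f x -> differentiable g x.
Proof.
move=> fg df.
have fgx : f x = g x by exact: nbhs_singleton fg.
have e : g \o shift x = cst (g x) + 'd f x +o_ (0 : V) id.
  apply/eqaddoP => _/posnumP[k].
  have /eqaddoP/(_ k%:num) := diff_locally df => /(_ (ltac:(done))) h.
  have fg' : \forall h \near (0 : V), f (h + x) = g (h + x).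
    by move: fg; rewrite (near_shift 0) /= subr0.
  apply: filterS2 fg' h => y fgy.
  have -> : (g \o shift x - (cst (g x) + 'd f x)) y = (f \o shift x - (cst (f x) + 'd f x)) y.
    change (g (y + x) - (g x + 'd f x y) = f (y + x) - (f x + 'd f x y)).
    by rewrite fgx fgy.
  by apply.
apply/diff_locallyP; rewrite (diff_unique (diff_continuous df) e).
by split=> [|]; [exact: diff_continuous | exact: e].
Qed.

Lemma near_open V W (f g : V -> W) (U : set V) x : open U -> U x ->
  (forall y, U y -> f y = g y) -> \near x, f x = g x.
Proof. by move=> oU Ux fg; near=> y; apply: fg; near: y; exact: open_nbhs_nbhs. 
Unshelve. all: by end_near. Qed.

Lemma Ck_eq V W k (U : set V) (f g : V -> W) : open U ->
  (forall x, U x -> f x = g x) -> Ck k U f -> Ck k U g.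
Proof.
move=> oU; elim: k f g => [|k IH] f g fg /=.
  move=> cf x Ux; have := cf x Ux; rewrite /prop_for /continuous_at -(fg x Ux).
  apply: cvg_trans; apply: near_eq_cvg.
  exact: near_open fg.
move=> [df dk]; split=> [x Ux | v].
  by apply: near_eq_differentiable (df x Ux); apply: near_open fg.
apply: IH (dk v) => x Ux; apply: near_eq_derive; exact: near_open fg.
Qed.

Lemma Ck_cont V W k (U : set V) (f : V -> W) x : Ck k U f -> U x -> {for x, continuous f}.
Proof.
case: k => [h Ux|k [h _] Ux]; first exact: h.
by apply: differentiable_continuous; apply: h.
Qed.

Lemma Ck_S V W k (U : set V) (f : V -> W) : Ck k.+1 U f -> Ck k U f.
Proof.
elim: k f => [|k IH] f; first by move=> h x; apply: Ck_cont h.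
by move=> [df dk]; split=> // v; apply: IH; apply: dk.
Qed.

Lemma Ck_cst V W k (U : set V) (w : W) : Ck k U (cst w : V -> W).
Proof.
elim: k w => [|k IH] w /=; first by move=> x _; apply: cvg_cst.
split=> [x _|v]; first exact: differentiable_cst.
by have -> : (fun x : V => 'D_v (cst w) x) = cst 0 by apply/funext => x; rewrite derive_cst.
Qed.

Lemma lin_comp_derive V W X (L : {linear W -> X}) (f : V -> W) x v :
  continuous L -> differentiable f x ->
  differentiable (L \o f) x /\ 'D_v (L \o f) x = L ('D_v f x).
Proof.
move=> cL df; have dL : differentiable L (f x) by exact: linear_differentiable.
have d : differentiable (L \o f) x by exact: differentiable_comp df dL.
by split=> //; rewrite [LHS](deriveE _ d) (deriveE _ df) (diff_comp df dL) /= diff_lin.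
Qed.

Lemma Ck_lin V W X k (U : set V) (L : {linear W -> X}) (f : V -> W) :
  open U -> continuous L -> Ck k U f -> Ck k U (L \o f).
Proof.
move=> oU cL; elim: k f => [|k IH] f /=.
  by move=> cf x Ux; apply: continuous_comp; [exact: cf | exact: cL].
move=> [df dk]; split=> [x Ux|v].
  by have [] := lin_comp_derive 0 cL (df x Ux).
apply: Ck_eq (IH _ (dk v)) => // x Ux /=.
by have [_ ->] := lin_comp_derive v cL (df x Ux).
Qed.

Lemma Ck_id V k (U : set V) : Ck k U (@id V).
Proof.
case: k => [x _|k]; first exact: cvg_id.
split=> [x _|v]; first by apply: ex_diff; exact: is_diff_id.
have -> : (fun x : V => 'D_v id x) = cst v by apply/funext => x; rewrite derive_id.
exact: Ck_cst.
Qed.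

Lemma Ck_add V W k (U : set V) (f g : V -> W) :
  open U -> Ck k U f -> Ck k U g -> Ck k U (fun x => f x + g x).
Proof.
move=> oU; elim: k f g => [|k IH] f g /=.
  by move=> cf cg x Ux; apply: cvgD; [exact: cf | exact: cg].
move=> [df dk] [dg dgk]; split=> [x Ux|v].
  by apply: differentiableD; [exact: df | exact: dg].
apply: Ck_eq (IH _ _ (dk v) (dgk v)) => // x Ux.
by rewrite -deriveD //; apply: diff_derivable; [exact: df | exact: dg].
Qed.

Lemma bilin_comp_derive V W1 W2 X (B : {bilinear W1 -> W2 -> X}) (f : V -> W1) (g : V -> W2) x v :
  continuous (fun p => B p.1 p.2) -> differentiable f x -> differentiable g x ->
  differentiable (fun y => B (f y) (g y)) x /\
  'D_v (fun y => B (f y) (g y)) x = B ('D_v f x) (g x) + B (f x) ('D_v g x).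
Proof.
move=> cB df dg.
have dp : differentiable (fun y => (f y, g y)) x by exact: differentiable_pair.
have dB := differentiable_bilin (f x, g x) cB.
have d : differentiable ((fun p => B p.1 p.2) \o (fun y => (f y, g y))) x.
  exact: differentiable_comp.
split; first exact: d.
rewrite [LHS](deriveE _ d) diff_comp //= diff_bilin //= diff_pair //=.
by rewrite -!deriveE // addrC.
Qed.

Lemma Ck_bilin V W1 W2 X k (U : set V) (B : {bilinear W1 -> W2 -> X}) (f : V -> W1) (g : V -> W2) :
  open U -> continuous (fun p => B p.1 p.2) -> Ck k U f -> Ck k U g ->
  Ck k U (fun x => B (f x) (g x)).
Proof.
move=> oU cB; elim: k f g => [|k IH] f g.
  move=> /= cf cg x Ux.
  apply: (@continuous_comp _ _ _ (fun y => (f y, g y)) (fun p => B p.1 p.2)); last exact: cB.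
  by apply: cvg_pair; [exact: cf | exact: cg].
move=> hf hg; have [df dk] := hf; have [dg dgk] := hg; split=> [x Ux|v].
  by have [] := bilin_comp_derive 0 cB (df x Ux) (dg x Ux).
(* Each term of the product rule has one undifferentiated factor, of class C^(k+1), whose order is
   lowered to match. *)
have h := Ck_add oU (IH _ _ (dk v) (Ck_S hg)) (IH _ _ (Ck_S hf) (dgk v)).
apply: Ck_eq h => // x Ux.
by have [_ ->] := bilin_comp_derive v cB (df x Ux) (dg x Ux).
Qed.

(** The derivative is -f' (1/f)^2, where 1/f is already of class C^k by induction. *)
Lemma Ck_inv V k (U : set V) (f : V -> R) : open U -> (forall x, U x -> f x != 0) ->
  Ck k U f -> Ck k U (fun x => (f x)^-1).
Proof.
move=> oU f0; elim: k => [|k IH].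
  by move=> /= cf x Ux; apply: cvgV; [exact: f0 | exact: cf].
move=> hf; have [df dk] := hf; split=> [x Ux|v].
  by apply: differentiableV; [exact: df | exact: f0].
have hi := IH (Ck_S hf).
have cm : continuous (fun p : R * R => p.1 * p.2) by move=> p; apply: mul_continuous.
have h : Ck k U (fun x => - ('D_v f x * ((f x)^-1 * (f x)^-1))).
  have h1 := Ck_bilin oU (B := @GRing.mul R) cm hi hi.
  have h2 := Ck_bilin oU (B := @GRing.mul R) cm (dk v) h1.
  have cN : continuous (@GRing.opp R) by move=> x; exact: opp_continuous.
  exact: (Ck_lin (L := @GRing.opp R) oU cN h2).
apply: Ck_eq h => // x Ux.
rewrite deriveV ?f0 //; last by apply: diff_derivable; exact: df.
by rewrite /GRing.scale /= mulNr -exprVn expr2 mulrC.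
Qed.

End CkTheory.

(** * Complex 2 x 2 matrices in coordinates *)

Section Matrices.
Context {R : realType}.
Local Notation C := R[i].
Local Notation M := (M2C R).
Local Notation vec := (vec R).

Lemma sum_ord2 (V : nmodType) (F : 'I_2 -> V) : \sum_(i < 2) F i = F 0 + F 1.
Proof.
by rewrite !big_ord_recl big_ord0 addr0; congr (_ + F _); apply/val_inj.
Qed.

Lemma M2C_lin_continuous (W : normedModType R) (L : {linear M -> W}) : continuous L.
Proof.
pose u (x : M) i j : W := x.1 i j *: L (delta_mx i j, 0) + x.2 i j *: L (0, delta_mx i j).
have LE x : L x = \sum_(i < 2) \sum_(j < 2) u x i j.
  have xE : x = \sum_(i < 2) \sum_(j < 2)
      (x.1 i j *: (delta_mx i j, 0) + x.2 i j *: (0, delta_mx i j) : M).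
    case: x => A B; rewrite [LHS](_ : _ = ((A, 0) + (0, B) : M)); last first.
      by congr (_, _); rewrite /= ?addr0 ?add0r.
    under eq_bigr do rewrite big_split /=.
    rewrite big_split /=; congr (_ + _).
      rewrite [A in LHS]matrix_sum_delta !sum_ord2.
      by congr (_, _); rewrite /= !scaler0 !addr0.
    rewrite [B in LHS]matrix_sum_delta !sum_ord2.
    by congr (_, _); rewrite /= !scaler0 !addr0.
  rewrite {1}xE linear_sum; apply: eq_bigr => i _; rewrite linear_sum.
  by apply: eq_bigr => j _; rewrite linearD !linearZ.
have -> : (L : M -> W) = (fun x => \sum_(i < 2) \sum_(j < 2) u x i j) by apply/funext.
have uc i j : continuous (fun x => u x i j).
  move=> x; apply: cvgD; apply: cvgZr_tmp.
    apply: (@continuous_comp _ _ _ fst (fun A : 'M[R]_2 => A i j)).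
      exact: cvg_fst.
    exact: coord_continuous.
  apply: (@continuous_comp _ _ _ snd (fun A : 'M[R]_2 => A i j)).
    exact: cvg_snd.
  exact: coord_continuous.
have -> : (fun x => \sum_(i < 2) \sum_(j < 2) u x i j) = (fun x => u x 0 0 + u x 0 1 + (u x 1 0 + u x 1 1)).
  by apply/funext => x; rewrite !sum_ord2.
by move=> x; apply: cvgD; apply: cvgD; apply: uc.
Qed.

Definition mat4 (a b c d : C) : 'M[C]_2 :=
  \matrix_(i, j) (if i == 0 then (if j == 0 then a else b) else (if j == 0 then c else d)).
(** Restores complex entries to a pair of real matrices, so that matrix identities become polynomial
    identities for [ring]. *)
Definition mk (a b c d : C) : M := of_cmx (mat4 a b c d).

Lemma to_cmxK : cancel (@to_cmx R) (@of_cmx R).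
Proof. by case=> A B; congr (_, _); apply/matrixP => i j; rewrite !mxE. Qed.
Lemma of_cmxK : cancel (@of_cmx R) (@to_cmx R).
Proof. by move=> A; apply/matrixP => i j; rewrite !mxE; case: (A i j). Qed.

Lemma forall_ord2 (P : 'I_2 -> Prop) : P 0 -> P 1 -> forall i, P i.
Proof.
move=> P0 P1 [[|[|//]] h]; first by rewrite (_ : Ordinal h = 0) //; apply/val_inj.
by rewrite (_ : Ordinal h = 1) //; apply/val_inj.
Qed.

Lemma mat4_surj (A : 'M[C]_2) : A = mat4 (A 0 0) (A 0 1) (A 1 0) (A 1 1).
Proof.
by apply/matrixP; apply: forall_ord2; apply: forall_ord2; rewrite mxE.
Qed.

Lemma mat4_mul (a b c d a' b' c' d' : C) : mat4 a b c d *m mat4 a' b' c' d' =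
  mat4 (a * a' + b * c') (a * b' + b * d') (c * a' + d * c') (c * b' + d * d').
Proof.
by apply/matrixP; apply: forall_ord2; apply: forall_ord2; rewrite !mxE sum_ord2 !mxE.
Qed.

Lemma mat4_det (a b c d : C) : \det (mat4 a b c d) = a * d - b * c.
Proof.
rewrite (expand_det_row _ 0) sum_ord2 /cofactor !det_mx11 !mxE /=.
by rewrite expr0 expr1; ring.
Qed.

Lemma mk_surj (x : M) : exists a b c d, x = mk a b c d.
Proof.
exists (to_cmx x 0 0), (to_cmx x 0 1), (to_cmx x 1 0), (to_cmx x 1 1).
by rewrite /mk -mat4_surj to_cmxK.
Qed.

Lemma mk_inj a b c d a' b' c' d' : mk a b c d = mk a' b' c' d' ->
  [/\ a = a', b = b', c = c' & d = d'].
Proof.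
move=> /(can_inj of_cmxK) /matrixP e.
by have := (e 0 0, e 0 1, e 1 0, e 1 1); rewrite !mxE /= => -[[[-> ->] ->] ->].
Qed.

Lemma cmul_mk a b c d a' b' c' d' : cmul (mk a b c d) (mk a' b' c' d') =
  mk (a * a' + b * c') (a * b' + b * d') (c * a' + d * c') (c * b' + d * d').
Proof. by rewrite /cmul !of_cmxK mat4_mul. Qed.

Lemma SL2_mk a b c d : SL2 (mk a b c d) <-> a * d - b * c = 1.
Proof. by rewrite /SL2 /= of_cmxK mat4_det. Qed.

Lemma sl2_mk a b c d : sl2 (mk a b c d) <-> d = - a.
Proof.
rewrite /sl2 /= of_cmxK /mxtrace sum_ord2 !mxE /= addrC.
by split=> [/eqP|->]; [rewrite addr_eq0 => /eqP | rewrite addNr].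
Qed.

Lemma mkD a b c d a' b' c' d' :
  mk a b c d + mk a' b' c' d' = mk (a + a') (b + b') (c + c') (d + d').
Proof.
by congr (_, _); apply/matrixP; apply: forall_ord2; apply: forall_ord2;
  rewrite !mxE /= raddfD.
Qed.

Lemma mkN a b c d : - mk a b c d = mk (- a) (- b) (- c) (- d).
Proof.
by congr (_, _); apply/matrixP; apply: forall_ord2; apply: forall_ord2;
  rewrite !mxE /= raddfN.
Qed.

Lemma mkZ (r : R) a b c d :
  r *: mk a b c d = mk (r%:C%C * a) (r%:C%C * b) (r%:C%C * c) (r%:C%C * d).
Proof.
move: a b c d => [a a'] [b b'] [c c'] [d d'].
by congr (_, _); apply/matrixP; apply: forall_ord2; apply: forall_ord2;
  rewrite !mxE /= ?mul0r ?subr0 ?addr0.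
Qed.

Lemma mk0 : 0 = mk 0 0 0 0.
Proof.
by congr (_, _); apply/matrixP; apply: forall_ord2; apply: forall_ord2; rewrite !mxE.
Qed.

Lemma cone_mk : cone = mk 1 0 0 1.
Proof. by rewrite /cone /mk [1%:M]mat4_surj !mxE. Qed.

Definition mkE := (mkD, mkN, mkZ, mk0, cmul_mk, cone_mk).

End Matrices.

Ltac mkcases := repeat match goal with
  | x : _ |- _ =>
      let a := fresh "a" in let b := fresh "b" in let c := fresh "c" in let d := fresh "d" in
      have [a [b [c [d ?]]]] := mk_surj x; subst x end.
Ltac mkring := mkcases; rewrite ?mkE; try (congr mk); ring.

(** * Matrix product, adjugate and the identification of sl2 with triples *)

Section CmulTheory.
Context {R : realType}.
Local Notation C := R[i].
Local Notation M := (M2C R).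
Local Notation vec := (vec R).
Implicit Types (x y z g h v : M) (j : vec -> vec).

Lemma cmul_bilinear : bilinear_for (GRing.Scale.Law.clone _ _ *:%R _)
  (GRing.Scale.Law.clone _ _ *:%R _) (@cmul R).
Proof. by split=> [y r x x' | x r y y'] /=; mkring. Qed.
HB.instance Definition _ := bilinear_isBilinear.Build R M M M _ _ (@cmul R) cmul_bilinear.

Lemma cmulA x y z : cmul x (cmul y z) = cmul (cmul x y) z. Proof. mkring. Qed.
Lemma cmul1 x : cmul x cone = x. Proof. mkring. Qed.
Lemma cmul1l x : cmul cone x = x. Proof. mkring. Qed.

Lemma cmul_linl y : linear (fun x => cmul x y). Proof. move=> r x x'; mkring. Qed.
Lemma cmul_linr x : linear (cmul x). Proof. move=> r y y'; mkring. Qed.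

Lemma cmulDr x y z : cmul x (y + z) = cmul x y + cmul x z. Proof. mkring. Qed.
Lemma cmulBr x y z : cmul x (y - z) = cmul x y - cmul x z. Proof. mkring. Qed.
Lemma cmulNr x y : cmul x (- y) = - cmul x y. Proof. mkring. Qed.
Lemma cmulNl x y : cmul (- x) y = - cmul x y. Proof. mkring. Qed.
Lemma cmul0r x : cmul x 0 = 0. Proof. mkring. Qed.

Definition linM (f : M -> M) (fl : linear f) : {linear M -> M} :=
  HB.pack f (GRing.isLinear.Build _ _ _ _ f fl).

Lemma cmul_continuous : continuous (fun p : M * M => cmul p.1 p.2).
Proof.
have e1 (u : 'M[R]_2) : (u, 0) = u 0 0 *: (delta_mx 0 0, 0) + u 0 1 *: (delta_mx 0 1, 0)
   + (u 1 0 *: (delta_mx 1 0, 0) + u 1 1 *: (delta_mx 1 1, 0)) :> M.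
  by rewrite {1}[u]matrix_sum_delta !sum_ord2; congr (_, _); rewrite /= !scaler0 !addr0.
have e2 (u : 'M[R]_2) : (0, u) = u 0 0 *: (0, delta_mx 0 0) + u 0 1 *: (0, delta_mx 0 1)
   + (u 1 0 *: (0, delta_mx 1 0) + u 1 1 *: (0, delta_mx 1 1)) :> M.
  by rewrite {1}[u]matrix_sum_delta !sum_ord2; congr (_, _); rewrite /= !scaler0 !addr0.
have coord (i j : 'I_2) : continuous (fun p : M * M => p.1.1 i j) /\ continuous (fun p : M * M => p.1.2 i j).
  split=> p.
    apply: (@continuous_comp _ _ _ (fun p : M * M => p.1.1) (fun A : 'M[R]_2 => A i j)).
      by apply: (@continuous_comp _ _ _ fst fst); exact: cvg_fst.
    exact: coord_continuous.
  apply: (@continuous_comp _ _ _ (fun p : M * M => p.1.2) (fun A : 'M[R]_2 => A i j)).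
    by apply: (@continuous_comp _ _ _ fst snd); [exact: cvg_fst | exact: cvg_snd].
  exact: coord_continuous.
have term (f : M * M -> R) (m : M) : continuous f -> continuous (fun p : M * M => f p *: cmul m p.2).
  move=> fc p; apply: cvgZ; first exact: fc.
  apply: (@continuous_comp _ _ _ snd (cmul m)); first exact: cvg_snd.
  exact: (@M2C_lin_continuous _ _ (linM (cmul_linr m))).
have -> : (fun p : M * M => cmul p.1 p.2) = (fun p =>
   (p.1.1 0 0 *: cmul (delta_mx 0 0, 0) p.2 + p.1.1 0 1 *: cmul (delta_mx 0 1, 0) p.2
   + (p.1.1 1 0 *: cmul (delta_mx 1 0, 0) p.2 + p.1.1 1 1 *: cmul (delta_mx 1 1, 0) p.2))
   + (p.1.2 0 0 *: cmul (0, delta_mx 0 0) p.2 + p.1.2 0 1 *: cmul (0, delta_mx 0 1) p.2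
   + (p.1.2 1 0 *: cmul (0, delta_mx 1 0) p.2 + p.1.2 1 1 *: cmul (0, delta_mx 1 1) p.2))).
  apply/funext => -[[A B] q] /=.
  have -> : (A, B) = (A, 0) + (0, B) :> M by congr (_, _); rewrite /= ?addr0 ?add0r.
  by rewrite [in LHS]e1 [in LHS]e2 !(linearDl, linearZl_LR).
move=> p; apply: cvgD; apply: cvgD; apply: cvgD; apply: term; by have [] := coord 0 0;
  have [] := coord 0 1; have [] := coord 1 0; have [] := coord 1 1.
Qed.

(** The adjugate: the inverse on SL2, yet linear on all matrices, so inverses differentiate without
    a quotient rule. *)
Definition cadj x : M := let A := to_cmx x in mk (A 1 1) (- A 0 1) (- A 1 0) (A 0 0).
(** Half the difference of the diagonal entries makes this the linear projection of all matrices
    onto sl2 along the scalar matrices. *)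
Definition tri x : vec := let A := to_cmx x in ((A 0 0 - A 1 1) / 2, A 0 1, A 1 0).
Definition mat (u : vec) : M := mk u.1.1 u.1.2 u.2 (- u.1.1).

Lemma cadj_mk a b c d : cadj (mk a b c d) = mk d (- b) (- c) a :> M.
Proof. by rewrite /cadj of_cmxK !mxE. Qed.
Lemma tri_mk a b c d : tri (mk a b c d : M) = ((a - d) / 2, b, c).
Proof. by rewrite /tri of_cmxK !mxE. Qed.

Lemma matK u : tri (mat u) = u.
Proof.
case: u => [[a b] c]; rewrite /mat tri_mk /=; congr (_, _, _).
by field.
Qed.
Lemma triK x : sl2 x -> mat (tri x) = x.
Proof.
by mkcases => /sl2_mk ->; rewrite tri_mk /mat /=; congr mk; field.
Qed.
Lemma mat_sl2 u : sl2 (mat u). Proof. exact/sl2_mk. Qed.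

Lemma tri_lin (r : R) x y : tri (r *: x + y) = r%:C%C *: tri x + tri y.
Proof.
by mkcases; rewrite !mkE !tri_mk; congr (_, _, _) => /=; rewrite /GRing.scale /=; field.
Qed.
Lemma mat_lin (r : R) (u w : vec) : mat (r%:C%C *: u + w) = r *: mat u + mat w.
Proof.
case: u => [[u1 u2] u3]; case: w => [[w1 w2] w3]; rewrite !(scE, addE) /mat !mkE.
by cbn [fst snd]; congr mk; rewrite ?scCE; ring. Qed.

Lemma mat_br (u w : vec) : mat (br u w) = commutator (mat u) (mat w).
Proof. by rewrite /commutator /mat !mkE; congr mk; rewrite /=; ring. Qed.

Lemma cadj_lin : linear cadj.
Proof. by move=> r x y; mkcases; rewrite !(mkE, cadj_mk); congr mk; ring. Qed.
Lemma cadjM x y : cadj (cmul x y) = cmul (cadj y) (cadj x).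
Proof. by mkcases; rewrite !(mkE, cadj_mk); congr mk; ring. Qed.
Lemma cadjK x : cadj (cadj x) = x.
Proof. by mkcases; rewrite !cadj_mk !opprK. Qed.
Lemma cadjV g : SL2 g -> cmul g (cadj g) = cone.
Proof.
mkcases => /SL2_mk e; rewrite !(mkE, cadj_mk); congr mk; rewrite -?e; ring.
Qed.
Lemma cadjVl g : SL2 g -> cmul (cadj g) g = cone.
Proof.
mkcases => /SL2_mk e; rewrite !(mkE, cadj_mk); congr mk; rewrite -?e; ring.
Qed.
Lemma SL2_cadj g : SL2 g -> SL2 (cadj g).
Proof. by mkcases; rewrite cadj_mk => /SL2_mk e; apply/SL2_mk; rewrite -e; ring. Qed.
Lemma SL2_1 : SL2 (cone : M).
Proof. by rewrite cone_mk; apply/SL2_mk; ring. Qed.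
Lemma SL2_mul g h : SL2 g -> SL2 h -> SL2 (cmul g h).
Proof.
mkcases => /SL2_mk e /SL2_mk e'; rewrite cmul_mk; apply/SL2_mk.
by rewrite -[1]mulr1 -{1}e -e'; ring.
Qed.
Lemma cmulVK g x : SL2 g -> cmul g (cmul (cadj g) x) = x.
Proof. by move=> hg; rewrite cmulA cadjV // cmul1l. Qed.
Lemma cmulKV g x : SL2 g -> cmul (cadj g) (cmul g x) = x.
Proof. by move=> hg; rewrite cmulA cadjVl // cmul1l. Qed.

(** The left side is the polarised determinant, the scalar matrix tr (adj(g) v); it arises on
    differentiating c(t) adj(c(t)) = 1. *)
Lemma sl2_polar g v : cmul v (cadj g) + cmul g (cadj v) = 0 -> sl2 (cmul (cadj g) v).
Proof.
mkcases; rewrite !(mkE, cadj_mk) => /mk_inj[e _ _ _]; apply/sl2_mk.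
by apply/eqP; rewrite -addr_eq0 -[X in _ == X]e; apply/eqP; ring.
Qed.

End CmulTheory.

(** * Tangent spaces of SL2 and differentials of maps on it *)

Section Tangent.
Context {R : realType}.
Local Notation C := R[i].
Local Notation M := (M2C R).
Local Notation vec := (vec R).
Implicit Types (g h : M) (j : vec -> vec).

Let cmulB : {bilinear M -> M -> M} := @cmul R.

Lemma Ck_cmul (V : normedModType R) k (U : set V) (f g : V -> M) : open U ->
  Ck k U f -> Ck k U g -> Ck k U (fun x => cmul (f x) (g x)).
Proof.
by move=> oU hf hg; exact: (@Ck_bilin R V M M M k U cmulB f g oU cmul_continuous hf hg).
Qed.

Lemma Ck_linM (V W : normedModType R) k (U : set V) (f : V -> M) (L : M -> W) :
  open U -> linear L -> Ck k U f -> Ck k U (fun x => L (f x)).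
Proof.
move=> oU Ll; pose L' : {linear M -> W} := HB.pack L (GRing.isLinear.Build _ _ _ _ L Ll).
by move=> hf; exact: (Ck_lin (L := L') oU (@M2C_lin_continuous _ _ L') hf).
Qed.

Lemma cmul_derive (V : normedModType R) (f g : V -> M) (x v : V) :
  differentiable f x -> differentiable g x ->
  differentiable (fun y => cmul (f y) (g y)) x /\
  'D_v (fun y => cmul (f y) (g y)) x = cmul ('D_v f x) (g x) + cmul (f x) ('D_v g x).
Proof. by move=> df dg; exact: (@bilin_comp_derive R V M M M cmulB f g x v cmul_continuous df dg). Qed.

Lemma linM_derive (V W : normedModType R) (f : V -> M) (L : M -> W) (x v : V) :
  linear L -> differentiable f x ->
  differentiable (fun y => L (f y)) x /\ 'D_v (fun y => L (f y)) x = L ('D_v f x).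
Proof.
move=> Ll; pose L' : {linear M -> W} := HB.pack L (GRing.isLinear.Build _ _ _ _ L Ll).
move=> df; exact: (lin_comp_derive (L := L') v (@M2C_lin_continuous _ _ L') df).
Qed.

Lemma cmul_derive1 (f g : R -> M) (x : R) :
  differentiable f x -> differentiable g x ->
  differentiable (fun y => cmul (f y) (g y)) x /\
  'D_1 (fun y => cmul (f y) (g y)) x = cmul ('D_1 f x) (g x) + cmul (f x) ('D_1 g x).
Proof. exact: (@cmul_derive R f g x 1). Qed.

Lemma linM_derive1 (W : normedModType R) (f : R -> M) (L : M -> W) (x : R) :
  linear L -> differentiable f x ->
  differentiable (fun y => L (f y)) x /\ 'D_1 (fun y => L (f y)) x = L ('D_1 f x).
Proof. exact: (@linM_derive R W f L x 1). Qed.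

Lemma curve_differentiable (V : normedModType R) (S : set V) p v (c : R -> V) :
  curve_in S p v c -> differentiable c 0 /\ 'D_1 c 0 = v.
Proof.
move=> [_ <- [U [oU U0 cU _]]]; rewrite derive1E; split=> //.
by have [+ _] := cU 1%N; apply.
Qed.

(** Along any curve in [S] the germs of [f] and [F] agree, so the chain rule gives the same value
    for every curve of velocity [v]; tangency of [v] supplies a curve for [xget] to find. *)
Lemma differentialE (V W : normedModType R) (S : set V) (f F : V -> W) p v (U : set V) :
  open U -> U p -> differentiable F p -> (forall x, U x -> S x -> F x = f x) ->
  tangent S p v -> differential S f p v = 'D_v F p.
Proof.
move=> oU Up dF Ff [c0 hc0].
have key c : curve_in S p v c -> derive1 (f \o c) 0 = 'D_v F p.
  move=> hc; have [dc Dc] := curve_differentiable hc.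
  have [cp _ [U' [oU' U'0 _ cS]]] := hc.
  have cc : {for 0, continuous c} by exact: differentiable_continuous.
  have nU : \forall t \near (0 : R), U (c t).
    by apply: cc; apply: open_nbhs_nbhs; rewrite cp; split.
  have nU' : \forall t \near (0 : R), U' t by apply: open_nbhs_nbhs; split.
  rewrite derive1E (@near_eq_derive _ _ _ _ (F \o c)); last first.
    by apply: filterS2 nU nU' => t Ut U't; rewrite /= Ff //; exact: cS.
  have dF' : differentiable F (c 0) by rewrite cp.
  have d : differentiable (F \o c) 0 by exact: differentiable_comp dc dF'.
  rewrite [LHS](deriveE _ d) (diff_comp dc dF') /= -(deriveE _ dc) Dc cp.
  by rewrite deriveE.
rewrite /differential; apply: xget_unique; last first.
  by move=> w [c hc ->]; rewrite (key _ hc).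
by exists c0 => //; rewrite (key _ hc0).
Qed.

(** For traceless N, det (1 + tN) = 1 - t^2 tr (N^2) / 2. For isotropic [u] the curve 1 + tN is exp
    (tN), available as a polynomial. *)
Lemma unipotent_SL2 (u : vec) (t : R) : trform u u = 0 -> SL2 (cone + t *: mat u).
Proof.
case: u => [[a b] c]; rewrite trformE /mat !mkE /= => e; apply/SL2_mk.
transitivity (1 - t%:C%C ^+ 2 * (2 * a * a + b * c + c * b) / 2); first by field.
by rewrite e; ring.
Qed.

Definition unipotent_curve (u : vec) (t : R) : M := cone + t *: mat u.

Let scaleM_linear (x : M) : linear (fun t : R => t *: x).
Proof. by move=> r s t; rewrite scalerDl scalerA. Qed.
Let scaleM (x : M) : {linear R -> M} :=
  HB.pack (fun t : R => t *: x) (GRing.isLinear.Build _ _ _ _ (fun t : R => t *: x) (scaleM_linear x)).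
Let scaleM_continuous (x : M) : continuous (scaleM x).
Proof. by move=> t; exact: scalel_continuous. Qed.

Lemma unipotent_curve_smooth u k : Ck k setT (unipotent_curve u).
Proof.
have h1 : Ck k setT (cst cone : R -> M) by exact: Ck_cst.
have h2 := @Ck_lin R R R M k setT (scaleM (mat u)) id openT (@scaleM_continuous (mat u)) (Ck_id k setT).
exact: (Ck_add openT h1 h2).
Qed.

Lemma unipotent_curve_derive u : differentiable (unipotent_curve u) 0 /\
  'D_1 (unipotent_curve u) 0 = mat u.
Proof.
have [d _] := unipotent_curve_smooth u 1; have d0 := d 0 I; split=> //.
have did : differentiable (id : R -> R) 0 by apply: ex_diff; exact: is_diff_id.
have [dL DL] := @lin_comp_derive R R R M (scaleM (mat u)) id 0 1 (@scaleM_continuous (mat u)) did.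
have -> : unipotent_curve u = cst (cone : M) + (scaleM (mat u) \o id) by [].
rewrite deriveD; [|exact: derivable_cst | exact: diff_derivable].
by rewrite derive_cst add0r DL derive_id /= scale1r.
Qed.

Lemma curve_sl2 (c : R -> M) g : SL2 g -> c 0 = g -> differentiable c 0 ->
  (\forall t \near (0 : R), SL2 (c t)) -> sl2 (cmul (cadj g) ('D_1 c 0)).
Proof.
move=> hg c0 dc cS.
have [da Da] := linM_derive1 cadj_lin dc.
have [dm] := cmul_derive1 dc da; rewrite Da c0.
have nc : \forall t \near (0 : R), cmul (c t) (cadj (c t)) = cst (cone : M) t.
  by apply: filterS cS => t ct; rewrite cadjV.
by rewrite (@near_eq_derive _ R M _ _ 0 1 nc) derive_cst => /esym /sl2_polar.
Qed.

Lemma tangentP g (v : M) : SL2 g -> tangent SL2 g v <-> sl2 (cmul (cadj g) v).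
Proof.
move=> hg; split=> [[c hc]|].
  have [dc <-] := curve_differentiable hc; have [c0 _ [U [oU U0 _ cS]]] := hc.
  apply: curve_sl2 => //; apply: (@filterS _ _ _ U); first by move=> t; apply: cS.
  by apply: open_nbhs_nbhs; split.
set X := cmul (cadj g) v; move=> hX.
have [a [b [c XE]]] : exists a b c, X = mat (a, b, c).
  by have := triK hX; case: (tri X) => [[a b] c] <-; exists a, b, c.
(* Every element of sl2 is a sum of three nilpotent ones; the product of their unipotent curves,
   translated by [g], has the required velocity. *)
pose A1 : vec := (a, a, - a); pose A2 : vec := (0, b - a, 0); pose A3 : vec := (0, 0, c + a).
pose f t := cmul g (cmul (unipotent_curve A1 t) (cmul (unipotent_curve A2 t) (unipotent_curve A3 t))).
have u0 u : unipotent_curve u 0 = cone by rewrite /unipotent_curve scale0r addr0.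
have fs k : Ck k setT f.
  apply: (Ck_linM openT (cmul_linr g)).
  by do ?[apply: (Ck_cmul openT)]; exact: unipotent_curve_smooth.
exists f; split.
- by rewrite /f !u0 !cmul1.
- have [d1 D1] := unipotent_curve_derive A1.
  have [d2 D2] := unipotent_curve_derive A2.
  have [d3 D3] := unipotent_curve_derive A3.
  have [d23 D23] := cmul_derive1 d2 d3.
  have [d123 D123] := cmul_derive1 d1 d23.
  have [_ D] := linM_derive1 (cmul_linr g) d123.
  rewrite derive1E D D123 D23 D1 D2 D3 !u0 !cmul1 !cmul1l.
  rewrite -[v](cmulVK _ hg) -/X XE /A1 /A2 /A3 /mat !mkE; congr cmul.
  by congr mk => /=; ring.
- exists setT; split=> //; first exact: openT.
  move=> t _; apply: SL2_mul => //; do ?[apply: SL2_mul]; apply: unipotent_SL2;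
    by rewrite trformE; ring.
Qed.

End Tangent.

(** * The left-invariant structure on the group defined by [j] *)

Section LeftInvariant.
Context {R : realType}.
Local Notation C := R[i].
Local Notation M := (M2C R).
Local Notation vec := (vec R).
Implicit Types (x y z g h v w : M) (j : vec -> vec) (u : vec) (J : endo_field R).

(** Extends [j] to all matrices by discarding the scalar part; [Jof j] is then given off SL2 by the
    same formula, ready to be differentiated in the ambient space. *)
Definition jM j x : M := mat (j (tri x)).
Definition Jof j : endo_field R := fun g v => cmul g (jM j (cmul (cadj g) v)).

Lemma jM_lin j : rlinear j -> linear (jM j).
Proof. by move=> jl r x y; rewrite /jM tri_lin jl mat_lin. Qed.
Lemma jM_mat j u : jM j (mat u) = mat (j u).
Proof. by rewrite /jM matK. Qed.
Lemma matD u u' : mat (u + u') = mat u + mat u' :> M.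
Proof. by have := mat_lin 1 u u'; rewrite !scale1r. Qed.
Lemma mat0 : mat 0 = 0 :> M.
Proof. by rewrite /mat mk0 /= oppr0. Qed.
Lemma matN u : mat (- u) = - mat u :> M.
Proof. by apply: (addrI (mat u)); rewrite -matD !subrr mat0. Qed.
Lemma matB u u' : mat (u - u') = mat u - mat u' :> M.
Proof. by rewrite matD matN. Qed.
Lemma mat_inj : injective (@mat R).
Proof. exact: can_inj (@matK R). Qed.
Lemma cadj_mat u : cadj (mat u) = - mat u :> M.
Proof. by rewrite /mat cadj_mk mkN opprK. Qed.

Lemma tangent_mul g u : SL2 g -> tangent SL2 g (cmul g (mat u)).
Proof. by move=> hg; apply/tangentP => //; rewrite cmulKV //; exact: mat_sl2. Qed.
Lemma tangent_repr g v : SL2 g -> tangent SL2 g v -> exists u, v = cmul g (mat u).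
Proof.
move=> hg /(tangentP v hg) hv; exists (tri (cmul (cadj g) v)).
by rewrite triK // cmulVK.
Qed.
Lemma Jof_mul j g u : SL2 g -> Jof j g (cmul g (mat u)) = cmul g (mat (j u)).
Proof. by move=> hg; rewrite /Jof cmulKV // jM_mat. Qed.

Lemma linear_smooth f : linear f -> smooth_on SL2 (f : M -> M).
Proof.
move=> fl p _; exists setT, f; split=> //; first exact: openT.
by move=> k; apply: (Ck_linM openT fl); exact: Ck_id.
Qed.

Lemma linear_diffeomorphism f f' : linear f -> linear f' ->
  (forall g, SL2 g -> SL2 (f g) /\ SL2 (f' g)) ->
  (forall g, SL2 g -> f' (f g) = g) -> (forall g, SL2 g -> f (f' g) = g) ->
  @diffeomorphism R f.
Proof. by move=> fl f'l fS fK f'K; exists f'; split=> //; exact: linear_smooth. Qed.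

Lemma linear_differential f g v : linear f -> tangent SL2 g v ->
  differential SL2 f g v = f v :> M.
Proof.
move=> fl tv.
have did : differentiable (id : M -> M) g by apply: ex_diff; exact: is_diff_id.
have [df Df] := @linM_derive R M M id f g v fl did.
by rewrite (@differentialE R M M SL2 f f g v setT openT I df) // Df derive_id.
Qed.

Lemma left_translation_diffeo g : SL2 g -> diffeomorphism (left_translation g).
Proof.
move=> hg; apply: (@linear_diffeomorphism _ (left_translation (cadj g))).
- exact: cmul_linr.
- exact: cmul_linr.
- by move=> h hh; split; apply: SL2_mul => //; exact: SL2_cadj.
- by move=> h _; exact: cmulKV.
- by move=> h _; exact: cmulVK.
Qed.

Lemma right_translation_diffeo g : SL2 g -> diffeomorphism (right_translation g).
Proof.
move=> hg; apply: (@linear_diffeomorphism _ (right_translation (cadj g))).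
- exact: cmul_linl.
- exact: cmul_linl.
- by move=> h hh; split; apply: SL2_mul => //; exact: SL2_cadj.
- by move=> h _; rewrite /right_translation -cmulA cadjV // cmul1.
- by move=> h _; rewrite /right_translation -cmulA cadjVl // cmul1.
Qed.

Lemma Ck_Jof k (U : set M) (F : M -> M) j : open U -> rlinear j -> Ck k U F ->
  Ck k U (fun x => Jof j x (F x)).
Proof.
move=> oU jl cF; apply: (Ck_cmul oU); first exact: Ck_id.
apply: (Ck_linM oU (jM_lin jl)); apply: (Ck_cmul oU) => //.
by apply: (Ck_linM oU cadj_lin); exact: Ck_id.
Qed.

Lemma Jof_almost_complex j : rlinear j -> (forall u, j (j u) = - u) ->
  almost_complex_structure (Jof j).
Proof.
move=> jl jj; split.
- by move=> g v hg /(tangent_repr hg)[u ->]; rewrite Jof_mul //; exact: tangent_mul.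
- move=> g a v w hg _ _; rewrite /Jof.
  by rewrite (cmul_linr (cadj g)) (jM_lin jl) (cmul_linr g).
- move=> g v hg /(tangent_repr hg)[u ->]; rewrite !Jof_mul // jj matN.
  by rewrite cmulNr.
- move=> V [sV _] p Sp; have [U [F [oU Up cF FV]]] := sV p Sp.
  exists U, (fun x => Jof j x (F x)).
  split; [exact: oU | exact: Up | by move=> k; exact: Ck_Jof oU jl (cF k) |].
  by move=> x Ux Sx; rewrite /app_field FV.
Qed.

(* Writing V = g a with a valued in sl2 and D_u V = g (u a + d u), the terms containing the
   derivative d cancel in the Nijenhuis tensor because j is constant in this frame. *)
Lemma covariant_derivative (V : M -> M) g : vector_field V -> SL2 g ->
  exists a (d : vec -> vec), V g = cmul g (mat a) /\
  forall u, differential SL2 V g (cmul g (mat u)) = cmul g (cmul (mat u) (mat a) + mat (d u)) /\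
    forall j, rlinear j ->
     differential SL2 (app_field (Jof j) V) g (cmul g (mat u)) =
     cmul g (cmul (mat u) (mat (j a)) + mat (j (d u))).
Proof.
move=> [sV tV] hg; have [a aE] := tangent_repr hg (tV g hg).
have [U [F [oU Ug cF FV]]] := sV g hg.
have dF : differentiable F g by have [+ _] := cF 1%N; apply.
have Fg : F g = cmul g (mat a) by rewrite FV.
have did : differentiable (id : M -> M) g by apply: ex_diff; exact: is_diff_id.
pose G x := cmul (cadj x) (F x).
pose w u := cmul g (mat u).
pose P u := cmul (cadj g) ('D_(w u) F g).
have hw u : tangent SL2 g (w u) by exact: tangent_mul.
have DG u : differentiable G g /\ 'D_(w u) G g = P u - cmul (mat u) (mat a).
  have [da Da] := @linM_derive R M M id (@cadj R) g (w u) cadj_lin did.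
  have [dG DG] := @cmul_derive R M _ _ g (w u) da dF.
  split; first exact: dG.
  rewrite [LHS]DG Da derive_id Fg /w cadjM cadj_mat -[X in X + _]cmulA cmulKV //.
  by rewrite cmulNl addrC.
(* The scalar part of a matrix. The map [G] is traceless only at points of SL2, so the derivative of
   its scalar part vanishes because the direction is tangent; this puts the derivative of [G] in
   sl2. *)
pose sc x : M := x - mat (tri x).
have scl : linear sc.
  move=> r x y; rewrite /sc tri_lin mat_lin scalerBr; move: (mat _) (mat (tri y)) => m m'.
  by rewrite opprD addrACA.
have PE u : P u = cmul (mat u) (mat a) + mat (tri (P u - cmul (mat u) (mat a))).
  have [dG DGu] := DG u.
  have [ds Ds] := @linM_derive R M M G sc g (w u) scl dG.
  have e1 := @differentialE R M M SL2 (cst 0) _ g (w u) U oU Ug ds.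
  have e2 := @differentialE R M M SL2 (cst 0) (cst 0) g (w u) U oU Ug (differentiable_cst _ _) (fun _ _ _ => erefl) (hw u).
  have : sc (P u - cmul (mat u) (mat a)) = 0.
    rewrite -DGu -Ds -e1 ?e2 ?derive_cst //.
    move=> x Ux Sx; rewrite /= /sc /G FV //.
    have [b ->] := tangent_repr Sx (tV x Sx).
    by rewrite cmulKV // matK subrr.
  by rewrite /sc => /eqP; rewrite subr_eq0 => /eqP <-; rewrite addrC subrK.
exists a, (fun u => tri (P u - cmul (mat u) (mat a))); split=> // u.
split.
  rewrite (@differentialE R M M SL2 V F g (w u) U oU Ug dF FV (hw u)).
  by rewrite -PE /P cmulVK.
move=> j jl.
have [dG DGu] := DG u.
have [dj Dj] := @linM_derive R M M G (jM j) g (w u) (jM_lin jl) dG.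
have [dJ DJ] := @cmul_derive R M id _ g (w u) did dj.
have FJ x : U x -> SL2 x -> cmul x (jM j (G x)) = app_field (Jof j) V x.
  by move=> Ux Sx; rewrite /app_field /Jof /G FV.
rewrite (@differentialE R M M SL2 _ _ g (w u) U oU Ug dJ FJ (hw u)).
rewrite [LHS]DJ derive_id Dj DGu {1}/G Fg cmulKV // jM_mat /w -cmulA.
by rewrite -cmulDr.
Qed.

Lemma Jof_integrable j : cxs j -> Defs.integrable (Jof j).
Proof.
move=> [jl jj jn] V W hV hW g hg.
have [a [d [Vg dV]]] := covariant_derivative hV hg.
have [b [e [Wg dW]]] := covariant_derivative hW hg.
have JV : app_field (Jof j) V g = cmul g (mat (j a)) by rewrite /app_field Vg Jof_mul.
have JW : app_field (Jof j) W g = cmul g (mat (j b)) by rewrite /app_field Wg Jof_mul.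
have key u u' (x y : vec) (D D' : M) : D = cmul g (cmul (mat u) (mat u') + mat x) ->
    D' = cmul g (cmul (mat u') (mat u) + mat y) -> D - D' = cmul g (mat (br u u' + x - y)).
  by move=> -> ->; rewrite -cmulBr; congr cmul; rewrite matB matD mat_br opprD addrACA addrA.
have L1 : lie_bracket (app_field (Jof j) V) (app_field (Jof j) W) g =
    cmul g (mat (br (j a) (j b) + j (e (j a)) - j (d (j b)))).
  by rewrite /lie_bracket JV JW; exact: key ((dW (j a)).2 j jl) ((dV (j b)).2 j jl).
have L2 : lie_bracket (app_field (Jof j) V) W g = cmul g (mat (br (j a) b + e (j a) - j (d b))).
  by rewrite /lie_bracket JV Wg; exact: key (dW (j a)).1 ((dV b).2 j jl).
have L3 : lie_bracket V (app_field (Jof j) W) g = cmul g (mat (br a (j b) + j (e a) - d (j b))).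
  by rewrite /lie_bracket JW Vg; exact: key ((dW a).2 j jl) (dV (j b)).1.
have L4 : lie_bracket V W g = cmul g (mat (br a b + e a - d b)).
  by rewrite /lie_bracket Vg Wg; exact: key (dW a).1 (dV b).1.
rewrite /nijenhuis L1 L2 L3 L4 !Jof_mul // -!cmulBr -!matB.
suff -> : br (j a) (j b) + j (e (j a)) - j (d (j b))
   - j (br (j a) b + e (j a) - j (d b)) - j (br a (j b) + j (e a) - d (j b))
   - (br a b + e a - d b) = 0 by rewrite mat0 cmul0r.
(* By j^2 = -1 the derivative terms [d] and [e] cancel in pairs, leaving the algebraic Nijenhuis
   tensor at (a, b). *)
rewrite !(rlinB jl) !(rlinD jl) !jj.
rewrite -[RHS](jn a b).
move: (j (e (j a))) (j (d (j b))) (j (br (j a) b)) (j (br a (j b))) (br (j a) (j b)) (br a b) => x1 x2 x3 x4 x5 x6.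
move: (e a) (d b) => y1 y2.
move: x1 x2 x3 x4 x5 x6 y1 y2 => [[? ?] ?] [[? ?] ?] [[? ?] ?] [[? ?] ?] [[? ?] ?] [[? ?] ?] [[? ?] ?] [[? ?] ?].
by rewrite !(oppE, addE); cbn [fst snd]; congr (_, _, _); ring.
Qed.

Lemma Jof_left_invariant j : left_invariant (Jof j).
Proof.
move=> a ha; split; first exact: left_translation_diffeo.
move=> g v hg tv; have [u uE] := tangent_repr hg tv.
have jt : tangent SL2 g (Jof j g v) by rewrite uE Jof_mul //; exact: tangent_mul.
rewrite !(linear_differential (cmul_linr a)) // uE /left_translation.
by rewrite cmulA !Jof_mul ?cmulA //; exact: SL2_mul.
Qed.

Lemma Jof_complex j : cxs j -> left_invariant_complex_structure (Jof j).
Proof.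
move=> hj; split; last exact: Jof_left_invariant.
split; last exact: Jof_integrable.
exact: Jof_almost_complex (cxs_lin hj) (cxs_sq hj).
Qed.

End LeftInvariant.

(** * From the group to [j], and lifting similarities to equivalences *)

Section Equivalence.
Context {R : realType}.
Local Notation C := R[i].
Local Notation M := (M2C R).
Local Notation vec := (vec R).
Implicit Types (x y z g h v w : M) (j k phi : vec -> vec) (u : vec) (J : endo_field R).

(** Values of an [endo_field] off the tangent spaces of SL2 are arbitrary, so agreement with [Jof j]
    can be asked only there. *)
Definition represents j J := forall g v, SL2 g -> tangent SL2 g v -> J g v = Jof j g v.

Lemma represents_mul j J g u : represents j J -> SL2 g ->
  J g (cmul g (mat u)) = cmul g (mat (j u)).
Proof. by move=> hJ hg; rewrite hJ // ?Jof_mul //; exact: tangent_mul. Qed.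

Lemma represents_Jof j : represents j (Jof j).
Proof. by []. Qed.

Lemma tangent_cone u : tangent SL2 (cone : M) (mat u).
Proof. by rewrite -[mat u]cmul1l; apply: tangent_mul; exact: SL2_1. Qed.

Lemma left_field a : vector_field (fun g : M => cmul g (mat a)).
Proof.
split; first exact: linear_smooth (cmul_linl (mat a)).
by move=> g hg; exact: tangent_mul.
Qed.

Lemma left_field_differential (V : M -> M) a u g : SL2 g ->
  (forall x, SL2 x -> V x = cmul x (mat a)) ->
  differential SL2 V g (cmul g (mat u)) = cmul g (cmul (mat u) (mat a)).
Proof.
move=> hg VE.
have did : differentiable (id : M -> M) g by apply: ex_diff; exact: is_diff_id.
have [df Df] := @linM_derive R M M id (fun x => cmul x (mat a)) g (cmul g (mat u)) (cmul_linl (mat a)) did.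
have Fg x : setT x -> SL2 x -> cmul x (mat a) = V x by move=> _ /VE ->.
have hu : tangent SL2 g (cmul g (mat u)) by exact: tangent_mul.
rewrite (@differentialE R M M SL2 V _ g (cmul g (mat u)) setT openT I df Fg hu).
by rewrite Df derive_id cmulA.
Qed.

Lemma left_field_bracket (V W : M -> M) a b g : SL2 g ->
  (forall x, SL2 x -> V x = cmul x (mat a)) ->
  (forall x, SL2 x -> W x = cmul x (mat b)) ->
  lie_bracket V W g = cmul g (mat (br a b)).
Proof.
move=> hg VE WE; rewrite /lie_bracket (VE g hg) (WE g hg).
have e1 := left_field_differential a hg WE; have e2 := left_field_differential b hg VE.
by rewrite e1 e2 -cmulBr mat_br.
Qed.

(** [j] is J at the identity. Brackets of left-invariant fields are brackets in sl2, so
    integrability tested on these fields is exactly [cxs_nij]. *)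
Lemma left_invariant_represented J : left_invariant_complex_structure J ->
  exists j, cxs j /\ represents j J.
Proof.
move=> [[[Jt Jl JJ _] Ji] Jinv].
pose j u := tri (J cone (mat u)).
have h1 : SL2 (cone : M) by exact: SL2_1.
have mj u : mat (j u) = J cone (mat u).
  apply: triK; have /(tangentP _ h1) := Jt _ _ h1 (tangent_cone u).
  suff -> : cadj cone = cone :> M by rewrite cmul1l.
  by rewrite cone_mk cadj_mk oppr0.
have Jg g u : SL2 g -> J g (cmul g (mat u)) = cmul g (mat (j u)).
  move=> hg; have [_ /(_ cone (mat u) h1 (tangent_cone u))] := Jinv g hg.
  have d1 := @linear_differential R _ cone (mat u) (cmul_linr g) (tangent_cone u).
  have d2 := @linear_differential R _ cone (mat (j u)) (cmul_linr g) (tangent_cone (j u)).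
  by rewrite -mj /left_translation d1 d2 cmul1.
have rep : represents j J.
  by move=> g v hg /(tangent_repr hg)[u ->]; rewrite Jg // Jof_mul.
exists j; split=> //; split.
- move=> r u u'; rewrite /j mat_lin Jl //; try exact: tangent_cone.
  exact: tri_lin.
- by move=> u; apply: (@mat_inj R); rewrite !mj JJ // ?matN //; exact: tangent_cone.
- move=> a b; have hV := left_field a; have hW := left_field b.
  have := Ji _ _ hV hW cone h1; rewrite /nijenhuis.
  have VE c x : SL2 x -> cmul x (mat c) = cmul x (mat c) by [].
  have JE c x : SL2 x -> app_field J (fun g => cmul g (mat c)) x = cmul x (mat (j c)).
    by move=> hx; rewrite /app_field Jg.
  rewrite (left_field_bracket h1 (JE a) (JE b)) (left_field_bracket h1 (JE a) (VE b)).
  rewrite (left_field_bracket h1 (VE a) (JE b)) (left_field_bracket h1 (VE a) (VE b)).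
  rewrite !Jg // -!cmulBr -!matB cmul1l -mat0.
  exact: mat_inj.
Qed.

(** An automorphism that is linear on the whole matrix space is its own differential, so [la_mat]
    describes its action on every tangent space. *)
Record linauto (f f' : M -> M) phi : Prop := LinAuto {
  la_lin : linear f;
  la_lin' : linear f';
  la_mul : forall x y, f (cmul x y) = cmul (f x) (f y);
  la_SL2 : forall g, SL2 g -> SL2 (f g);
  la_SL2' : forall g, SL2 g -> SL2 (f' g);
  la_K : cancel f f';
  la_K' : cancel f' f;
  la_mat : forall u, f (mat u) = mat (phi u) }.

Definition conjugation (g : M) x := cmul (cmul g x) (cadj g).

Lemma linauto_conjugation g phi : SL2 g ->
  (forall u, conjugation g (mat u) = mat (phi u)) ->
  linauto (conjugation g) (conjugation (cadj g)) phi.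
Proof.
move=> hg hphi; have hg' := SL2_cadj hg.
have lin z : linear (conjugation z) by move=> r x y; rewrite /conjugation cmul_linr cmul_linl.
split=> //; rewrite /conjugation.
- by move=> x y; rewrite -!cmulA (cmulKV _ hg).
- by move=> x hx; do ?[apply: SL2_mul].
- by move=> x hx; do ?[apply: SL2_mul]; rewrite // cadjK.
- by move=> x; rewrite -!cmulA cadjK cadjVl // cmul1 cmulKV.
- by move=> x; rewrite -!cmulA cadjK cadjV // cmul1 cmulVK.
Qed.

Definition mconj x : M := (x.1, - x.2).

Lemma mconj_mk a b c d : mconj (mk a b c d : M) = mk (a^*)%C (b^*)%C (c^*)%C (d^*)%C.
Proof.
by congr (_, _); apply/matrixP; apply: forall_ord2; apply: forall_ord2;
  rewrite !mxE /=; case: (a) (b) (c) (d) => [? ?] [? ?] [? ?] [? ?].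
Qed.

(** Generators are conjugations by matrices of SL2 or entrywise complex conjugation, so no
    integration of Lie algebra automorphisms is required. *)
Lemma gen_linauto phi : gen phi -> exists f f', linauto f f' phi.
Proof.
elim=> {phi} [|t||l l0||p q _ [f [f' hf]] _ [g [g' hg]]].
- by exists idfun, idfun; split.
- exists (conjugation (mk 1 t 0 1)), (conjugation (cadj (mk 1 t 0 1))).
  apply: linauto_conjugation; first by apply/SL2_mk; ring.
  case=> [[a b] c]; rewrite /conjugation /mat /adU cadj_mk !mkE; cbn [fst snd].
  by congr mk; ring.
- exists (conjugation (mk 0 1 (-1) 0)), (conjugation (cadj (mk 0 1 (-1) 0))).
  apply: linauto_conjugation; first by apply/SL2_mk; ring.
  case=> [[a b] c]; rewrite /conjugation /mat /adW cadj_mk !mkE; cbn [fst snd].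
  by congr mk; ring.
- exists (conjugation (mk l 0 0 l^-1)), (conjugation (cadj (mk l 0 0 l^-1))).
  apply: linauto_conjugation; first by apply/SL2_mk; field.
  case=> [[a b] c]; rewrite /conjugation /mat /adD cadj_mk !mkE; cbn [fst snd].
  by congr mk; field.
- have lin : linear mconj.
    by move=> r [x1 x2] [y1 y2]; congr (_, _); rewrite /= opprD scalerN.
  exists mconj, mconj; split=> //.
  + move=> x y; have [a [b [c [d ->]]]] := mk_surj x; have [a' [b' [c' [d' ->]]]] := mk_surj y.
    by rewrite !(cmul_mk, mconj_mk) !conjE.
  + move=> x; have [a [b [c [d ->]]]] := mk_surj x; rewrite mconj_mk => /SL2_mk e.
    by apply/SL2_mk; rewrite -!conjE e conjc1.
  + move=> x; have [a [b [c [d ->]]]] := mk_surj x; rewrite mconj_mk => /SL2_mk e.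
    by apply/SL2_mk; rewrite -!conjE e conjc1.
  + by case=> x1 x2; rewrite /mconj /= opprK.
  + by case=> x1 x2; rewrite /mconj /= opprK.
  + by case=> [[a b] c]; rewrite /mat mconj_mk /cj /= conjcN.
- exists (f \o g), (g' \o f'); split=> /=.
  + by move=> r x y /=; rewrite (la_lin hg) (la_lin hf).
  + by move=> r x y /=; rewrite (la_lin' hf) (la_lin' hg).
  + by move=> x y /=; rewrite (la_mul hg) (la_mul hf).
  + by move=> x /(la_SL2 hg) /(la_SL2 hf).
  + by move=> x /(la_SL2' hf) /(la_SL2' hg).
  + by move=> x /=; rewrite (la_K hf) (la_K hg).
  + by move=> x /=; rewrite (la_K' hg) (la_K' hf).
  + by move=> u /=; rewrite (la_mat hg) (la_mat hf).
Qed.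

Lemma linauto_lie f f' phi : linauto f f' phi -> lie_automorphism f.
Proof.
move=> h; split; last by move=> x y _ _; exact: la_mul h x y.
apply: (linear_diffeomorphism (la_lin h) (la_lin' h)).
- by move=> g hg; split; [exact: la_SL2 h g hg | exact: la_SL2' h g hg].
- by move=> g _; exact: la_K h g.
- by move=> g _; exact: la_K' h g.
Qed.

Lemma sim_equivalent j k J : represents j J -> sim j k -> equivalent J (Jof k).
Proof.
move=> hJ [phi [/gen_linauto[f [f' hf]] phiE]]; exists f; split; first exact: linauto_lie hf.
move=> g v hg /(tangent_repr hg)[u ->]; have fl := la_lin hf.
rewrite (represents_mul u hJ hg).
have d1 := @linear_differential R _ g _ fl (tangent_mul u hg).
have d2 := @linear_differential R _ g _ fl (tangent_mul (j u) hg).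
rewrite d1 d2 !(la_mul hf) !(la_mat hf) phiE Jof_mul //.
exact: la_SL2 hf g hg.
Qed.

End Equivalence.

(** * From equivalences and right invariance back to the Lie algebra *)

Section Invariants.
Context {R : realType}.
Local Notation C := R[i].
Local Notation M := (M2C R).
Local Notation vec := (vec R).
Implicit Types (x y z g h v w : M) (j k phi : vec -> vec) (u : vec) (J : endo_field R).

Lemma curve_chain (F : M -> M) (c : R -> M) p : c 0 = p -> differentiable c 0 ->
  differentiable F p ->
  differentiable (fun t => F (c t)) 0 /\ 'D_1 (fun t => F (c t)) 0 = 'd F p ('D_1 c 0).
Proof.
move=> cp dc dF; have dF' : differentiable F (c 0) by rewrite cp.
have d : differentiable (F \o c) 0 := differentiable_comp dc dF'.
by split=> //; rewrite [LHS](deriveE _ d) (diff_comp dc dF') /= -(deriveE _ dc) cp.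
Qed.

Lemma curve_exists u : exists c : R -> M, [/\ differentiable c 0, c 0 = cone,
  'D_1 c 0 = mat u & \forall t \near (0 : R), SL2 (c t)].
Proof.
have [c hc] := tangent_cone u; have [dc Dc] := curve_differentiable hc.
exists c; have [c0 _ [U [oU U0 _ cS]]] := hc; split=> //.
by apply: filterS cS _; apply: open_nbhs_nbhs; split.
Qed.

Lemma cadj_cone : cadj cone = cone :> M.
Proof. by rewrite cone_mk cadj_mk oppr0. Qed.

Lemma adjoint_derive (c : R -> M) u x : differentiable c 0 -> c 0 = cone ->
  'D_1 c 0 = mat u ->
  differentiable (fun t => cmul (c t) (cmul x (cadj (c t)))) 0 /\
  'D_1 (fun t => cmul (c t) (cmul x (cadj (c t)))) 0 = cmul (mat u) x - cmul x (mat u).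
Proof.
move=> dc c0 Dc; have [da Da] := linM_derive1 cadj_lin dc.
have [db Db] := linM_derive1 (cmul_linr x) da.
have [d D] := cmul_derive1 dc db; split; first exact: d.
by rewrite D Db Da Dc c0 cadj_cone !cmul1 cmul1l cadj_mat cmulNr.
Qed.

Lemma near_derive (c c' : R -> M) : (\forall t \near (0 : R), c t = c' t) ->
  'D_1 c 0 = 'D_1 c' 0.
Proof. exact: (@near_eq_derive R R M c c' 0 1). Qed.

(* The differential at 1 of an automorphism of the Lie group. *)
Lemma equivalent_rauto j k J J' : represents j J -> represents k J' ->
  equivalent J J' -> exists phi, rauto phi /\ forall u, phi (j u) = k (phi u).
Proof.
move=> hj hk [f [[[f' [sf sf' fS fK f'K]] fM] fJ]].
have h1 : SL2 (cone : M) := SL2_1.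
have fS1 g : SL2 g -> SL2 (f g) by move=> /fS [].
have f1 : f cone = cone.
  have e := fM _ _ h1 h1; rewrite cmul1 in e.
  have e2 : cmul (cadj (f cone)) (f cone) = cmul (cadj (f cone)) (cmul (f cone) (f cone)) by rewrite -e.
  by rewrite cmulKV ?cadjVl in e2; [exact: esym e2 | exact: fS1..].
have fV g : SL2 g -> f (cadj g) = cadj (f g).
  move=> hg; have e := fM _ _ hg (SL2_cadj hg); rewrite cadjV // f1 in e.
  by rewrite -[LHS](cmulKV _ (fS1 _ hg)) -e cmul1.
have f'1 : f' cone = cone by rewrite -{1}f1 fK.
have [U [F [oU U1 cF Ff]]] := sf cone h1.
have [U' [F' [oU' U'1 cF' F'f]]] := sf' cone h1.
have dF : differentiable F cone by have [+ _] := cF 1%N; apply.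
have dF' : differentiable F' cone by have [+ _] := cF' 1%N; apply.
have F1 : F cone = cone by rewrite Ff.
pose L : M -> M := 'd F cone.
have Ll : linear L by move=> r x y; rewrite /L linearP.
have near_in (c : R -> M) (A : set M) : open A -> A cone -> c 0 = cone -> differentiable c 0 ->
    \forall t \near (0 : R), A (c t).
  move=> oA A1 c0 dc; have cc : {for 0, continuous c} by exact: differentiable_continuous.
  by apply: cc; apply: open_nbhs_nbhs; rewrite c0; split.
have near_f (c : R -> M) : c 0 = cone -> differentiable c 0 -> (\forall t \near (0 : R), SL2 (c t)) ->
    \forall t \near (0 : R), F (c t) = f (c t).
  move=> c0 dc cS; apply: filterS2 cS (near_in c U oU U1 c0 dc) => t St Ut.
  exact: Ff.
have Lsl u : sl2 (L (mat u)).
  have [c [dc c0 Dc cS]] := curve_exists u.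
  have [dFc DFc] := curve_chain c0 dc dF.
  have FS : \forall t \near (0 : R), SL2 (F (c t)).
    by apply: filterS2 cS (near_f c c0 dc cS) => t St ->; exact: fS1.
  have Fc0 : F (c 0) = cone by rewrite c0.
  have := curve_sl2 h1 Fc0 dFc FS.
  by rewrite DFc Dc cadj_cone cmul1l.
pose phi u := tri (L (mat u)).
have Lm u : L (mat u) = mat (phi u) by rewrite /phi triK.
(* Differentiating f (h c(t) h^-1) = f(h) f(c(t)) f(h)^-1 at t = 0 shows that [L] intertwines the
   adjoint actions. *)
have LAd h u : SL2 h -> L (cmul h (cmul (mat u) (cadj h))) =
    cmul (f h) (cmul (L (mat u)) (cadj (f h))).
  move=> hh; have [c [dc c0 Dc cS]] := curve_exists u.
  have [d1 D1] := linM_derive1 (cmul_linl (cadj h)) dc.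
  have [d2 D2] := linM_derive1 (cmul_linr h) d1.
  have c20 : cmul h (cmul (c 0) (cadj h)) = cone by rewrite c0 cmul1l cadjV.
  have [dFc DFc] := curve_chain c0 dc dF.
  have [dF2 DF2] := curve_chain c20 d2 dF.
  have [d3 D3] := linM_derive1 (cmul_linl (cadj (f h))) dFc.
  have [d4 D4] := linM_derive1 (cmul_linr (f h)) d3.
  have c2S : \forall t \near (0 : R), SL2 (cmul h (cmul (c t) (cadj h))).
    by apply: filterS cS => t St; do ?[apply: SL2_mul] => //; exact: SL2_cadj.
  have e : \forall t \near (0 : R), F (cmul h (cmul (c t) (cadj h))) =
      cmul (f h) (cmul (F (c t)) (cadj (f h))).
    apply: filterS3 cS (near_f c c0 dc cS) (near_f _ c20 d2 c2S) => t St -> ->.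
    have hh' := SL2_cadj hh.
    by rewrite !fM ?fV //; exact: SL2_mul.
  rewrite Dc in DFc; rewrite DFc in D3; rewrite D3 in D4.
  rewrite Dc in D1; rewrite D1 in D2; rewrite D2 in DF2.
  exact: etrans (esym DF2) (etrans (near_derive e) D4).
(* A second differentiation, now with h moving along a curve of velocity [u], turns the adjoint
   action into the bracket. *)
have Lbr u u' : L (mat (br u u')) = cmul (L (mat u)) (L (mat u')) - cmul (L (mat u')) (L (mat u)).
  have [c [dc c0 Dc cS]] := curve_exists u.
  have [d1 D1] := adjoint_derive (mat u') dc c0 Dc.
  have [d2 D2] := linM_derive1 Ll d1.
  have [dFc DFc] := curve_chain c0 dc dF.
  have Fc0 : F (c 0) = cone by rewrite c0.
  have DFc' : 'D_1 (fun t => F (c t)) 0 = mat (phi u) by rewrite DFc Dc -Lm.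
  have [d3 D3] := adjoint_derive (L (mat u')) dFc Fc0 DFc'.
  have e : \forall t \near (0 : R), L (cmul (c t) (cmul (mat u') (cadj (c t)))) =
      cmul (F (c t)) (cmul (L (mat u')) (cadj (F (c t)))).
    by apply: filterS2 cS (near_f c c0 dc cS) => t St ->; exact: LAd.
  rewrite D1 in D2; rewrite (Lm u) mat_br.
  exact: etrans (esym D2) (etrans (near_derive e) D3).
(* The extension F' of the inverse automorphism undoes F along curves in SL2, so its differential is
   a left inverse of [L] on sl2. *)
have Linj u : L (mat u) = 0 -> u = 0.
  move=> Lu; have [c [dc c0 Dc cS]] := curve_exists u.
  have [dFc DFc] := curve_chain c0 dc dF.
  have Fc0 : F (c 0) = cone by rewrite c0.
  have [dF'c DF'c] := curve_chain Fc0 dFc dF'.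
  have e : \forall t \near (0 : R), F' (F (c t)) = c t.
    apply: filterS3 cS (near_f c c0 dc cS) (near_in _ U' oU' U'1 Fc0 dFc) => t St Fc U'c.
    rewrite F'f //; last by rewrite Fc; exact: fS1.
    by rewrite Fc fK.
  rewrite Dc -/(L _) Lu in DFc; rewrite DFc linear0 in DF'c.
  have e0 := etrans (esym DF'c) (etrans (near_derive e) Dc).
  by apply: (@mat_inj R); rewrite -e0 mat0.
have phil : rlinear phi by move=> r u u'; rewrite /phi mat_lin Ll tri_lin.
have phi_inj : injective phi.
  move=> u u' e; apply/eqP; rewrite -subr_eq0; apply/eqP; apply: Linj.
  by rewrite Lm (rlinB phil) e subrr mat0.
exists phi; split.
  split=> //; last exact/rlinear_inj_surj.
  by move=> u u'; apply: (@mat_inj R); rewrite -Lm Lbr !Lm mat_br.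
move=> u; have := fJ cone (mat u) h1 (tangent_cone u).
have jE : J cone (mat u) = mat (j u).
  by have := represents_mul u hj h1; rewrite !cmul1l.
have dE u' : differential SL2 f cone (mat u') = L (mat u').
  rewrite (@differentialE R M M SL2 f F cone (mat u') U oU U1 dF Ff (tangent_cone u')).
  by rewrite deriveE.
rewrite jE !dE f1 !Lm.
have -> : J' cone (mat (phi u)) = mat (k (phi u)).
  by have := represents_mul (phi u) hk h1; rewrite !cmul1l.
by move=> /mat_inj.
Qed.

Lemma conj_sl2 g x : sl2 x -> sl2 (cmul (cadj g) (cmul x g)).
Proof.
have [a [b [c [d ->]]]] := mk_surj g; have [a' [b' [c' [d' ->]]]] := mk_surj x.
move=> /sl2_mk ->; rewrite cadj_mk !cmul_mk; apply/sl2_mk; ring.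
Qed.

(** Combined with left invariance, right translation by c(t) says that [j] commutes with Ad
    (c(t)^-1); the derivative at t = 0 is commutation with ad u. *)
Lemma right_invariant_cen j J H u : cxs j -> represents j J ->
  right_invariant_under H J -> (forall g, H g -> SL2 g) -> lie_algebra_of H (mat u) -> cen j u.
Proof.
move=> hj hJ hH HS [c [[cs cS cM] cH Dc]] y.
have jl := cxs_lin hj.
have c0 : c 0 = cone.
  have e := cM 0 0; rewrite addr0 in e.
  have e2 : cmul (cadj (c 0)) (c 0) = cmul (cadj (c 0)) (cmul (c 0) (c 0)) by rewrite -e.
  by rewrite cmulKV ?cadjVl in e2.
have dc : differentiable c 0 by have [+ _] := cs 1%N; apply.
have Dc' : 'D_1 c 0 = mat u by rewrite -derive1E.
have h1 : SL2 (cone : M) := SL2_1.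
have key t : jM j (cmul (cadj (c t)) (cmul (mat y) (c t))) =
    cmul (cadj (c t)) (cmul (mat (j y)) (c t)).
  have hct := cS t; have [_ /(_ cone (mat y) h1 (tangent_cone y))] := hH _ (cH t).
  have d1 := @linear_differential R _ cone (mat y) (cmul_linl (c t)) (tangent_cone y).
  have d2 := @linear_differential R _ cone (mat (j y)) (cmul_linl (c t)) (tangent_cone (j y)).
  have jE : J cone (mat y) = mat (j y).
    by have := represents_mul y hJ h1; rewrite !cmul1l.
  rewrite jE /right_translation d1 d2 cmul1l hJ //; last first.
    rewrite -[cmul (mat y) (c t)](cmulVK _ hct).
    have sl : sl2 (cmul (cadj (c t)) (cmul (mat y) (c t))).
      exact: conj_sl2 (mat_sl2 y).
    by rewrite -(triK sl); exact: tangent_mul.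
  by rewrite /Jof => e; rewrite -[LHS](cmulKV _ hct) e.
have [da Da] := linM_derive1 cadj_lin dc.
have Da' : 'D_1 (fun t => cadj (c t)) 0 = mat (- u) by rewrite Da Dc' cadj_mat matN.
have a0 : cadj (c 0) = cone by rewrite c0 cadj_cone.
have [d1 D1] := adjoint_derive (mat y) da a0 Da'.
have [d2 D2] := adjoint_derive (mat (j y)) da a0 Da'.
have [d3 D3] := linM_derive1 (jM_lin jl) d1.
(* Writing c(t) as the inverse of its inverse lets [adjoint_derive] apply to the inverse curve, of
   velocity -u. *)
have e : \forall t \near (0 : R),
    jM j (cmul (cadj (c t)) (cmul (mat y) (cadj (cadj (c t))))) =
    cmul (cadj (c t)) (cmul (mat (j y)) (cadj (cadj (c t)))).
  by near=> t; rewrite cadjK key.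
rewrite D1 in D3.
have E : mat (j (br (- u) y)) = mat (br (- u) (j y)) :> M.
  rewrite -jM_mat !mat_br; exact: etrans (esym D3) (etrans (near_derive e) D2).
by move: (mat_inj E); rewrite !brNl (rlinN jl) => /oppr_inj.
Unshelve. all: by end_near. Qed.

Lemma idempotent_cone g : SL2 g -> g = cmul g g -> g = cone.
Proof. by move=> hg e; rewrite -[LHS](cmulKV _ hg) -e cadjVl. Qed.

Lemma unipotent_one_parameter u : trform u u = 0 -> one_parameter_subgroup (unipotent_curve u).
Proof.
move=> ku; split.
- exact: unipotent_curve_smooth.
- by move=> t; exact: unipotent_SL2.
- move=> s t; rewrite /unipotent_curve.
  have N2 : cmul (mat u) (mat u) = 0.
    move: ku; case: u => [[a b] c]; rewrite trformE /mat cmul_mk mk0 => e; cbn [fst snd] in *.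
    have {}e : a * a + b * c = 0.
      by apply: (mulfI (@two_neq0 R)); rewrite mulr0 -e; ring.
    by congr mk; first [by ring | by rewrite -e; ring].
  have -> : cmul (cone + s *: mat u) (cone + t *: mat u) =
      cone + (s + t) *: mat u + (s * t) *: cmul (mat u) (mat u).
    by have [a [b [c [d ->]]]] := mk_surj (mat u : M); rewrite !mkE; congr mk; rewrite ?realcM ?realcD; ring.
  by rewrite N2 scaler0 addr0.
Qed.

Lemma SL2_lie_algebra_nilpotent u : trform u u = 0 -> lie_algebra_of (@SL2 R) (mat u).
Proof.
move=> ku; exists (unipotent_curve u); split.
- exact: unipotent_one_parameter.
- by move=> t; exact: unipotent_SL2.
- by rewrite derive1E; have [_ ->] := unipotent_curve_derive u.
Qed.

Lemma cenD j u u' : rlinear j -> cen j u -> cen j u' -> cen j (u + u').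
Proof. by move=> jl h h' y; rewrite !brDl (rlinD jl) h h'. Qed.

(** Nilpotent elements generate polynomial one-parameter subgroups, and every element is a sum of
    three of them; linearity of [j] does the rest. *)
Lemma bi_invariant_cen j J u : cxs j -> represents j J -> bi_invariant J -> cen j u.
Proof.
move=> hj hJ [_ hR]; have jl := cxs_lin hj.
have nil u' : trform u' u' = 0 -> cen j u'.
  move=> ku; apply: (right_invariant_cen hj hJ hR) => //.
  exact: SL2_lie_algebra_nilpotent.
case: u => [[a b] c].
have -> : (a, b, c) = (a, a, - a) + (0, b - a, 0) + (0, 0, c + a) :> vec.
  by rewrite !addE; cbn [fst snd]; congr (_, _, _); ring.
by do ?[apply: cenD => //]; apply: nil; rewrite trformE; ring.
Qed.

(** Since g u a = (g a) (a^-1 u a), right translation by [a] reads Ad (a^-1) in the left frame. *)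
Lemma right_translation_biholomorphism j J a : represents j J -> SL2 a ->
  (forall u, jM j (cmul (cadj a) (cmul (mat u) a)) = cmul (cadj a) (cmul (mat (j u)) a)) ->
  biholomorphism J (right_translation a).
Proof.
move=> hJ ha hja; split; first exact: right_translation_diffeo.
move=> g v hg /(tangent_repr hg)[u ->].
have d1 := @linear_differential R _ g _ (cmul_linl a) (tangent_mul u hg).
have d2 := @linear_differential R _ g _ (cmul_linl a) (tangent_mul (j u) hg).
have e : J g (cmul g (mat u)) = cmul g (mat (j u)) by exact: represents_mul.
rewrite e /right_translation d1 d2.
have sl : sl2 (cmul (cadj a) (cmul (mat u) a)) by exact: conj_sl2 (mat_sl2 u).
have hga : SL2 (cmul g a) by exact: SL2_mul.
have -> : cmul (cmul g (mat u)) a = cmul (cmul g a) (mat (tri (cmul (cadj a) (cmul (mat u) a)))).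
  by rewrite (triK sl) -[RHS]cmulA (cmulVK _ ha) cmulA.
rewrite (represents_mul _ hJ hga) -/(jM j _) hja.
by rewrite -!cmulA (cmulVK _ ha).
Qed.

Lemma Jbi_bi_invariant : bi_invariant (Jof (@jbi R)).
Proof.
split; first exact: Jof_left_invariant.
move=> a ha; apply: (right_translation_biholomorphism (@represents_Jof R _) ha) => u.
(* On traceless matrices [jbi] is multiplication by the scalar matrix i, which is central. *)
have jE x : sl2 x -> jM (@jbi R) x = cmul (mk (ii R) 0 0 (ii R)) x.
  have [p [q [r [s ->]]]] := mk_surj x; move=> /sl2_mk ->.
  rewrite /jM tri_mk /jbi scE /mat; cbn [fst snd]; rewrite cmul_mk.
  by congr mk; field.
have central x y : cmul x (cmul (mk (ii R) 0 0 (ii R)) y) = cmul (mk (ii R) 0 0 (ii R)) (cmul x y).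
  by have [p [q [r [s ->]]]] := mk_surj x; have [p' [q' [r' [s' ->]]]] := mk_surj y;
    rewrite !cmul_mk; congr mk; ring.
rewrite (jE _ (conj_sl2 a (mat_sl2 u))) -jM_mat (jE _ (mat_sl2 u)).
by rewrite -[cmul (cmul (mk _ _ _ _) _) _]cmulA central.
Qed.

(** Right invariance puts the Lie algebra of the subgroup in a zero centraliser; but the zero
    subalgebra is normalised by E and so is not self-normalising. *)
Lemma not_regular_Jnon : ~ regular (Jof (@jnon R)).
Proof.
move=> [H [[[[HS _ _ _] _ _] [hsl _ [_ [[hs0 _ _] _] _ norm]]] hR]].
have X0 X : lie_algebra_of H X -> X = 0.
  move=> hX; have sX : sl2 X := hsl _ hX; rewrite -(triK sX) in hX *.
  have := right_invariant_cen (@cxs_jnon R) (@represents_Jof R _) hR HS hX.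
  by move=> /cen_jnon ->; exact: mat0.
have E0 : lie_algebra_of H (mat (@basis_E R)).
  have gE : complexified_set sl2 ((mat (@basis_E R), 0) : complexified M).
    by split; [exact: mat_sl2 | rewrite /= -mat0; exact: mat_sl2].
  have [] // := norm _ gE.
  move=> [y1 y2] [/= h1 h2]; rewrite (X0 _ h1) (X0 _ h2) /complexified_bracket /=.
  have c0 x : commutator x 0 = 0 :> M by rewrite /commutator; mkring.
  by rewrite !c0 subrr addr0; exact: hs0.
by apply: (@basisE_neq0 R); apply: (@mat_inj R); rewrite (X0 _ E0) mat0.
Qed.

End Invariants.

(** * The complex exponential and curves in the diagonal torus *)

Section ComplexExponential.
Context {R : realType}.
Local Notation C := R[i].
Local Notation M := (M2C R).

Definition expc (w : C) : C :=
  Complex (expR (complex.Re w) * cos (complex.Im w)) (expR (complex.Re w) * sin (complex.Im w)).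

Lemma expcD (w w' : C) : expc (w + w') = expc w * expc w'.
Proof.
case: w w' => [x y] [x' y']; rewrite /expc /= expRD cosD sinD -[RHS]/(Complex _ _).
by congr Complex; ring.
Qed.
Lemma expc0 : expc 0 = 1.
Proof. by rewrite /expc /= expR0 cos0 sin0 mulr1 mulr0. Qed.
Lemma expcN (w : C) : expc w * expc (- w) = 1.
Proof. by rewrite -expcD subrr expc0. Qed.
Lemma expc_neq0 (w : C) : expc w != 0.
Proof. by apply/negP => /eqP e; have := expcN w; rewrite e mul0r => /eqP; rewrite eq_sym oner_eq0. Qed.
Lemma expcV (w : C) : (expc w)^-1 = expc (- w).
Proof. by apply: (mulfI (expc_neq0 w)); rewrite expcN mulfV // expc_neq0. Qed.

Lemma unit_circle_angle (x y : R) : x ^+ 2 + y ^+ 2 = 1 -> exists t, x = cos t /\ y = sin t.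
Proof.
move=> e; have x1 : -1 <= x <= 1.
  have : x ^+ 2 <= 1 by rewrite -e lerDl sqr_ge0.
  by move=> h; apply/andP; split; nra.
have y2 : y ^+ 2 = 1 - x ^+ 2 by rewrite -e addrC addKr.
have s := sin_acos x1.
have [y0|y0] := leP 0 y.
  exists (acos x); rewrite acosK // s -y2 sqrtr_sqr ger0_norm //.
exists (- acos x); rewrite cosN sinN acosK // s -y2 sqrtr_sqr ltr0_norm // opprK //.
Qed.

(** Polar coordinates: the logarithm of the modulus together with an angle of the normalised
    number. *)
Lemma expc_surj (l : C) : l != 0 -> exists w, expc w = l.
Proof.
case: l => [x y] l0; pose n := Num.sqrt (x ^+ 2 + y ^+ 2).
have xy : 0 < x ^+ 2 + y ^+ 2.
  rewrite lt_neqAle addr_ge0 ?sqr_ge0 // andbT eq_sym paddr_eq0 ?sqr_ge0 // !sqrf_eq0.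
  by move: l0; rewrite eq_complex.
have n0 : 0 < n by rewrite sqrtr_gt0.
have n2 : n ^+ 2 = x ^+ 2 + y ^+ 2 by rewrite sqr_sqrtr // ltW.
have n00 : n != 0 by rewrite gt_eqF.
have [|t [xt yt]] := @unit_circle_angle (x / n) (y / n).
  have -> : (x / n) ^+ 2 + (y / n) ^+ 2 = (x ^+ 2 + y ^+ 2) / n ^+ 2 by field.
  by rewrite -n2 divff // expf_neq0.
exists (Complex (ln n) t); rewrite /expc /= lnK // -xt -yt.
by congr Complex; field.
Qed.

(* The shape is closed under differentiation in t, which gives smoothness by induction. *)
Definition damped (x y A B t : R) : R := expR (x * t) * (A * cos (y * t) + B * sin (y * t)).

Lemma damped_derive (x y A B t v : R) : differentiable (damped x y A B) t /\
  'D_v (damped x y A B) t = v * damped x y (x * A + y * B) (x * B - y * A) t.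
Proof.
have d : is_derive t 1 (damped x y A B) (damped x y (x * A + y * B) (x * B - y * A) t).
  apply: is_derive_eq.
  rewrite /damped /GRing.scale /=; ring.
have [dd DD] := d.
have df : differentiable (damped x y A B) t by apply/derivable1_diffP.
split=> //; rewrite deriveE // -[v in LHS]mulr1 -[v * 1]/(v *: 1) linearZ /= -deriveE //.
by rewrite DD.
Qed.

Lemma damped_smooth k (x y A B : R) : Ck k setT (damped x y A B).
Proof.
elim: k A B => [|k IH] A B /=.
  move=> t _; apply: differentiable_continuous; exact: (damped_derive x y A B t 0).1.
split=> [t _|v]; first exact: (damped_derive x y A B t 0).1.
have -> : (fun t => 'D_v (damped x y A B) t) =
    damped x y (v * (x * A + y * B)) (v * (x * B - y * A)).
  apply/funext => t; rewrite (damped_derive x y A B t v).2 /damped; ring.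
exact: IH.
Qed.

Definition torus_curve (w : C) (t : R) : M := mk (expc (t%:C%C * w)) 0 0 (expc (- (t%:C%C * w))).

Let scale_linear (m : M) : linear (fun t : R => t *: m).
Proof. by move=> r s t; rewrite scalerDl scalerA. Qed.
Let scale (m : M) : {linear R -> M} := HB.pack (fun t : R => t *: m)
  (GRing.isLinear.Build _ _ _ _ (fun t : R => t *: m) (scale_linear m)).
Let scale_continuous (m : M) : continuous (scale m).
Proof. by move=> t; exact: scalel_continuous. Qed.

Lemma Ck_scale (V : normedModType R) k (U : set V) (f : V -> R) (m : M) :
  open U -> Ck k U f -> Ck k U (fun t => f t *: m).
Proof. by move=> oU hf; exact: (@Ck_lin R V R M k U (scale m) f oU (@scale_continuous m) hf). Qed.

Lemma scale_derive (f : R -> R) (m : M) t : differentiable f t ->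
  differentiable (fun s => f s *: m) t /\ 'D_1 (fun s => f s *: m) t = 'D_1 f t *: m.
Proof. by move=> df; exact: (@lin_comp_derive R R R M (scale m) f t 1 (@scale_continuous m) df). Qed.

(** Separates real damped oscillations from constant matrices, reducing smoothness and the velocity
    to real functions of t. *)
Lemma torus_curveE (x y : R) : torus_curve (Complex x y) = (fun t =>
    (damped x y 1 0 t *: mk 1 0 0 0 + damped x y 0 1 t *: mk (ii R) 0 0 0) +
    (damped (- x) y 1 0 t *: mk 0 0 0 1 + damped (- x) y 0 (-1) t *: mk 0 0 0 (ii R))).
Proof.
apply/funext => t; rewrite /torus_curve !mkE /expc /damped.
have e1 : (t%:C%C * Complex x y : C) = Complex (x * t) (y * t).
  by rewrite -[LHS]/(Complex _ _); congr Complex; ring.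
rewrite e1 /= cosN sinN !mulNr.
congr mk; rewrite ?mulr0 ?addr0 //.
  by rewrite -[RHS]/(Complex _ _); congr Complex; ring.
by rewrite ?add0r -[RHS]/(Complex _ _); congr Complex; ring.
Qed.

Lemma torus_curve_smooth w : Cinfty setT (torus_curve w).
Proof.
move=> k; case: w => [x y]; rewrite torus_curveE.
by do ?[apply: (Ck_add openT)]; apply: (Ck_scale _ openT); exact: damped_smooth.
Qed.

Lemma torus_curve_derive w : 'D_1 (torus_curve w) 0 = mk w 0 0 (- w).
Proof.
case: w => [x y]; rewrite torus_curveE.
have [d1 D1] := damped_derive x y 1 0 0 1; have [d2 D2] := damped_derive x y 0 1 0 1.
have [d3 D3] := damped_derive (- x) y 1 0 0 1; have [d4 D4] := damped_derive (- x) y 0 (-1) 0 1.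
have [e1 E1] := scale_derive (mk 1 0 0 0) d1; have [e2 E2] := scale_derive (mk (ii R) 0 0 0) d2.
have [e3 E3] := scale_derive (mk 0 0 0 1) d3; have [e4 E4] := scale_derive (mk 0 0 0 (ii R)) d4.
have e12 := differentiableD e1 e2; have e34 := differentiableD e3 e4.
have D12 := @deriveD R R M _ _ 0 1 (diff_derivable e1) (diff_derivable e2).
have D34 := @deriveD R R M _ _ 0 1 (diff_derivable e3) (diff_derivable e4).
have D := @deriveD R R M _ _ 0 1 (diff_derivable e12) (diff_derivable e34).
apply: etrans D _; rewrite D12 D34 E1 E2 E3 E4 D1 D2 D3 D4 /damped.
rewrite !mulr0 expR0 cos0 sin0 !mkE.
have e (p q r s : R) : p = r -> q = s -> Complex p q = Complex r s by move=> -> ->.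
by congr mk; rewrite ?mulr0 ?addr0 ?add0r ?oppr0 //;
  rewrite -[LHS]/(Complex _ _) -?[RHS]/(Complex _ _); apply: e; ring.
Qed.

Lemma torus_curve_mul w s t : torus_curve w (s + t) = cmul (torus_curve w s) (torus_curve w t).
Proof.
rewrite /torus_curve cmul_mk -!expcD realcD mulrDl opprD.
by congr mk; ring.
Qed.

Lemma torus_curve_SL2 w t : SL2 (torus_curve w t).
Proof. by apply/SL2_mk; rewrite expcN mulr0 subr0. Qed.

End ComplexExponential.

(** * Cartan subgroups conjugate to the diagonal torus *)

Section Torus.
Context {R : realType}.
Local Notation C := R[i].
Local Notation M := (M2C R).
Local Notation vec := (vec R).
Implicit Types (x y z g h v w : M) (j k : vec -> vec) (u : vec).

Variables (f f' : M -> M) (phi : vec -> vec).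
Hypotheses (hf : linauto f f' phi) (hphi : rauto phi).

(** The preimage of the diagonal torus under [f], so that a structure similar to a model inherits
    regularity from it. *)
Definition torus : set M := [set g | SL2 g /\ exists2 l : C, l != 0 & f g = mk l 0 0 l^-1].

Let h1 : SL2 (cone : M) := SL2_1.

Lemma la_cone : f cone = cone.
Proof.
apply: idempotent_cone; first exact: la_SL2 hf _ h1.
by rewrite -(la_mul hf) cmul1.
Qed.

Lemma la_cadj g : SL2 g -> f (cadj g) = cadj (f g).
Proof.
move=> hg; have hfg := la_SL2 hf hg.
by rewrite -[LHS](cmulKV _ hfg) -(la_mul hf) cadjV // la_cone cmul1.
Qed.

Lemma torus_subgroup : Defs.subgroup torus.
Proof.
split.
- by move=> g [].
- by split=> //; exists 1; rewrite ?oner_neq0 // la_cone cone_mk invr1.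
- move=> g h [hg [l l0 fg]] [hh [l' l'0 fh]]; split; first exact: SL2_mul.
  exists (l * l'); first exact: mulf_neq0.
  by rewrite (la_mul hf) fg fh cmul_mk invfM; congr mk; ring.
- move=> g [hg [l l0 fg]]; exists (cadj g); last exact: cadjV.
  split; first exact: SL2_cadj.
  exists l^-1; first by rewrite invr_eq0.
  by rewrite la_cadj // fg cadj_mk oppr0 invrK.
Qed.

Lemma torus_one_parameter (w : C) : one_parameter_subgroup (fun t => f' (torus_curve w t)) /\
  (forall t, torus (f' (torus_curve w t))) /\
  derive1 (fun t => f' (torus_curve w t)) 0 = f' (mk w 0 0 (- w)).
Proof.
have S t : SL2 (f' (torus_curve w t)) by apply: la_SL2' hf _ _; exact: torus_curve_SL2.
split; [split | split].
- by move=> k; apply: (Ck_linM openT (la_lin' hf)); exact: torus_curve_smooth.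
- exact: S.
- move=> s t; apply: (can_inj (la_K hf)).
  by rewrite (la_mul hf) !(la_K' hf) torus_curve_mul.
- move=> t; split; first exact: S.
  exists (expc (t%:C%C * w)); first exact: expc_neq0.
  by rewrite (la_K' hf) /torus_curve expcV.
- have [d _] := torus_curve_smooth w 1; have d0 := d 0 I.
  have [_ D] := linM_derive1 (la_lin' hf) d0.
  by rewrite derive1E D torus_curve_derive.
Qed.

(** This keeps the off-diagonal entries: a linear map vanishing exactly on diagonal matrices, hence
    also on velocities of diagonal curves. *)
Definition diag_part (x : M) : M := mk 0 (to_cmx x 0 1) (to_cmx x 1 0) 0.
Lemma diag_part_mk a b c d : diag_part (mk a b c d) = mk 0 b c 0 :> M.
Proof. by rewrite /diag_part of_cmxK !mxE. Qed.
Lemma diag_part_lin : linear diag_part.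
Proof. by move=> r x y; mkcases; rewrite !(mkE, diag_part_mk); congr mk; ring. Qed.

Lemma torus_lie_algebra X : lie_algebra_of torus X <->
  exists u a, X = mat u /\ phi u = (a, 0, 0).
Proof.
split=> [[c [[cs cS cM] cH Dc]] | [u [a [-> ua]]]].
  have c0 : c 0 = cone by apply: idempotent_cone => //; rewrite -cM addr0.
  have dc : differentiable c 0 by have [+ _] := cs 1%N; apply.
  have nS : \forall t \near (0 : R), SL2 (c t) by near=> t; exact: cS.
  have := curve_sl2 h1 c0 dc nS; rewrite cadj_cone cmul1l -derive1E Dc => sX.
  have [df Df] := linM_derive1 (la_lin hf) dc.
  have [dd Dd] := linM_derive1 diag_part_lin df.
  have e : \forall t \near (0 : R), diag_part (f (c t)) = cst (0 : M) t.
    near=> t; have [_ [l _ ->]] := cH t.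
    by rewrite diag_part_mk mk0.
  have Dc' : 'D_1 c 0 = X by rewrite -derive1E.
  rewrite Df Dc' in Dd.
  have H := etrans (esym Dd) (etrans (near_derive e) (derive_cst _ _ _)).
  exists (tri X), (phi (tri X)).1.1; split; first by rewrite triK.
  move: H; rewrite -(triK sX) (la_mat hf) /mat diag_part_mk mk0 => /mk_inj[_ b0 c0' _].
  by move: b0 c0'; rewrite matK; case: (phi _) => [[p q] r] /= -> ->.
have [op [cT Dc]] := torus_one_parameter a.
exists (fun t => f' (torus_curve a t)); split=> //.
rewrite Dc; apply: (can_inj (la_K hf)).
by rewrite (la_K' hf) (la_mat hf) ua.
Unshelve. all: by end_near. Qed.

Lemma torus_lie_coord X : lie_algebra_of torus X -> exists u a, X = mat u /\ phi u = (a, 0, 0).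
Proof. by move/torus_lie_algebra. Qed.

Lemma torus_lie_mat u a : phi u = (a, 0, 0) -> lie_algebra_of torus (mat u).
Proof. by move=> ua; apply/torus_lie_algebra; exists u, a. Qed.

Let pl : rlinear phi. Proof. by case: hphi. Qed.
Let pb u u' : phi (br u u') = br (phi u) (phi u'). Proof. by case: hphi. Qed.

Lemma torus_subspace : Defs.subspace (lie_algebra_of torus).
Proof.
split.
- by have := torus_lie_mat (rlin0 pl); rewrite mat0.
- move=> x y /torus_lie_coord[u [a [-> ua]]] /torus_lie_coord[u' [a' [-> ua']]].
  have e : phi (u + u') = (a + a', 0, 0) by rewrite (rlinD pl) ua ua' addE !addr0.
  by have := torus_lie_mat e; rewrite matD.
- move=> r x /torus_lie_coord[u [a [-> ua]]].
  have e : phi (r%:C%C *: u) = (r%:C%C * a, 0, 0) by rewrite (rlinZ pl) ua scE !mulr0.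
  have := torus_lie_mat e; suff -> : mat (r%:C%C *: u) = r *: mat u by [].
  by have := mat_lin r u 0; rewrite mat0 !addr0.
Qed.

Lemma torus_connected : connected_lie_subgroup torus.
Proof.
split; [exact: torus_subgroup | exact: torus_subspace |].
(* Surjectivity of the complex exponential makes each element of the torus a single exponential. *)
move=> h [hh [l l0 fh]]; have [w wl] := expc_surj l0.
have [op [cT Dc]] := torus_one_parameter w.
have hE : h = f' (torus_curve w 1).
  by apply: (can_inj (la_K hf)); rewrite (la_K' hf) fh /torus_curve realc1 mul1r -expcV wl.
exists [:: h]; split; first by rewrite /= cmul1.
move=> x; rewrite inE => /eqP ->; exists (fun t => f' (torus_curve w t)); split=> //.
Qed.

Lemma torus_commutator x y : lie_algebra_of torus x -> lie_algebra_of torus y ->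
  commutator x y = 0.
Proof.
move=> /torus_lie_coord[u [a [-> ua]]] /torus_lie_coord[u' [a' [-> ua']]].
rewrite -mat_br; have [_ _ pi _] := hphi.
have -> : br u u' = 0; last exact: mat0.
apply: pi; rewrite pb ua ua' brE (rlin0 pl).
by rewrite !(mulr0, mul0r, subrr).
Qed.

Lemma commutator0r x : commutator x 0 = 0 :> M.
Proof. by rewrite /commutator; mkring. Qed.

Lemma torus_cartan : cartan_subgroup torus.
Proof.
split; first exact: torus_connected.
have hsub := torus_subspace; have [hs0 hsD hsZ] := hsub.
have hsl : lie_algebra_of torus `<=` sl2.
  by move=> x /torus_lie_coord[u [a [-> _]]]; exact: mat_sl2.
have br0 (x y : complexified M) : complexified_set (lie_algebra_of torus) x ->
    complexified_set (lie_algebra_of torus) y -> complexified_bracket (@commutator R) x y = 0.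
  move=> [hx1 hx2] [hy1 hy2]; rewrite /complexified_bracket.
  by rewrite !torus_commutator // subrr addr0.
have hc : Defs.subspace (complexified_set (lie_algebra_of torus)).
  split.
  - by split.
  - by move=> x y [hx1 hx2] [hy1 hy2]; split; apply: hsD.
  - move=> a x [hx1 hx2]; split=> /=; last by apply: hsD; apply: hsZ.
    by apply: hsD; [apply: hsZ | rewrite -scaleNr; apply: hsZ].
split=> //.
  by split=> // x y hx hy; rewrite torus_commutator.
split.
- by move=> x [hx1 hx2]; split; apply: hsl.
- split=> // x y hx hy; rewrite br0 //; exact: (let: And3 h _ _ := hc in h).
(* The first term after [h] in the lower central series is spanned by brackets, all zero here. *)
- exists 1%N => z /= hz; apply: (hz [set 0]).
    split=> //= [x y -> ->|a x ->]; [by rewrite addr0 | by rewrite scaler0].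
  by move=> w [x [y [hx hy ->]]]; rewrite br0.
- move=> [x1 x2] [sx1 sx2] norm.
  (* Bracketing with the preimage of H alone suffices: [x, H] lies in C H only if the E- and
     F-coordinates of x vanish. *)
  have [_ _ _ ps] := hphi; have [u0 u0E] := ps (@basis_H R).
  have H0 : lie_algebra_of torus (mat u0) by exact: torus_lie_mat (esym u0E).
  have [] := norm (mat u0, 0) (conj H0 hs0).
  rewrite /complexified_bracket /= !commutator0r subr0 add0r => n1 n2.
  have key x : sl2 x -> lie_algebra_of torus (commutator x (mat u0)) -> lie_algebra_of torus x.
    move=> sx; rewrite -(triK sx) -mat_br => /torus_lie_coord[u [a [/mat_inj <-]]].
    rewrite pb -u0E => e; apply: (@torus_lie_mat _ (phi (tri x)).1.1).
    move: e; case: (phi _) => [[p q] r] /=; rewrite /basis_H brE => -[_ e2 e3].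
    have q0 : q = 0 by apply: (mulfI (@two_neq0 R)); rewrite mulr0 -[RHS]oppr0 -e2; ring.
    have r0 : r = 0 by apply: (mulfI (@two_neq0 R)); rewrite mulr0 -e3; ring.
    by rewrite q0 r0.
  by split; [exact: key sx1 n1 | exact: key sx2 n2].
Qed.

(** Under [f], conjugation by an element of [torus] becomes some [adD], with which the model [k]
    commutes. *)
Lemma torus_regular j k J : represents j J -> (forall u, phi (j u) = k (phi u)) ->
  (forall l u, l != 0 -> k (adD l u) = adD l (k u)) -> regular J.
Proof.
move=> hJ jk hk; exists torus; split; first exact: torus_cartan.
move=> a [ha [l l0 fa]]; apply: (right_translation_biholomorphism hJ ha) => u.
have conjE' u' : cmul (cadj a) (cmul (mat u') a) = f' (mat (adD l^-1 (phi u'))).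
  apply: (can_inj (la_K hf)); rewrite (la_K' hf) (la_mul hf (cadj a)) (la_mul hf (mat u')) (la_cadj ha) (la_mat hf u') fa.
  case: (phi u') => [[p q] r]; rewrite /mat /adD cadj_mk !cmul_mk; cbn [fst snd].
  by congr mk; field.
have [_ _ pi ps] := hphi; have [u' u'E] := ps (adD l^-1 (phi u)).
have f'm u2 : f' (mat (phi u2)) = mat u2 by rewrite -(la_mat hf) (la_K hf).
rewrite !conjE' u'E f'm jM_mat -f'm; congr f'; congr mat.
by rewrite !jk -u'E hk // invr_eq0.
Qed.

End Torus.

(** * Smooth dependence on the parameter, and regularity along similarities *)

Section Family.
Context {R : realType}.
Local Notation C := R[i].
Local Notation M := (M2C R).
Local Notation vec := (vec R).

Let fstR : {linear (R * R)%type -> R} :=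
  HB.pack (fun z : R * R => z.1) (GRing.isLinear.Build _ _ _ _ (fun z : R * R => z.1) (fun _ _ _ => erefl)).
Let sndR : {linear (R * R)%type -> R} :=
  HB.pack (fun z : R * R => z.2) (GRing.isLinear.Build _ _ _ _ (fun z : R * R => z.2) (fun _ _ _ => erefl)).

Section Scalar.
Variables (k : nat) (U : set (R * R)).
Hypothesis oU : open U.

Lemma Ck_fst : Ck k U (fun z : R * R => z.1).
Proof.
have c : continuous fstR by move=> z; exact: cvg_fst.
exact: (@Ck_lin R (R * R)%type (R * R)%type R k U fstR id oU c (Ck_id k U)).
Qed.
Lemma Ck_snd : Ck k U (fun z : R * R => z.2).
Proof.
have c : continuous sndR by move=> z; exact: cvg_snd.
exact: (@Ck_lin R (R * R)%type (R * R)%type R k U sndR id oU c (Ck_id k U)).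
Qed.
Lemma Ck_mul (f g : R * R -> R) : Ck k U f -> Ck k U g -> Ck k U (fun z => f z * g z).
Proof.
have cm : continuous (fun p : R * R => p.1 * p.2) by move=> p; apply: mul_continuous.
by move=> hf hg; exact: (@Ck_bilin R (R * R)%type R R R k U (@GRing.mul R) f g oU cm hf hg).
Qed.
Lemma Ck_sqn : Ck k U (@sqn R).
Proof.
have -> : @sqn R = (fun z => z.1 * z.1 + z.2 * z.2) by apply/funext => z; rewrite /sqn !expr2.
apply: (Ck_add oU); apply: Ck_mul; by [exact: Ck_fst | exact: Ck_snd].
Qed.
End Scalar.

Lemma open_unit_disk : open (unit_disk R).
Proof.
have c : continuous (@sqn R) by move=> z; exact: (Ck_cont (@Ck_sqn 0 setT openT)).
have /continuousP/(_ _ (@open_lt R 1)) := c.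
by [].
Qed.

(** At a fixed tangent vector the value is a combination of constant matrices with coefficients
    rational in the parameter; their only denominator, 1 - |z|^2, is nonzero on the disk. *)
Lemma Jreg_smooth_family : smooth_family (unit_disk R) (fun z => Jof (jreg z)).
Proof.
move=> g v _ _ p hp; exists (unit_disk R), (fun z => Jof (jreg z) g v).
split; [exact: open_unit_disk | exact: hp | | by []].
move=> k; have oU := open_unit_disk.
apply: (Ck_linM oU (cmul_linr g)); rewrite /jM.
case: (tri _) => [[a b] c].
pose d (z : R * R) : R := (1 - sqn z)^-1.
have hd : Ck k (unit_disk R) d.
  apply: (Ck_inv oU) => [z zU|]; first by rewrite gt_eqF // subr_gt0.
  have h : Ck k (unit_disk R) (fun z => 1 + (-1) * sqn z).
    apply: (Ck_add oU); first exact: Ck_cst.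
    by apply: (Ck_mul oU); [exact: Ck_cst | exact: Ck_sqn].
  by apply: (Ck_eq oU _ h) => z _; rewrite mulN1r.
have -> : (fun z => mat (jreg z (a, b, c))) = (fun z =>
    (((1 + sqn z) * d z) *: mat (ii R * a, 0, 0) + ((2 * z.1) * d z) *: mat (a^*%C, 0, 0)) +
    (((2 * z.2) * d z) *: mat (ii R * a^*%C, 0, 0) + mat (0, ii R * b, - ii R * c)) : M).
  apply/funext => z; rewrite /mat /jreg /jst !mkE -/(d z); cbn [fst snd].
  have e (x y : R) : Complex x y = x%:C%C + ii R * y%:C%C :> C by exact: complexE.
  by rewrite e; congr mk; ring.
do ?[apply: (Ck_add oU)]; last exact: Ck_cst.
- apply: (Ck_scale _ oU); apply: (Ck_mul oU) => //.
  by apply: (Ck_add oU); [exact: Ck_cst | exact: Ck_sqn].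
- apply: (Ck_scale _ oU); apply: (Ck_mul oU) => //.
  by apply: (Ck_mul oU); [exact: Ck_cst | exact: Ck_fst].
- apply: (Ck_scale _ oU); apply: (Ck_mul oU) => //.
  by apply: (Ck_mul oU); [exact: Ck_cst | exact: Ck_snd].
Qed.

Lemma sim_regular (j k : vec -> vec) (J : endo_field R) : represents j J -> sim j k ->
  (forall l u, l != 0 -> k (adD l u) = adD l (k u)) -> regular J.
Proof.
move=> hJ [phi [gphi jk]] hk; have [f [f' hf]] := gen_linauto gphi.
exact: torus_regular hf (gen_rauto gphi) _ _ _ hJ jk hk.
Qed.

Lemma sim_refl (j : vec -> vec) : sim j j.
Proof. by exists idfun; split=> //; exact: gen_id. Qed.

Lemma jbi_adD l (u : vec) : l != 0 -> jbi (adD l u) = adD l (jbi u).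
Proof.
by case: u => [[a b] c] _; rewrite /jbi /adD !scE; cbn [fst snd]; rewrite ?scCE; congr (_, _, _); ring.
Qed.

Lemma jreg_adD z l (u : vec) : l != 0 -> jreg z (adD l u) = adD l (jreg z u).
Proof.
by case: u => [[a b] c] _; rewrite /jreg /jst /adD; cbn [fst snd]; congr (_, _, _); ring.
Qed.

End Family.

Theorem theorem1p1 (R : realType) :
  exists (Jbi : endo_field R) (Jreg : (R * R)%type -> endo_field R)
         (Jnon : endo_field R),
    (left_invariant_complex_structure Jbi /\ bi_invariant Jbi) /\
    (forall z, unit_disk R z ->
       left_invariant_complex_structure (Jreg z) /\
       regular (Jreg z) /\ ~ bi_invariant (Jreg z)) /\
    smooth_family (unit_disk R) Jreg /\
    (left_invariant_complex_structure Jnon /\ ~ regular Jnon) /\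
    (* every left-invariant complex structure is in the list *)
    (forall J, left_invariant_complex_structure J ->
       equivalent J Jbi \/
       (exists2 z, unit_disk R z & equivalent J (Jreg z)) \/
       equivalent J Jnon) /\
    (* the list has no repetition *)
    (forall z w, unit_disk R z -> unit_disk R w ->
       equivalent (Jreg z) (Jreg w) -> z = w) /\
    (forall z, unit_disk R z ->
       ~ equivalent Jbi (Jreg z) /\ ~ equivalent Jnon (Jreg z)) /\
    ~ equivalent Jbi Jnon /\
    (* uniqueness of the bi-invariant and of the non-regular structure *)
    (forall J, left_invariant_complex_structure J -> bi_invariant J ->
       equivalent J Jbi) /\
    (forall J, left_invariant_complex_structure J -> ~ regular J ->
       equivalent J Jnon).
Proof.
exists (Jof (@jbi R)), (fun z => Jof (jreg z)), (Jof (@jnon R)).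
have Jbi_complex := Jof_complex (@cxs_jbi R).
have Jreg_complex z (hz : unit_disk R z) := Jof_complex (cxs_jreg hz).
have Jbi_rep := @represents_Jof R (@jbi R).
have Jreg_rep z := @represents_Jof R (jreg z).
have Jnon_rep := @represents_Jof R (@jnon R).
have classify J : left_invariant_complex_structure J ->
    exists j, [/\ cxs j, represents j J & classified j].
  by move=> /left_invariant_represented[j [hj hJ]]; exists j; split=> //; exact: cxs_classified.
split; first by split; [exact: Jbi_complex | exact: Jbi_bi_invariant].
split.
  move=> z hz; split; first exact: Jreg_complex.
  split; first exact: sim_regular (Jreg_rep z) (sim_refl _) (jreg_adD z).
  by move=> /(bi_invariant_cen (@basis_E R) (cxs_jreg hz) (Jreg_rep z)) /cen_jreg_E.
split; first exact: Jreg_smooth_family.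
split; first by split; [exact: Jof_complex (@cxs_jnon R) | exact: not_regular_Jnon].
split.
  move=> J /classify[j [hj hJ [jk | [z [hz jk]] | jk]]].
  - by left; exact: sim_equivalent hJ jk.
  - by right; left; exists z; [exact: hz | exact: sim_equivalent hJ jk].
  - by right; right; exact: sim_equivalent hJ jk.
split.
  move=> z w hz hw /(equivalent_rauto (Jreg_rep z) (Jreg_rep w))[phi [hphi jk]].
  exact: jreg_rauto hphi hz hw jk.
split.
  move=> z hz; split.
    by move=> /(equivalent_rauto Jbi_rep (Jreg_rep z))[phi [hphi /(jbi_jreg hphi)]].
  by move=> /(equivalent_rauto Jnon_rep (Jreg_rep z))[phi [hphi /(jnon_jreg hphi)]].
split.
  by move=> /(equivalent_rauto Jbi_rep Jnon_rep)[phi [hphi /(jbi_jnon hphi)]].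
split.
  move=> J /classify[j [hj hJ jk]] hbi.
  (* Bi-invariance makes the centraliser everything, and a similarity carries this to the model; E
     is then in a centraliser that excludes it for [jreg] and [jnon]. *)
  have cenj u : cen j u := bi_invariant_cen u hj hJ hbi.
  have cenk k phi : gen phi -> (forall v, phi (j v) = k (phi v)) -> cen k (@basis_E R).
    move=> /gen_rauto hphi phiE; have [_ _ _ ps] := hphi; have [v ->] := ps (@basis_E R).
    exact/(cen_rauto _ hphi phiE).
  case: jk => [jk | [z [hz [phi [gphi phiE]]]] | [phi [gphi phiE]]].
  - exact: sim_equivalent hJ jk.
  - by have /cen_jreg_E := cenk _ _ gphi phiE.
  - by have /cen_jnon /basisE_neq0 := cenk _ _ gphi phiE.
(* The models [jbi] and [jreg z] commute with the adjoint action of the diagonal torus, so whatever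
   is similar to them is regular. *)
move=> J /classify[j [hj hJ [jk | [z [hz jk]] | jk]]] nreg.
- by case: nreg; exact: sim_regular hJ jk (@jbi_adD R).
- by case: nreg; exact: sim_regular hJ jk (jreg_adD z).
- exact: sim_equivalent hJ jk.
Qed.
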